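(* Let $\lambda^D_k$ ($k\ge 1$) be the eigenvalues of the dynamic Laplacian $\Delta^D$ on $M$, and for $a>0$ let $\Lambda_{k,a}$, $\Lambda_{k,a}^{\mathrm{temp}}$ and $\Lambda_{k,a}^{\mathrm{spat}}$ ($k\ge 1$) be the eigenvalues, the temporal eigenvalues and the spatial eigenvalues, respectively, of the inflated dynamic Laplacian $\Delta_{G_{0,a}}$ on $\mathbb{M}_0=[0,\tau]\times M$ (all as defined in the context). Then: 1. For each $k\ge 1$ and $a>0$ one has $\lambda_k^D\le \Lambda_{k,a}^{\mathrm{spat}}$. 2. For each $k\ge 1$, the quantities $\Lambda_{k,a}$, $\Lambda_{k,a}^{\mathrm{temp}}$ and $\Lambda_{k,a}^{\mathrm{spat}}$ are nonincreasing functions of $a>0$. 3. For each $k\ge 1$, $\lim_{a\to\infty}\Lambda_{k,a}^{\mathrm{temp}}=-\infty$. 4. For each $k\ge 1$, $\lim_{a\to\infty}\Lambda_{k,a}^{\mathrm{spat}}=\lim_{a\to\infty}\Lambda_{k,a}=\lambda_k^D$.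
   Context: Setting. Let $0<\tau<\infty$ and let $v:[0,\tau]\times\mathbb{R}^d\to\mathbb{R}^d$ be a smooth time-dependent velocity field with $v(t,\cdot)$ divergence-free for every $t$. Let $M\subset\mathbb{R}^d$ be a $d$-dimensional, connected, compact, flat submanifold (possibly with smooth boundary; flat boundaryless domains such as a torus are also allowed). Let $\phi_t:M\to\phi_t(M)$ be the flow map of $\dot x_t=v(t,x_t)$ from time $0$ to time $t$ (a volume-preserving diffeomorphism onto its image), $J_t(x)=D\phi_t(x)$, and let $g_t=\phi_t^*e$ be the pullback to $M$ of the Euclidean metric $e$ on $\phi_t(M)$; its matrix at $x$ is $J_t(x)^\top J_t(x)$. Let $\ell$ be Lebesgue measure on $M$. For $f:M\to\mathbb{R}$, $\|\nabla_{g_t}f(x)\|_{g_t}^2=[\partial f(x)]^\top (J_t(x)^\top J_t(x))^{-1}[\partial f(x)]$, where $\partial f$ is the column vector of partial derivatives. Dynamic Laplacian. $\Delta^D=\frac1\tau\int_0^\tau \Delta_{g_t}\,dt$ on $L^2(M)$, where $\Delta_{g_t}$ is the Laplace--Beltrami operator of $(M,g_t)$, with its natural (''dynamic Neumann'') boundary condition, i.e. the natural boundary condition of the quadratic form below. It has discrete spectrum $0=\lambda_1^D>\lambda_2^D\ge\lambda_3^D\ge\cdots$ (with multiplicity) with eigenfunctions $\mathbf 1_M=f_1,f_2,\ldots$, and, writing $S_0=L^2(M)$ and $S_k=\{f\in L^2(M):\langle f,f_i\rangle=0,\ 1\le i\le k\}$, $$\lambda_k^D=-\inf_{f\in S_{k-1}}\frac{\int_0^\tau\int_M\|\nabla_{g_t}f\|_{g_t}^2\,d\ell\,dt}{\int_0^\tau\int_M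 f^2\,d\ell\,dt}.$$ Inflated dynamic Laplacian. For $a>0$, let $G_{0,a}$ be the Riemannian metric on $\mathbb{M}_0=[0,\tau]\times M$ with block-diagonal matrix $\mathrm{diag}(1/a^2,\ J_t(x)^\top J_t(x))$ at $(t,x)$. Its Laplace--Beltrami operator is $\Delta_{G_{0,a}}F(t,\cdot)=a^2\partial_{tt}F(t,\cdot)+\Delta_{g_t}F(t,\cdot)$, taken with homogeneous Neumann boundary conditions. It is self-adjoint on $L^2(\mathbb{M}_0)$ with associated quadratic form $-\iint_{\mathbb{M}_0}\left(a^2(\partial_tF)^2+\|\nabla_{g_t}F(t,\cdot)\|_{g_t}^2\right)d\ell\,dt$ on $H^1(\mathbb{M}_0)$, and has discrete spectrum $0=\Lambda_{1,a}>\Lambda_{2,a}\ge\Lambda_{3,a}\ge\cdots$ (with multiplicity). Temporal and spatial eigenvalues. For $k\ge1$, $F_k^{\mathrm{temp}}(t,x)=\cos(k\pi t/\tau)$ is an eigenfunction with eigenvalue $\Lambda_{k,a}^{\mathrm{temp}}:=-(a\pi k/\tau)^2$ (the temporal eigenvalues). Let $\mathbb{S}_0^{\mathrm{temp}}=\{(t,x)\mapsto f(t): f\in L^2([0,\tau]),\ \int_0^\tau f\,dt=0\}\subset L^2(\mathbb{M}_0)$ and $\mathbb{S}_0^{\mathrm{spat}}=(\mathbb{S}_0^{\mathrm{temp}})^\perp$, which is the set of $F\in L^2(\mathbb{M}_0)$ for which $t\mapsto\int_MF(t,\cdot)\,d\ell$ is a.e. constant. The spatial eigenvalues $0=\Lambda_{1,a}^{\mathrm{spat}}>\Lambda_{2,a}^{\mathrm{spat}}\ge\Lambda_{3,a}^{\mathrm{spat}}\ge\cdots$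 are the eigenvalues, with multiplicity, of $\Delta_{G_{0,a}}$ whose eigenfunctions lie in $\mathbb{S}_0^{\mathrm{spat}}$; the spectrum of $\Delta_{G_{0,a}}$ counted with multiplicity is the union of the temporal and the spatial eigenvalues. *)

(* Defs.v *)
From HB Require Import structures.
From mathcomp Require Import all_boot all_order all_algebra.
From mathcomp Require Import all_classical all_reals all_analysis.

Set Implicit Arguments.
Unset Strict Implicit.
Unset Printing Implicit Defensive.

Import Order.TTheory GRing.Theory Num.Theory.
Import numFieldNormedType.Exports.

Local Open Scope classical_set_scope.
Local Open Scope ring_scope.

Definition rV_display : measure_display -> measure_display.
Proof. exact. Qed.

Section measurable_rV.
Context {d : measure_display} {T : sigmaRingType d}.
Variable n : nat.

Let coors : 'I_n -> 'rV[T]_n -> T := fun i x => x ord0 i.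

Let rV_set0 : g_sigma_preimage coors set0.
Proof. exact: sigma_algebra0. Qed.

Let rV_setC A : g_sigma_preimage coors A -> g_sigma_preimage coors (~` A).
Proof. exact: sigma_algebraC. Qed.

Let rV_bigcup (F : _^nat) : (forall i, g_sigma_preimage coors (F i)) ->
  g_sigma_preimage coors (\bigcup_i (F i)).
Proof. exact: sigma_algebra_bigcup. Qed.

(* The product sigma-algebra, generated by the coordinate maps; for T = R
   it is the Borel sigma-algebra of R^n. *)
HB.instance Definition _ := @isMeasurable.Build (rV_display d)
  'rV[T]_n (g_sigma_preimage coors) rV_set0 rV_setC rV_bigcup.

End measurable_rV.

Section measurable_fun_rV.
Context d1 d2 (T1 : measurableType d1) (T2 : measurableType d2).

Lemma measurable_coord_rV n (i : 'I_n) :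
  measurable_fun [set: 'rV[T2]_n] (fun x : 'rV[T2]_n => x ord0 i).
Proof.
move=> _ Y mY; rewrite setTI; apply: sub_sigma_algebra => /=.
rewrite -bigcup_seq/=; exists i => /=; first by rewrite mem_index_enum.
by exists Y => //; rewrite setTI.
Qed.

Lemma measurable_fun_rVP n (f : T1 -> 'rV[T2]_n) :
  (forall i, measurable_fun [set: T1] (fun x => f x ord0 i)) ->
  measurable_fun [set: T1] f.
Proof.
move=> mf _ A mA; rewrite setTI; move: A mA.
suff : g_sigma_preimage (fun i (x : 'rV[T2]_n) => x ord0 i) `<=`
    [set A | measurable (f @^-1` A)] by [].
apply: smallest_sub.
  split=> /=; first by rewrite preimage_set0.
    by move=> A mA; rewrite setTD preimage_setC; exact: measurableC.
  by move=> F mF; rewrite preimage_bigcup; exact: bigcup_measurable.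
rewrite -bigcup_seq/=; apply: bigcup_sub => i _ _ [B mB <-] /=.
by rewrite setTI -comp_preimage -[X in measurable X]setTI; exact: mf.
Qed.

End measurable_fun_rV.

Section lebesgue_rV.
Context {R : realType}.

Definition cons_rV n (p : measurableTypeR R * 'rV[R]_n) : 'rV[R]_n.+1 :=
  row_mx (p.1%:M : 'rV[R]_1) p.2.

Definition uncons_rV n (x : 'rV[R]_n.+1) : measurableTypeR R * 'rV[R]_n :=
  (x ord0 ord0, \row_i x ord0 (lift ord0 i)).

Lemma uncons_rVK n : cancel (@uncons_rV n) (@cons_rV n).
Proof.
move=> x; apply/rowP => i; rewrite /cons_rV /uncons_rV /=.
case: (split_ordP (i : 'I_(1 + n))) => j ->.
  by rewrite (@row_mxEl _ 1 1 n) !ord1 mxE mulr1n; congr (x _ _); exact/val_inj.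
by rewrite (@row_mxEr _ 1 1 n) mxE; congr (x _ _); exact/val_inj.
Qed.

Lemma cons_rVK n : cancel (@cons_rV n) (@uncons_rV n).
Proof.
move=> [t x]; rewrite /cons_rV /uncons_rV /=; congr pair.
  rewrite (_ : ord0 = lshift n (ord0 : 'I_1)); last exact/val_inj.
  by rewrite (@row_mxEl _ 1 1 n) mxE mulr1n.
apply/rowP => i; rewrite mxE.
rewrite (_ : lift ord0 i = rshift 1 i); last exact/val_inj.
by rewrite (@row_mxEr _ 1 1 n).
Qed.

Lemma measurable_cons_rV n : measurable_fun [set: _] (@cons_rV n).
Proof.
apply: measurable_fun_rVP => i.
case: (split_ordP (i : 'I_(1 + n))) => j ->.
  apply: (eq_measurable_fun fst) => [p _|//].
  by rewrite /cons_rV (@row_mxEl _ 1 1 n) !ord1 mxE mulr1n.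
apply: (eq_measurable_fun ((fun x : 'rV[R]_n => x ord0 j) \o snd)) => [p _|].
  by rewrite /cons_rV (@row_mxEr _ 1 1 n).
by apply: measurableT_comp => //; exact: measurable_coord_rV.
Qed.

Lemma measurable_uncons_rV n : measurable_fun [set: _] (@uncons_rV n).
Proof.
apply/measurable_fun_pairP; split; first exact: measurable_coord_rV.
apply: measurable_fun_rVP => i.
apply: (eq_measurable_fun (fun x : 'rV[R]_n.+1 => x ord0 (lift ord0 i))).
  by move=> x _; rewrite /= mxE.
exact: measurable_coord_rV.
Qed.

Section step.
Variables (n : nat) (mu : {sigma_finite_measure set 'rV[R]_n -> \bar R}).

Definition lebesgue_rV_step : set 'rV[R]_n.+1 -> \bar R :=
  pushforward (lebesgue_measure \x mu)%E (@cons_rV n).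

Let preimage_cons_measurable A :
  measurable A -> measurable (@cons_rV n @^-1` A).
Proof.
by move=> mA; rewrite -[X in measurable X]setTI; exact: measurable_cons_rV.
Qed.

Let step0 : lebesgue_rV_step set0 = 0%E.
Proof. by rewrite /lebesgue_rV_step /pushforward preimage_set0 measure0. Qed.

Let step_ge0 A : (0 <= lebesgue_rV_step A)%E.
Proof. exact: (measure_ge0 (lebesgue_measure \x mu)%E). Qed.

Let step_sigma_additive : semi_sigma_additive lebesgue_rV_step.
Proof.
move=> F mF tF mUF; rewrite /lebesgue_rV_step /pushforward preimage_bigcup.
apply: measure_semi_sigma_additive.
- by move=> i; exact: preimage_cons_measurable.
- apply/trivIsetP => /= i j _ _ ij; rewrite -preimage_setI.
  by move/trivIsetP : tF => /(_ _ _ _ _ ij) ->//; rewrite preimage_set0.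
- by rewrite -preimage_bigcup; exact: preimage_cons_measurable.
Qed.

HB.instance Definition _ := isMeasure.Build _ _ _
  lebesgue_rV_step step0 step_ge0 step_sigma_additive.

Let step_sigma_finite : sigma_finite setT lebesgue_rV_step.
Proof.
have /sigma_finiteP[F [TF ndF Foo]] := sigma_finiteT (@lebesgue_measure R).
have /sigma_finiteP[H [TH ndH Hoo]] := sigma_finiteT mu.
exists (fun i => @uncons_rV n @^-1` (F i `*` H i)).
  rewrite -preimage_bigcup (_ : \bigcup_i _ = setT) ?preimage_setT//.
  rewrite -setXTT TF TH predeqE => -[x y]; split.
    by move=> [i _ []/= ? ?]; split; exists i.
  move=> [/= [i _ Fix] [k _ Hky]]; exists (maxn i k) => //; split.
  - by move: x Fix; exact/subsetPset/ndF/leq_maxl.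
  - by move: y Hky; exact/subsetPset/ndH/leq_maxr.
move=> i; have [mF Fi] := Foo i; have [mH Hi] := Hoo i; split.
  rewrite -[X in measurable X]setTI; apply: measurable_uncons_rV => //.
  exact: measurableX.
rewrite /lebesgue_rV_step /pushforward -comp_preimage.
rewrite (_ : _ \o _ = id); last by apply/funext => p; exact: cons_rVK.
by rewrite preimage_id product_measure1E// lte_mul_pinfty// ge0_fin_numE.
Qed.

HB.instance Definition _ := Measure_isSigmaFinite.Build _ _ _
  lebesgue_rV_step step_sigma_finite.

End step.

(* Lebesgue measure on R^n as the n-fold product of the one on R. *)
Fixpoint lebesgue_rV n : {sigma_finite_measure set 'rV[R]_n -> \bar R} :=
  if n is n'.+1 return {sigma_finite_measure set 'rV[R]_n -> \bar R}
  then lebesgue_rV_step (lebesgue_rV n') else \d_(0 : 'rV[R]_0).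

End lebesgue_rV.

Section smooth.
Context {R : realType} {V W : normedModType R}.

Definition smooth (f : V -> W) : Prop :=
  forall (s : seq V) (x : V), differentiable (foldr (fun u g => 'D_u g) f s) x.

End smooth.

Section test_functions.
Context {R : realType} {V : normedModType R}.
Implicit Types (G A : set V) (f : V -> R).

Definition periodic (W : Type) G (f : V -> W) : Prop :=
  forall u x, G u -> f (x + u) = f x.

(* The smooth functions on A / G with support in the interior of A / G, as
   G-periodic functions on V; when A / G is compact, so is the support. *)
Definition test_function G A : set (V -> R) :=
  [set psi | [/\ smooth psi, periodic G psi &
                 closure [set x | psi x != 0] `<=` A°]].

Section weak_derivative.
Variables (L : set (V -> R)) (ip : (V -> R) -> (V -> R) -> R).
Variable test : set (V -> R).

Definition is_weak_derivative (u : V) f g : Prop :=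
  L g /\ forall psi, test psi -> ip f ('D_u psi) = - ip g psi.

(* A weak derivative is unique up to null sets; this picks one if any. *)
Definition weak_derivative (u : V) f : V -> R :=
  xget (cst 0) [set g | is_weak_derivative u f g].

Definition sobolev1 : set (V -> R) :=
  [set f | L f /\ forall u, exists g, is_weak_derivative u f g].

End weak_derivative.
End test_functions.

Section forms.
Context {R : realType} {T : Type}.
Local Notation fct := (T -> R).
Variables (L : set fct) (ip : fct -> fct -> R).

(* [form_operator dom E f g] : f is in the domain of the operator A of the
   space (L, ip) with quadratic form -E on dom, and A f = g.  Membership of
   f in dom without further boundary condition encodes the natural
   (Neumann) boundary condition. *)
Definition form_operator (dom : set fct) (E : fct -> fct -> R) (f g : fct) :=
  [/\ dom f, L g & forall h, dom h -> - E f h = ip g h].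

Variable A : fct -> fct -> Prop.

Definition eigenvector (mu : R) (f : fct) : Prop := A f (fun x => mu * f x).

(* lam lists the eigenvalues of A with eigenvectors in S, in nonincreasing
   order and repeated according to multiplicity, with orthonormal
   eigenvectors e; by the last clause no eigenvector in S is missed. *)
Definition eigensystem (S : set fct) (lam : nat -> R) (e : nat -> fct) : Prop :=
  [/\ forall i j, (i <= j)%N -> lam j <= lam i,
      forall k, S (e k) /\ eigenvector (lam k) (e k),
      forall i j, ip (e i) (e j) = (i == j)%:R &
      forall mu f, S f -> eigenvector mu f ->
        (forall k, ip f (e k) = 0) -> ip f f = 0].

Definition eigenvalues_in (S : set fct) (lam : nat -> R) : Prop :=
  exists e, eigensystem S lam e.

(* The spectrum of A is discrete and lam lists it: the eigenvectors are
   complete in L and the eigenvalues do not accumulate. *)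
Definition discrete_spectrum (lam : nat -> R) : Prop :=
  exists e, [/\ eigensystem L lam e,
    lam k @[k --> \oo] --> -oo &
    forall f, L f -> (forall k, ip f (e k) = 0) -> ip f f = 0].

End forms.

Section setting.
Context {R : realType} {d : nat}.
Local Notation V := 'rV[R]_d.
Implicit Types (G M D : set V) (v phi : R -> V -> V) (tau a t : R).

Definition translation_lattice G : Prop :=
  [/\ G 0, forall u w, G u -> G w -> G (u - w) &
      exists2 r : R, 0 < r & forall u, G u -> `|u| < r -> u = 0].

(* M is the preimage in R^d of a nonempty connected compact d-dimensional
   submanifold, possibly with smooth boundary, of the flat manifold R^d / G.
   For G = [set 0] this is a submanifold M of R^d itself; if G is a full
   lattice and M = setT it is a flat torus. *)
Record flat_manifold G M : Prop := FlatManifold {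
  flat_lattice : translation_lattice G ;
  flat_nonempty : M !=set0 ;
  flat_closed : closed M ;
  flat_invariant : forall x u, M x -> G u -> M (x + u) ;
  flat_boundary : forall p, M p -> ~ M° p ->
    exists rho : V -> R, [/\ smooth rho,
      exists u, 'D_u rho p != 0 &
      \forall x \near p, M x <-> rho x <= 0] ;
  flat_compact : exists2 K : set V, compact K &
    forall x, M x -> exists y u, [/\ K y, G u & x = y + u] ;
  flat_connected : forall B : set V, B !=set0 ->
    (forall x u, B x -> G u -> B (x + u)) ->
    (exists2 C, open C & B = M `&` C) ->
    (exists2 C, closed C & B = M `&` C) -> B = M
}.

(* A measurable set of representatives of R^d / G; it is the whole space if
   G = [set 0].  Functions on M / G are functions on M `&` D. *)
Definition fundamental_domain G D : Prop :=
  measurable D /\ forall x, exists! u, G u /\ D (x - u).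

(* A map on [0, tau] x A, A closed, is smooth iff it is the restriction of a
   smooth map on R x R^d; v and phi denote such extensions, and they are
   constrained only on [0, tau] x R^d and [0, tau] x M respectively. *)
Definition velocity_field tau G v : Prop :=
  smooth (fun p : R * V => v p.1 p.2) /\
  forall t, 0 <= t <= tau ->
    periodic G (v t) /\
    forall x, \tr ('J (v t) x) = 0.

Definition flow_map tau M v phi : Prop :=
  smooth (fun p : R * V => phi p.1 p.2) /\
  forall x, M x -> phi 0 x = x /\
    forall t, 0 <= t <= tau ->
      is_derive t 1 (fun s => phi s x) (v t (phi t x)).

(* 'J f x acts on row vectors from the right, hence the transposition. *)
Definition flow_jacobian phi t x : 'M[R]_d := ('J (phi t) x)^T.

Definition pullback_metric phi t x : 'M[R]_d :=
  (flow_jacobian phi t x)^T *m flow_jacobian phi t x.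

(* The inner product for the pulled back metric of the gradients of two
   functions with partial derivatives p and q. *)
Definition grad_dot phi t x (p q : V) : R :=
  (p *m invmx (pullback_metric phi t x) *m q^T) ord0 ord0.

Definition L2_M M D : set (V -> R) :=
  [set f | f \_ (M `&` D) \in Lfun (lebesgue_rV d) 2%:E].

Definition ip_M M D (f h : V -> R) : R :=
  \int[lebesgue_rV d]_(x in M `&` D) (f x * h x).

Definition H1_M G M D : set (V -> R) :=
  sobolev1 (L2_M M D) (ip_M M D) (test_function G M).

Definition partials G M D (f : V -> R) (x : V) : V :=
  \row_i weak_derivative (L2_M M D) (ip_M M D) (test_function G M)
    (delta_mx ord0 i) f x.

Definition dirichlet_form G M D phi t (f h : V -> R) : R :=
  \int[lebesgue_rV d]_(x in M `&` D)
    grad_dot phi t x (partials G M D f x) (partials G M D h x).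

Definition dynamic_form tau G M D phi (f h : V -> R) : R :=
  tau^-1 * \int[lebesgue_measure]_(t in `[0, tau]) dirichlet_form G M D phi t f h.

Definition dynamic_laplacian tau G M D phi : (V -> R) -> (V -> R) -> Prop :=
  form_operator (L2_M M D) (ip_M M D) (H1_M G M D) (dynamic_form tau G M D phi).

Local Notation F := (R * V -> R).

Definition L2_M0 tau M D : set F :=
  [set f | f \_ (`[0, tau] `*` (M `&` D)) \in
    Lfun (lebesgue_measure \x lebesgue_rV d)%E 2%:E].

Definition ip_M0 tau M D (f h : F) : R :=
  \int[(lebesgue_measure \x lebesgue_rV d)%E]_(p in `[0, tau] `*` (M `&` D))
    (f p * h p).

Definition test_M0 tau G M : set F :=
  test_function ([set 0] `*` G) (`[0, tau] `*` M).

Definition H1_M0 tau G M D : set F :=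
  sobolev1 (L2_M0 tau M D) (ip_M0 tau M D) (test_M0 tau G M).

Definition time_partial tau G M D (f : F) : F :=
  weak_derivative (L2_M0 tau M D) (ip_M0 tau M D) (test_M0 tau G M) (1, 0) f.

Definition space_partials tau G M D (f : F) (p : R * V) : V :=
  \row_i weak_derivative (L2_M0 tau M D) (ip_M0 tau M D) (test_M0 tau G M)
    (0, delta_mx ord0 i) f p.

Definition inflated_form tau G M D phi a (f h : F) : R :=
  \int[(lebesgue_measure \x lebesgue_rV d)%E]_(p in `[0, tau] `*` (M `&` D))
    (a ^+ 2 * time_partial tau G M D f p * time_partial tau G M D h p +
     grad_dot phi p.1 p.2
       (space_partials tau G M D f p) (space_partials tau G M D h p)).

Definition inflated_laplacian tau G M D phi a : F -> F -> Prop :=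
  form_operator (L2_M0 tau M D) (ip_M0 tau M D) (H1_M0 tau G M D)
    (inflated_form tau G M D phi a).

Definition S0_temp tau : set F :=
  [set f | exists g : R -> R,
    [/\ g \_ `[0, tau] \in Lfun lebesgue_measure 2%:E,
        \int[lebesgue_measure]_(t in `[0, tau]) g t = 0 &
        f = fun p => g p.1]].

Definition S0_spat tau M D : set F :=
  [set f | L2_M0 tau M D f /\
    forall h, S0_temp tau h -> ip_M0 tau M D f h = 0].

End setting.

Definition temporal_eigenvalue (R : realType) (tau a : R) (k : nat) : R :=
  - (a * pi * k%:R / tau) ^+ 2.

(* Main.v *)
(* By the min-max principle, each inequality between eigenvalues follows by
   testing the form of one operator on the eigenvectors of the other.  The
   lift f(x) of f in H^1(M) satisfies E_a(f, f) = tau * Edyn(f, f) for the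
   forms of the two operators and is a spatial function, so
   lamD_k <= Lam_spat_k; and E_a is nondecreasing in a.  The spatial
   eigenvectors are complete among the spatial functions because H^1(M_0)
   splits E_a-orthogonally into the functions of t with mean 0 and the
   functions whose average over M does not depend on t.
   For the limit, suppose that - Lam_k <= m for all a = n + 1.  Choose a unit
   F_n in the span of the first k eigenvectors for a = n + 1, orthogonal to the
   lifts of the first k - 1 eigenvectors of the dynamic Laplacian.  Its energy
   is at most m, so || d_t F_n ||^2 <= m / (n + 1)^2 while the spatial gradients
   stay bounded.  Along an ultrafilter F_n and its gradients converge weakly,
   and the limit w has d_t w = 0, that is, w is the lift of some f in H^1(M).
   No mass is lost: the eigenvalues for a = 1 tend to infinity and bound the
   tails of F_n uniformly, so || w || >= 1.  Lower semicontinuity gives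
   Edyn(f, f) <= m * <f, f>, whence - lamD_k <= m. *)

Require Import Defs.
From HB Require Import structures.
From mathcomp Require Import all_boot all_order all_algebra.
From mathcomp Require Import all_classical all_reals all_analysis.
From mathcomp Require Import measurable_realfun ring lra.

Set Implicit Arguments.
Unset Strict Implicit.
Unset Printing Implicit Defensive.

Import Order.TTheory GRing.Theory Num.Theory.
Import numFieldNormedType.Exports.

Local Open Scope classical_set_scope.
Local Open Scope ring_scope.

(** * Positive semidefinite forms and orthonormal systems *)

(** Functions are never identified modulo null sets: the spaces carry degenerate forms, and a
    difference [h] with [ip h h = 0] replaces equality. The weak derivatives, being chosen, are
    determined only up to null functions, so every computation with them rests on the fundamental
    lemma of the calculus of variations. Test functions are supported in the interior of M, hence
    that lemma requires the boundary of M to be null; they are also periodic, hence it is proved on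
    small boxes whose lattice translates are disjoint. The inverse metric has to be bounded and
    uniformly elliptic up to the boundary. As [phi] is controlled only on M, this comes from a
    two-sided Gronwall estimate on the distance between two trajectories starting in M, then from
    difference quotients at interior points, then from continuity. No compact embedding of H^1 is
    proved: its role is taken by the discreteness of the spectra, which belongs to the hypotheses
    and supplies total orthonormal systems in both L^2 spaces. *)

Section psd_form.
Context {R : realType} {U : lmodType R}.
Implicit Types (D : set U) (B : U -> U -> R).

(** The axioms hold only on [D], because an integral of products is bilinear only among square
    integrable functions. Degenerate forms are allowed, since functions that agree almost everywhere
    stay distinct. *)
Record psd_form D B : Prop := PsdForm {
  psd0 : D 0 ;
  psd_closed : forall c f g, D f -> D g -> D (c *: f + g) ;
  psdC : forall f g, D f -> D g -> B f g = B g f ;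
  psd_linear : forall c f g h, D f -> D g -> D h ->
    B (c *: f + g) h = c * B f h + B g h ;
  psd_ge0 : forall f, D f -> 0 <= B f f }.

Variables (D : set U) (B : U -> U -> R).
Hypothesis psdB : psd_form D B.

Let D0 := psd0 psdB.
Let Dlin := psd_closed psdB.
Let BC := psdC psdB.
Let Blin := psd_linear psdB.
Let B_ge0 := psd_ge0 psdB.

Lemma psdZ_closed c f : D f -> D (c *: f).
Proof. by move=> Df; rewrite -[_ *: _]addr0; exact: Dlin. Qed.

Lemma psdD_closed f g : D f -> D g -> D (f + g).
Proof. by move=> Df Dg; rewrite -[f]scale1r; exact: Dlin. Qed.

Lemma psdB_closed f g : D f -> D g -> D (f - g).
Proof. by move=> Df Dg; rewrite addrC -scaleN1r; exact: Dlin. Qed.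

Lemma psd_sum_closed n (c : 'I_n -> R) (e : 'I_n -> U) :
  (forall i, D (e i)) -> D (\sum_(i < n) c i *: e i).
Proof.
by move=> De; elim/big_ind : _ => // *; [exact: psdD_closed|exact: psdZ_closed].
Qed.

Lemma psd0l h : D h -> B 0 h = 0.
Proof.
by move=> Dh; have := Blin 1 D0 D0 Dh; rewrite scaler0 addr0 mul1r => ?; lra.
Qed.

Lemma psdZl c f h : D f -> D h -> B (c *: f) h = c * B f h.
Proof. by move=> Df Dh; rewrite -[_ *: _]addr0 Blin// psd0l// addr0. Qed.

Lemma psdDl f g h : D f -> D g -> D h -> B (f + g) h = B f h + B g h.
Proof. by move=> Df Dg Dh; rewrite -[f]scale1r Blin// mul1r scale1r. Qed.

Lemma psdBl f g h : D f -> D g -> D h -> B (f - g) h = B f h - B g h.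
Proof.
by move=> Df Dg Dh; rewrite addrC -scaleN1r Blin// mulN1r addrC.
Qed.

Lemma psd0r h : D h -> B h 0 = 0.
Proof. by move=> Dh; rewrite BC// psd0l. Qed.

Lemma psdZr c f h : D f -> D h -> B h (c *: f) = c * B h f.
Proof. by move=> Df Dh; rewrite BC ?psdZl ?(BC Df)//; exact: psdZ_closed. Qed.

Lemma psdDr f g h : D f -> D g -> D h -> B h (f + g) = B h f + B h g.
Proof.
by move=> Df Dg Dh; rewrite BC ?psdDl ?(BC Df) ?(BC Dg)//; exact: psdD_closed.
Qed.

Lemma psdBr f g h : D f -> D g -> D h -> B h (f - g) = B h f - B h g.
Proof.
by move=> Df Dg Dh; rewrite BC ?psdBl ?(BC Df) ?(BC Dg)//; exact: psdB_closed.
Qed.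

Lemma psd_suml n (c : 'I_n -> R) (e : 'I_n -> U) h :
  (forall i, D (e i)) -> D h ->
  B (\sum_(i < n) c i *: e i) h = \sum_(i < n) c i * B (e i) h.
Proof.
move=> De Dh.
suff [] : D (\sum_(i < n) c i *: e i) /\
  B (\sum_(i < n) c i *: e i) h = \sum_(i < n) c i * B (e i) h by [].
elim/big_ind2 : _ => [|x a y b [Dx Bx] [Dy By]|i _]; first by rewrite psd0l.
- by split; [exact: psdD_closed|rewrite psdDl// Bx By].
- by split; [exact: psdZ_closed|rewrite psdZl].
Qed.

Lemma psd_sqB f g : D f -> D g ->
  B (f - g) (f - g) = B f f - 2 * B f g + B g g.
Proof.
move=> Df Dg; rewrite psdBl ?psdBr ?(BC Dg Df)//; last exact: psdB_closed.
by ring.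
Qed.

Lemma psd_sqD f g : D f -> D g ->
  B (f + g) (f + g) = B f f + 2 * B f g + B g g.
Proof.
move=> Df Dg; rewrite psdDl ?psdDr ?(BC Dg Df)//; last exact: psdD_closed.
by ring.
Qed.

Lemma cauchy_schwarz f g : D f -> D g -> B f g ^+ 2 <= B f f * B g g.
Proof.
move=> Df Dg; have gg := B_ge0 Dg.
have H c : 0 <= B f f - 2 * c * B f g + c ^+ 2 * B g g.
  have := B_ge0 (psdB_closed Df (psdZ_closed c Dg)).
  rewrite psd_sqB ?psdZr ?psdZl//; try exact: psdZ_closed.
  by rewrite !mulrA expr2.
have [gg0|gg0] := eqVneq (B g g) 0.
  have [fg0|fg0] := eqVneq (B f g) 0; first by rewrite fg0 gg0 mulr0 expr0n.
  (* With [B g g = 0] the polynomial in [c] is affine; at this [c] it would equal -1. *)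
  have := H ((B f f + 1) / (2 * B f g)).
  rewrite gg0 !mulr0 addr0.
  have -> : B f f - 2 * ((B f f + 1) / (2 * B f g)) * B f g = -1 by field.
  by move=> ?; lra.
have gg1 : 0 < B g g by rewrite lt_neqAle eq_sym gg0.
have := H (B f g / B g g).
have -> : B f f - 2 * (B f g / B g g) * B f g + (B f g / B g g) ^+ 2 * B g g =
  B f f - B f g ^+ 2 / B g g by field.
by rewrite subr_ge0 ler_pdivrMr.
Qed.

(** By Cauchy-Schwarz a null vector pairs to 0 with everything, so representatives may be exchanged
    inside the form; this takes the place of a quotient space. *)
Lemma psd_null f g : D f -> D g -> B f f = 0 -> B f g = 0.
Proof.
move=> Df Dg ff; have := cauchy_schwarz Df Dg.
by rewrite ff mul0r => fg; apply/eqP; rewrite -sqrf_eq0 eq_le fg sqr_ge0.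
Qed.

Lemma psd_nullB f g h : D f -> D g -> D h -> B (f - g) (f - g) = 0 ->
  B f h = B g h.
Proof.
move=> Df Dg Dh fg; have := psd_null (psdB_closed Df Dg) Dh fg.
by rewrite psdBl// => /eqP; rewrite subr_eq0 => /eqP.
Qed.

Definition orthonormal_seq (e : nat -> U) :=
  (forall i, D (e i)) /\ forall i j, B (e i) (e j) = (i == j)%:R.

Definition partial_sum (e : nat -> U) (c : nat -> R) N :=
  \sum_(i < N) c i *: e i.

Section orthonormal.
Variable e : nat -> U.
Hypothesis oe : orthonormal_seq e.

Let De : forall i, D (e i) := proj1 oe.

Lemma partial_sum_closed c N : D (partial_sum e c N).
Proof. exact: psd_sum_closed. Qed.

Lemma partial_sum_coef c N j :
  B (partial_sum e c N) (e j) = if (j < N)%N then c j else 0.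
Proof.
rewrite psd_suml//; case: ifPn => jN.
  rewrite (bigD1 (Ordinal jN))//= big1 ?addr0.
    by rewrite (proj2 oe) eqxx mulr1.
  move=> i ij; rewrite (proj2 oe) (_ : (_ == _) = false) ?mulr0//.
  by apply/negbTE; apply: contra ij => /eqP ij; apply/eqP/val_inj.
rewrite big1// => i _; rewrite (proj2 oe) (_ : (_ == _) = false) ?mulr0//.
by apply/negbTE; apply: contra jN => /eqP <-.
Qed.

Lemma partial_sum_dot c N f : D f ->
  B f (partial_sum e c N) = \sum_(i < N) c i * B f (e i).
Proof.
move=> Df; rewrite BC ?psd_suml//; last exact: partial_sum_closed.
by apply: eq_bigr => i _; rewrite BC.
Qed.

Lemma partial_sum_sq c N :
  B (partial_sum e c N) (partial_sum e c N) = \sum_(i < N) c i ^+ 2.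
Proof.
rewrite partial_sum_dot; last exact: partial_sum_closed.
by apply: eq_bigr => i _; rewrite partial_sum_coef ltn_ord expr2.
Qed.

Lemma partial_sum_sub c m n : (m <= n)%N ->
  B (partial_sum e c n - partial_sum e c m)
    (partial_sum e c n - partial_sum e c m) =
  \sum_(m <= i < n) c i ^+ 2.
Proof.
move=> mn; have Dm := partial_sum_closed c m; have Dn := partial_sum_closed c n.
rewrite psd_sqB// !partial_sum_sq partial_sum_dot//.
have -> : \sum_(i < m) c i * B (partial_sum e c n) (e i) =
    \sum_(i < m) c i ^+ 2.
  apply: eq_bigr => i _.
  by rewrite partial_sum_coef (leq_trans (ltn_ord i) mn) -expr2.
rewrite -!(big_mkord xpredT (fun i => c i ^+ 2)) (big_cat_nat (n := m))//=.
by ring.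
Qed.

Lemma bessel_eq f N : D f ->
  B (f - partial_sum e (fun i => B f (e i)) N)
    (f - partial_sum e (fun i => B f (e i)) N) =
  B f f - \sum_(i < N) B f (e i) ^+ 2.
Proof.
move=> Df; rewrite psd_sqB//; last exact: partial_sum_closed.
rewrite partial_sum_sq partial_sum_dot//.
by under eq_bigr do rewrite -expr2; ring.
Qed.

Lemma bessel f N : D f -> \sum_(i < N) B f (e i) ^+ 2 <= B f f.
Proof.
move=> Df; rewrite -subr_ge0 -bessel_eq//.
by apply/B_ge0/psdB_closed => //; exact: partial_sum_closed.
Qed.

(** This is the dimension count of the min-max principle: the matrix of the [B (e i) (g j)] has k +
    1 rows and rank at most k, so some nonzero row vector kills it, and that vector is
    normalised. *)
Lemma orthonormal_combination k (g : 'I_k -> U) : (forall j, D (g j)) ->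
  exists c : nat -> R, [/\ \sum_(i < k.+1) c i ^+ 2 = 1 &
    forall j, B (partial_sum e c k.+1) (g j) = 0].
Proof.
move=> Dg; pose A : 'M[R]_(k.+1, k) := \matrix_(i, j) B (e i) (g j).
have /rowV0Pn[v vA v0] : kermx A != 0.
  rewrite -mxrank_eq0 mxrank_ker -lt0n subn_gt0.
  by rewrite (leq_ltn_trans (rank_leq_col A)).
have Q0 : 0 < \sum_(i < k.+1) v ord0 i ^+ 2.
  rewrite lt_neqAle sumr_ge0 ?andbT; last by move=> i _; exact: sqr_ge0.
  apply: contra v0; rewrite eq_sym psumr_eq0; last by move=> i _; exact: sqr_ge0.
  move=> /allP H; apply/eqP/rowP => i; rewrite mxE; apply/eqP.
  by rewrite -sqrf_eq0; apply: H; rewrite mem_index_enum.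
set Q := \sum_(i < _) _ in Q0.
exists (fun i => v ord0 (inord i) / Num.sqrt Q); split.
  under eq_bigr do rewrite inord_val expr_div_n sqr_sqrtr ?(ltW Q0)//.
  by rewrite -mulr_suml divff// gt_eqF.
move=> j; rewrite psd_suml//.
move/sub_kermxP : vA => /rowP/(_ j); rewrite !mxE => vA.
transitivity ((\sum_(i < k.+1) v ord0 i * B (e i) (g j)) / Num.sqrt Q).
  by rewrite mulr_suml; apply: eq_bigr => i _; rewrite inord_val mulrAC.
rewrite (_ : \sum_(i < k.+1) _ = 0) ?mul0r// -[RHS]vA.
by apply: eq_bigr => i _; rewrite mxE.
Qed.

End orthonormal.

(** Completeness for the seminorm of [B]; the limit [w] is one representative among those that
    differ by a null vector. *)
Definition psd_complete := forall u : nat -> U, (forall n, D (u n)) ->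
  (forall eps, 0 < eps -> exists N, forall m n, (N <= m)%N -> (m <= n)%N ->
     B (u n - u m) (u n - u m) <= eps) ->
  exists2 w, D w & forall eps, 0 < eps -> exists N, forall n, (N <= n)%N ->
     B (w - u n) (w - u n) <= eps.

Section complete.
Hypothesis complB : psd_complete.
Variable e : nat -> U.
Hypothesis oe : orthonormal_seq e.

Let De : forall i, D (e i) := proj1 oe.

Lemma riesz_fischer (c : nat -> R) (C : R) :
  (forall N, \sum_(i < N) c i ^+ 2 <= C) ->
  exists w, [/\ D w, forall i, B w (e i) = c i &
    forall eps, 0 < eps -> exists N, forall n, (N <= n)%N ->
     B (w - partial_sum e c n) (w - partial_sum e c n) <= eps].
Proof.
move=> cC.
have /complB[] : forall n, D (partial_sum e c n).
  by move=> n; exact: partial_sum_closed.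
- move=> eps eps0.
  have : cvgn (fun N => \sum_(i < N) c i ^+ 2).
    apply: nondecreasing_is_cvgn.
      apply/nondecreasing_seqP => n; rewrite big_ord_recr/= lerDl.
      exact: sqr_ge0.
    by exists C => _ [n _ <-].
  move=> /cauchy_cvgP /cauchy_ballP /(_ _ eps0)[[A1 A2] /= [[N1 _ HN1] [N2 _ HN2]] H].
  exists (maxn N1 N2) => m n Nm mn; rewrite partial_sum_sub//.
  have := H (\sum_(i < n) c i ^+ 2, \sum_(i < m) c i ^+ 2); rewrite /ball/= => {}H.
  have : `|\sum_(i < n) c i ^+ 2 - \sum_(i < m) c i ^+ 2| < eps.
    apply: H; split.
      by apply: HN1 => /=; rewrite (leq_trans _ (leq_trans Nm mn))// leq_maxl.
    by apply: HN2 => /=; rewrite (leq_trans _ Nm)// leq_maxr.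
  rewrite -!(big_mkord xpredT (fun i => c i ^+ 2)) (big_cat_nat (n := m))//=.
  by move/ltW; apply: le_trans; rewrite addrAC subrr add0r ler_norm.
move=> w Dw cw; exists w; split => // i.
(* For n > i the coefficient of [w - partial_sum e c n] along [e i] is [B w (e i) - c i];
   Cauchy-Schwarz bounds its square by every positive [eps]. *)
apply/eqP; rewrite -subr_eq0 -sqrf_eq0; apply/eqP/le_anti.
rewrite sqr_ge0 andbT; apply/ler_addgt0Pl => eps eps0; rewrite addr0.
have [N HN] := cw _ eps0.
have Ds := partial_sum_closed oe c (maxn N i.+1).
apply: le_trans (HN (maxn N i.+1) (leq_maxl _ _)).
have := cauchy_schwarz (psdB_closed Dw Ds) (De i).
by rewrite psdBl// partial_sum_coef// leq_maxr (proj2 oe) eqxx mulr1.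
Qed.

Hypothesis total : forall f, D f -> (forall k, B f (e k) = 0) -> B f f = 0.

(** The sum [w] given by Riesz-Fischer has the same coefficients as [f], so [f - w] is orthogonal to
    all [e k] and null by totality; exchanging [f] for [w] does not change the distance to the
    partial sums. *)
Lemma parseval f : D f -> forall eps, 0 < eps -> exists N, forall n, (N <= n)%N ->
  B (f - partial_sum e (fun i => B f (e i)) n)
    (f - partial_sum e (fun i => B f (e i)) n) <= eps.
Proof.
move=> Df eps eps0.
have [w [Dw wc cw]] := riesz_fischer (c := fun i => B f (e i)) (fun N => bessel oe N Df).
have fw : B (f - w) (f - w) = 0.
  apply: total; first exact: psdB_closed.
  by move=> k; rewrite psdBl// wc subrr.
have [N HN] := cw _ eps0; exists N => n Nn.
set S := partial_sum _ _ _.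
have DS : D S by exact: partial_sum_closed.
have Dfw := psdB_closed Df Dw; have DwS := psdB_closed Dw DS.
have -> : f - S = (f - w) + (w - S) by rewrite addrA subrK.
by rewrite psd_sqD// fw (psd_null Dfw DwS fw) mulr0 !add0r; exact: HN.
Qed.

End complete.
End psd_form.

(** * Quadratic forms with an orthonormal system of eigenvectors *)

Section spectral_bounds.
Context {R : realType} {U : lmodType R}.
Variables (L dom : set U) (ip E : U -> U -> R).
Hypotheses (psdL : psd_form L ip) (psdE : psd_form dom E).
Hypothesis domL : dom `<=` L.
Variables (e : nat -> U) (s : nat -> R).
Hypothesis oe : orthonormal_seq L ip e.
Hypothesis dome : forall k, dom (e k).
Hypothesis eigen : forall k h, dom h -> E (e k) h = s k * ip (e k) h.

Lemma eigen_sum_form c N : E (partial_sum e c N) (partial_sum e c N) =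
  \sum_(i < N) s i * c i ^+ 2.
Proof.
have Dp : dom (partial_sum e c N) by exact: (psd_sum_closed psdE).
rewrite {1}/partial_sum (psd_suml psdE)//; apply: eq_bigr => i _.
rewrite eigen// (psdC psdL) ?(partial_sum_coef psdL oe) ?ltn_ord//.
- by ring.
- exact: domL.
- exact: domL.
Qed.

(** Testing the eigenvector equation with [f] gives [E (e i) f = s i * ip (e i) f], so the
    truncation that is orthogonal for [ip] is orthogonal for [E] too, and Bessel's identity holds in
    both forms. *)
Lemma form_residual f N : dom f ->
  E (f - partial_sum e (fun i => ip f (e i)) N)
    (f - partial_sum e (fun i => ip f (e i)) N) =
  E f f - \sum_(i < N) s i * ip f (e i) ^+ 2.
Proof.
move=> df.
have Dp : dom (partial_sum e (fun i => ip f (e i)) N).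
  exact: (psd_sum_closed psdE).
rewrite (psd_sqB psdE)// eigen_sum_form (psdC psdE)//.
rewrite {1}/partial_sum (psd_suml psdE)//.
under eq_bigr => i _.
  rewrite eigen// (psdC psdL _ (domL df)); last exact: domL.
  rewrite mulrCA -expr2; over.
by ring.
Qed.

Lemma form_bessel f N : dom f -> \sum_(i < N) s i * ip f (e i) ^+ 2 <= E f f.
Proof.
move=> df; rewrite -subr_ge0 -form_residual//.
by apply/(psd_ge0 psdE)/(psdB_closed psdE) => //; exact: (psd_sum_closed psdE).
Qed.

Lemma eigenvalue_ge0 k : 0 <= s k.
Proof.
have := psd_ge0 psdE (dome k).
by rewrite eigen// (proj2 oe) eqxx mulr1.
Qed.

Hypothesis complL : psd_complete L ip.
Hypothesis total : forall f, L f -> (forall k, ip f (e k) = 0) -> ip f f = 0.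

(** Every nonzero coefficient of [f] belongs to some [s i >= t], so the Bessel sum of [E] is at
    least t times that of [ip]. Parseval in [ip] removes the truncation; [f] need not be the limit
    of its expansion for [E]. *)
Lemma spectral_lower_bound t f : dom f ->
  (forall j, s j < t -> ip f (e j) = 0) -> t * ip f f <= E f f.
Proof.
move=> df orth; apply/ler_addgt0Pr => eps eps0.
(* The absolute value covers negative t, and the 1 keeps the divisor of [eps] positive when t =
   0. *)
have t0 : 0 < `|t| + 1 by rewrite ltr_wpDl.
have [N HN] := parseval psdL complL oe total (domL df) (divr_gt0 eps0 t0).
have := HN N (leqnn _); rewrite (bessel_eq psdL oe _ (domL df)).
set S := \sum_(i < N) _ => HS.
have S1 : t * S <= E f f.
  apply: le_trans (form_bessel N df).
  rewrite mulr_sumr ler_sum// => i _.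
  have [st|st] := ltP (s i) t; first by rewrite orth// expr0n !mulr0.
  by rewrite ler_wpM2r// sqr_ge0.
have fS : 0 <= ip f f - S.
  by rewrite subr_ge0; exact: (bessel psdL oe _ (domL df)).
have : t * (ip f f - S) <= eps.
  apply: (@le_trans _ _ (`|t| * (ip f f - S))).
    by rewrite ler_wpM2r// ler_norm.
  apply: (@le_trans _ _ ((`|t| + 1) * (ip f f - S))).
    by rewrite ler_wpM2r// lerDl.
  by rewrite -ler_pdivlMl// mulrC.
by rewrite mulrBr lerBlDr => /le_trans; apply; rewrite addrC lerD2r.
Qed.

End spectral_bounds.

(** * Weak compactness along an ultrafilter *)

Section weak_limit.
Context {R : realType} {U : lmodType R}.
Variables (L : set U) (ip : U -> U -> R).
Hypotheses (psdL : psd_form L ip) (complL : psd_complete L ip).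
Variable e : nat -> U.
Hypothesis oe : orthonormal_seq L ip e.
Hypothesis total : forall f, L f -> (forall k, ip f (e k) = 0) -> ip f f = 0.
Context {I : Type} (F : set_system I) {FU : UltraFilter F}.

(** The image of an ultrafilter is an ultrafilter, and on a compact segment it converges. *)
Lemma ultra_bounded_cvg (x : I -> R) (C : R) :
  (forall i, `|x i| <= C) -> exists l : R, x @ F --> l.
Proof.
move=> xC.
have := @segment_compact R (- C) C; rewrite compact_ultra.
have FF : Filter F by typeclasses eauto.
move=> cF; have xF : F (x @^-1` `[- C, C]).
  by apply: (@filterE _ F) => i /=; rewrite in_itv/= -ler_norml.
have xU : UltraFilter (x @ F).
  split=> [|G GF xFG]; first exact: fmap_proper_filter.
  rewrite predeqE => A; split; last exact: xFG.
  move=> GA; have [//|FA] := in_ultra_setVsetC (x @^-1` A) FU.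
  have GA' : G (~` A) by exact: xFG.
  by have [y []] := filter_ex (filterI GA GA').
by have [l [_ xl]] := cF (x @ F) xU xF; exists l.
Qed.

(** All coefficients along [e] converge at once. Bessel's inequality survives the limit, so
    Riesz-Fischer produces [w] with the limit coefficients. A general [h] is replaced by a partial
    sum of its expansion, at a cost that is uniform in i. *)
Lemma weak_compactness (u : I -> U) (C : R) : (forall i, L (u i)) ->
  (forall i, ip (u i) (u i) <= C) ->
  exists2 w, L w & forall h, L h -> ip (u i) h @[i --> F] --> ip w h.
Proof.
move=> Lu uC.
have Le := proj1 oe.
have C0 : 0 <= C.
  have [i _] := @filter_ex _ F _ setT filterT.
  by apply: le_trans (uC i); exact: (psd_ge0 psdL).
have bnd i h : L h -> `|ip (u i) h| <= Num.sqrt (C * ip h h).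
  move=> Lh; rewrite -sqrtr_sqr ler_wsqrtr//.
  apply: le_trans (cauchy_schwarz psdL (Lu i) Lh) _.
  by rewrite ler_wpM2r//; exact: (psd_ge0 psdL).
have lim h : L h -> exists l : R, ip (u i) h @[i --> F] --> l.
  by move=> Lh; apply: (@ultra_bounded_cvg _ (Num.sqrt (C * ip h h))) => i;
     exact: bnd.
have /choice[c Hc] := fun j => lim _ (Le j).
have cC N : \sum_(i < N) c i ^+ 2 <= C.
  have cv : \sum_(j < N) ip (u i) (e j) ^+ 2 @[i --> F] --> \sum_(j < N) c j ^+ 2.
    apply: cvg_big => [|j _]; first exact: add_continuous.
    by apply: cvgM; exact: Hc.
  apply: (cvgr_to_le cv).
  by apply: filterE => i; apply: le_trans (bessel psdL oe N (Lu i)) (uC i).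
have [w [Lw wc _]] := riesz_fischer psdL complL oe cC.
exists w => // h Lh.
have Luw i : L (u i - w) by exact: (psdB_closed psdL).
(* The squared norm of [u i - w] is at most twice the sum of those of [u i] and [w], by positivity
   of the form at [u i + w]; the 1 makes [K] positive. *)
have [K K0 HK] : exists2 K, 0 < K & forall i, ip (u i - w) (u i - w) <= K.
  exists (2 * C + 2 * ip w w + 1).
    by rewrite ltr_wpDl// addr_ge0// mulr_ge0// (psd_ge0 psdL).
  move=> i; have := psd_ge0 psdL (psdD_closed psdL (Lu i) Lw).
  rewrite (psd_sqB psdL)// (psd_sqD psdL)// => H.
  by have := uC i; lra.
apply/cvgrPdist_lt => eps eps0.
(* Chosen so that Cauchy-Schwarz against a vector of squared norm at most [K] gives [eps / 2]. *)
pose d := (eps / 2) ^+ 2 / K.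
have d0 : 0 < d by rewrite divr_gt0// exprn_gt0// divr_gt0.
have [N HN] := parseval psdL complL oe total Lh d0.
have {}HN := HN N (leqnn _).
set S := partial_sum _ _ _ in HN.
have LS : L S by exact: (partial_sum_closed psdL oe).
have cvS : ip (u i) S @[i --> F] --> ip w S.
  rewrite (partial_sum_dot psdL oe)//.
  under eq_cvg do rewrite (partial_sum_dot psdL oe)//.
  apply: cvg_big => [|j _]; first exact: add_continuous.
  by apply: cvgM; [exact: cvg_cst | rewrite wc; exact: Hc].
have /cvgrPdist_lt/(_ (eps / 2)) := cvS.
move=> /(_ (divr_gt0 eps0 (ltr0n _ 2))); apply: filterS => i Hi.
have LhS := psdB_closed psdL Lh LS.
have : `|ip (u i - w) (h - S)| <= eps / 2.
  rewrite -(@ler_pXn2r _ 2) ?nnegrE ?divr_ge0 ?(ltW eps0)//.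
  rewrite real_normK ?num_real//.
  apply: le_trans (cauchy_schwarz psdL (Luw i) LhS) _.
  have -> : (eps / 2) ^+ 2 = K * d by rewrite /d; field; rewrite gt_eqF.
  by rewrite ler_pM// (psd_ge0 psdL).
rewrite (psdBl psdL)// !(psdBr psdL)// => H.
have -> : ip w h - ip (u i) h = (ip w S - ip (u i) S) -
  (ip (u i) h - ip (u i) S - (ip w h - ip w S)) by ring.
by apply: le_lt_trans (ler_normB _ _) _; lra.
Qed.

End weak_limit.

(** * Square integrable functions *)

Section L2_total.
Context {d} {T : measurableType d} {R : realType}.
Variable mu : {measure set T -> \bar R}.

Lemma Lfun2P (f : T -> R) : f \in Lfun mu 2%:E <->
  measurable_fun setT f /\ mu.-integrable setT (fun x => (f x ^+ 2)%:E).
Proof.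
split=> [Lf|[mf /integrableP[mf2 if2]]].
  split; last exact: Lfun2_integrable_sqr.
  by move: Lf => /sub_Lfun_mfun; rewrite inE.
rewrite inE; apply/andP; split; rewrite inE/=; first exact: mf.
rewrite /finite_norm unlock /= poweR_lty//.
move: if2; congr (_ < _)%E; apply: eq_integral => x _.
by rewrite /= powR_mulrn// real_normK ?num_real// ger0_norm ?sqr_ge0.
Qed.

Let L2 : set (T -> R) := [set f | f \in Lfun mu 2%:E].
Let ip (f g : T -> R) := \int[mu]_x (f x * g x).

Let ip_integrable f g : L2 f -> L2 g -> mu.-integrable setT (fun x => (f x * g x)%:E).
Proof. by move=> Lf Lg; apply/Lfun1_integrable; exact: Lfun2_mul_Lfun1. Qed.

Lemma L2_psd : psd_form L2 ip.
Proof.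
have L2lin (c : R) (f g : T -> R) : L2 f -> L2 g -> L2 (c *: f + g).
  move=> /Lfun2P[mf if2] /Lfun2P[mg ig2]; apply/Lfun2P; split.
    by apply: measurable_funD => //; exact: measurable_funM.
  apply: (@le_integrable _ _ _ mu setT _ _
      (fun x => ((2 * c ^+ 2)%:E * (f x ^+ 2)%:E + 2%:E * (g x ^+ 2)%:E)%E)) => //.
  - apply/measurable_EFinP/measurable_funX.
    by apply: measurable_funD => //; exact: measurable_funM.
  - move=> x _; rewrite -!EFinM -EFinD /= lee_fin !ger0_norm ?sqr_ge0//.
      have -> : (c *: f + g) x = c * f x + g x by [].
      rewrite -subr_ge0 (_ : _ - _ = (c * f x - g x) ^+ 2) ?sqr_ge0//.
      by ring.
    by rewrite addr_ge0// mulr_ge0 ?sqr_ge0// mulr_ge0 ?sqr_ge0.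
  - by apply: integrableD => //; exact: integrableZl.
split => //.
- apply/Lfun2P; split; first exact: measurable_cst.
  by under eq_fun do rewrite expr0n/=; exact: integrable0.
- by move=> f g _ _; apply: eq_Rintegral => x _; rewrite mulrC.
- move=> c f g h Lf Lg Lh; rewrite /ip -RintegralZl//; last exact: ip_integrable.
  have ifh := ip_integrable Lf Lh.
  have icfh : mu.-integrable setT (fun x => (c * (f x * h x))%:E).
    by under eq_fun do rewrite EFinM; exact: integrableZl.
  rewrite -RintegralD//; last exact: ip_integrable.
  by apply: eq_Rintegral => x _; rewrite mulrA -mulrDl.
- by move=> f _; apply: Rintegral_ge0 => x _; rewrite -expr2 sqr_ge0.
Qed.

Let ip_sqE f : L2 f -> (ip f f)%:E = (\int[mu]_x (f x ^+ 2)%:E)%E.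
Proof.
move=> Lf; rewrite /ip /Rintegral fineK; last first.
  by apply: integrable_fin_num => //; exact: ip_integrable.
by apply: eq_integral => x _; rewrite expr2.
Qed.

(** The Riesz-Fischer argument: a subsequence with geometrically small increments converges almost
    everywhere, Fatou's lemma bounds its distance to the limit, and the Cauchy property carries the
    bound to the whole sequence. *)
Lemma L2_complete : psd_complete L2 ip.
Proof.
move=> u Lu cauchy.
have mu_ n : measurable_fun setT (u n) by have /Lfun2P[] := Lu n.
have /choice[N HN] : forall k, exists N, forall m n, (N <= m)%N -> (m <= n)%N ->
    ip (u n - u m) (u n - u m) <= (4 ^- k) by move=> k; exact: cauchy.
(* Partial sums of the thresholds are monotone in k and at least [N k]. *)
pose nk k := (\sum_(i < k.+1) N i)%N.
have nk_mono k l : (k <= l)%N -> (nk k <= nk l)%N.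
  move=> kl; rewrite /nk -!(big_mkord xpredT) [leqRHS](big_cat_nat (n := k.+1))//=.
  exact: leq_addr.
have nkN k : (N k <= nk k)%N by rewrite /nk big_ord_recr/= leq_addl.
pose v k := u (nk k).
have vv k l : (k <= l)%N -> ip (v l - v k) (v l - v k) <= 4 ^- k.
  by move=> kl; apply: HN => //; exact: nk_mono.
have Lv k : L2 (v k) by exact: Lu.
have mv k : measurable_fun setT (v k) by exact: mu_.
(* The weight [2 ^+ k] lies between two needs: against increments of squared norm at most [4 ^- k]
   the integral is still a convergent geometric series, and finiteness of [G x] still forces the
   increments at x to be absolutely summable. *)
pose G x := (\sum_(k <oo) (2 ^+ k * (v k.+1 x - v k x) ^+ 2)%:E)%E.
have mG : measurable_fun setT G.
  apply: ge0_emeasurable_sum => k.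
    by move=> x _ _; rewrite lee_fin mulr_ge0// ?sqr_ge0// exprn_ge0.
  move=> _; apply/measurable_EFinP/measurable_funM => //; apply/measurable_funX.
  exact: measurable_funB.
have G0 x : (0 <= G x)%E.
  by apply: nneseries_ge0 => k _ _; rewrite lee_fin mulr_ge0 ?sqr_ge0.
have intG : (\int[mu]_x G x < +oo)%E.
  rewrite integral_nneseries//; last 2 first.
  - move=> k; apply/measurable_EFinP/measurable_funM => //; apply/measurable_funX.
    exact: measurable_funB.
  - by move=> k x _; rewrite lee_fin mulr_ge0 ?sqr_ge0.
  apply: (@le_lt_trans _ _ (\sum_(k <oo) (2 / (2 ^ (k + 1))%:R)%:E)%E).
    apply: lee_nneseries => k _.
      by move=> _; apply: integral_ge0 => x _; rewrite lee_fin mulr_ge0 ?sqr_ge0.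
    under eq_integral do rewrite EFinM.
    rewrite ge0_integralZl//; last 2 first.
    - by apply/measurable_EFinP/measurable_funX/measurable_funB.
    - by move=> x _; rewrite lee_fin sqr_ge0.
    rewrite -[X in (_ * X)%E](ip_sqE (psdB_closed L2_psd (Lv k.+1) (Lv k))) -EFinM lee_fin.
    apply: (@le_trans _ _ (2 ^+ k * 4 ^- k)).
      by rewrite ler_wpM2l// vv.
    rewrite addn1 natrX exprS invfM mulrA divff// mul1r -exprVn -exprMn -exprVn.
    by rewrite (_ : 2 * 4^-1 = 2^-1 :> R)//; field.
  by have /cvg_lim -> := @cvg_geometric_eseries_half R 2 0; rewrite ?ltry.
pose E := [set x | (G x < +oo)%E].
have mE : measurable E.
  by rewrite -[E]setTI; apply: emeasurable_fun_infty_o.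
have muE : mu (~` E) = 0.
  have /integrable_ae[//|Z [mZ Z0 ZG]] : mu.-integrable setT G.
    apply/integrableP; split => //.
    by under eq_integral do rewrite gee0_abs//.
  apply: (subset_measure0 _ mZ _ Z0); first exact: measurableC.
  move=> x /= Ex; apply: ZG => /= /(_ I) Gx; apply: Ex.
  by rewrite /E/= -ge0_fin_numE.
(* Cutting off outside [E] makes the sequence converge at every point, so the limit is
   measurable. *)
pose vE k := v k \_ E.
have mvE k : measurable_fun setT (vE k).
  by apply/(measurable_restrictT _ mE)/measurable_funTS.
have vE_cvg x : cvgn (vE ^~ x).
  have [Ex|Ex] := pselect (E x); last first.
    rewrite (_ : vE ^~ x = cst 0); first exact: is_cvg_cst.
    by apply/funext => k; rewrite /vE patchE memNset.
  rewrite (_ : vE ^~ x = fun k => v k x); last first.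
    by apply/funext => k; rewrite /vE patchE mem_set.
  pose dl k := v k.+1 x - v k x.
  have -> : (fun k => v k x) = (fun k => v 0%N x + series dl k).
    apply/funext => k; rewrite /series/= telescope_sumr//.
    by rewrite addrC subrK.
  apply: is_cvgD; first exact: is_cvg_cst.
  apply: normed_cvg.
  (* With [y = 2 ^+ k * |dl k|], the inequality [y <= y ^+ 2 + 1] divided by [2 ^+ k] bounds the
     increment by [b k]. *)
  pose b k := (2 ^+ k * dl k ^+ 2) + (2^-1) ^+ k.
  apply: (@series_le_cvg _ _ b) => //.
  - by move=> k /=.
  - move=> k; apply: addr_ge0; last by rewrite exprn_ge0// invr_ge0.
    by apply: mulr_ge0; [exact: exprn_ge0|exact: sqr_ge0].
  - move=> k /=; have k0 : 0 < 2 ^+ k :> R by rewrite exprn_gt0.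
    rewrite /b exprVn.
    have -> : 2 ^+ k * dl k ^+ 2 + 2 ^- k = 2 ^- k * ((2 ^+ k * `|dl k|) ^+ 2 + 1).
      by rewrite exprMn real_normK ?num_real//; field; rewrite gt_eqF.
    rewrite -ler_pdivrMl ?invr_gt0// invrK.
    by have := sqr_ge0 (2 ^+ k * `|dl k| - 1); rewrite sqrrB1; have := sqr_ge0 (2 ^+ k * `|dl k|); nra.
  - have -> : series b = series (fun k => 2 ^+ k * dl k ^+ 2) +
        series (fun k => (2^-1) ^+ k).
      by apply/funext => n; rewrite /series/= big_split.
    apply: is_cvgD; last first.
      rewrite exprn_geometric; apply: is_cvg_geometric_series.
      by rewrite ger0_norm// invf_lt1// ltr1n.
    apply: nondecreasing_is_cvgn.
      apply/nondecreasing_seqP => n; rewrite /series/= big_nat_recr//= lerDl.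
      by rewrite mulr_ge0 ?sqr_ge0// exprn_ge0.
    exists (fine (G x)) => _ [n _ <-].
    rewrite -lee_fin fineK ?ge0_fin_numE// /series/= -sumEFin.
    by apply: nneseries_lim_ge => k _; rewrite lee_fin mulr_ge0 ?sqr_ge0.
pose w x := limn (vE ^~ x).
have mw : measurable_fun setT w.
  by apply: measurable_fun_cvg mvE _ => x _; exact: vE_cvg.
have vE_sq m k : (\int[mu]_x ((vE m x - vE k x) ^+ 2)%:E <=
    \int[mu]_x ((v m x - v k x) ^+ 2)%:E)%E.
  apply: ge0_le_integral => //.
  - by move=> x _; rewrite lee_fin sqr_ge0.
  - by apply/measurable_EFinP/measurable_funX/measurable_funB.
  - by apply/measurable_EFinP/measurable_funX/measurable_funB.
  - move=> x _; rewrite lee_fin /vE !patchE; case: ifP => // _.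
    by rewrite subrr expr0n sqr_ge0.
have wv k : (\int[mu]_x ((w x - vE k x) ^+ 2)%:E <= (4 ^- k)%:E)%E.
  have -> : (\int[mu]_x ((w x - vE k x) ^+ 2)%:E =
      \int[mu]_x (limn_einf (fun m => ((vE m x - vE k x) ^+ 2)%:E)))%E.
    apply: eq_integral => x _; apply/esym.
    have cv : ((vE m x - vE k x) ^+ 2)%:E @[m --> \oo] --> ((w x - vE k x) ^+ 2)%:E.
      apply: cvg_EFin; first exact: nearW.
      have cv1 : vE m x - vE k x @[m --> \oo] --> w x - vE k x.
        by apply: cvgB; [exact: vE_cvg | exact: cvg_cst].
      by apply: cvgM.
    by rewrite is_cvg_limn_einfE; [exact/cvg_lim|apply/cvg_ex; eexists; exact: cv].
  apply: le_trans (fatou _ _ _ _) _ => //.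
  - by move=> m; apply/measurable_EFinP/measurable_funX/measurable_funB.
  - by move=> m x _; rewrite lee_fin sqr_ge0.
  rewrite limn_einf_lim; apply: lime_le; first exact: is_cvg_einfs.
  apply: nearW => m; rewrite /einfs/=.
  apply: (@le_trans _ _ (\int[mu]_x ((vE (maxn m k) x - vE k x) ^+ 2)%:E)%E).
    by apply: ereal_inf_lbound; exists (maxn m k) => //=; exact: leq_maxl.
  apply: le_trans (vE_sq _ _) _.
  rewrite -[X in (X <= _)%E](ip_sqE (psdB_closed L2_psd (Lv _) (Lv _))) lee_fin.
  by apply: vv; exact: leq_maxr.
have wvN k : (\int[mu]_x ((w x - v k x) ^+ 2)%:E <= (4 ^- k)%:E)%E.
  apply: le_trans (wv k); apply: ae_ge0_le_integral => //.
  - by move=> x _; rewrite lee_fin sqr_ge0.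
  - by apply/measurable_EFinP/measurable_funX/measurable_funB.
  - by move=> x _; rewrite lee_fin sqr_ge0.
  - by apply/measurable_EFinP/measurable_funX/measurable_funB.
  - exists (~` E); split => //; first exact: measurableC.
    by move=> x /=; apply: contra_not => Ex _; rewrite /vE patchE mem_set.
have Lwv k : L2 (w - v k).
  apply/Lfun2P; split; first exact: measurable_funB.
  apply/integrableP; split; first by apply/measurable_EFinP/measurable_funX/measurable_funB.
  under eq_integral do rewrite gee0_abs ?lee_fin ?sqr_ge0//.
  by apply: le_lt_trans (wvN k) _; rewrite ltry.
have Lw : L2 w.
  by rewrite -(subrK (v 0%N) w); apply: (psdD_closed L2_psd).
have ipwv k : ip (w - v k) (w - v k) <= 4 ^- k.
  by rewrite -lee_fin ip_sqE//; exact: wvN.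
exists w => // eps eps0.
(* Both [w - v K] and [u n - v K] have squared norm at most [4 ^- K], and that of their difference
   is at most twice the sum. *)
have [K HK] : exists K, 4 * 4 ^- K <= eps :> R.
  have : geometric (4 : R) (4^-1) @ \oo --> 0.
    by apply: cvg_geometric; rewrite ger0_norm// invf_lt1// ltr1n.
  move=> /cvgrPdist_lt/(_ _ eps0)[K _ /(_ K (leqnn _))].
  rewrite sub0r normrN /geometric/= exprVn => HK; exists K.
  by apply/ltW; apply: le_lt_trans HK; exact: ler_norm.
exists (nk K) => n nKn.
have -> : w - u n = (w - v K) - (u n - v K) by rewrite opprB addrA subrK.
have Luv : L2 (u n - v K) by exact: (psdB_closed L2_psd).
have := psd_ge0 L2_psd (psdD_closed L2_psd (Lwv K) Luv).
rewrite (psd_sqB L2_psd)// (psd_sqD L2_psd)//.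
have : ip (u n - v K) (u n - v K) <= 4 ^- K by apply: HN => //; exact: nkN.
by have := ipwv K; rewrite -/ip; lra.
Qed.
End L2_total.

Section L2_on.
Context {d} {T : measurableType d} {R : realType}.
Variables (mu : {measure set T -> \bar R}) (A : set T) (mA : measurable A).
Implicit Types f g h : T -> R.

(** [L2_M] and [L2_M0] are instances by conversion, as [ip_M] and [ip_M0] are of [ip_on]. *)
Definition L2_on : set (T -> R) := [set f | f \_ A \in Lfun mu 2%:E].

Definition ip_on f g : R := \int[mu]_(x in A) (f x * g x).

Lemma ip_onE f g : ip_on f g = \int[mu]_x ((f \_ A) x * (g \_ A) x).
Proof.
rewrite /ip_on Rintegral_mkcond; apply: eq_Rintegral => x _; rewrite !patchE.
by case: ifP => // _; rewrite mulr0.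
Qed.

Lemma restrict_lin (c : R) f g : (c *: f + g) \_ A = c *: f \_ A + g \_ A.
Proof.
apply/funext => x; rewrite patchE !fctE !patchE; case: ifP => // _.
by rewrite scaler0 addr0.
Qed.

Lemma L2_on_psd : psd_form L2_on ip_on.
Proof.
have H := L2_psd mu.
split => [|c f g Lf Lg|f g Lf Lg|c f g h Lf Lg Lh|f Lf].
- rewrite /L2_on/= (_ : 0 \_ A = 0); first exact: (psd0 H).
  by apply/funext => x; rewrite patchE; case: ifP.
- by rewrite /L2_on/= restrict_lin; exact: (psd_closed H).
- by rewrite !ip_onE; exact: (psdC H).
- by rewrite !ip_onE restrict_lin; exact: (psd_linear H).
- by rewrite ip_onE; exact: (psd_ge0 H).
Qed.

Lemma L2_onP f : L2_on f <->
  measurable_fun A f /\ mu.-integrable A (fun x => (f x ^+ 2)%:E).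
Proof.
rewrite /L2_on/= Lfun2P (measurable_restrictT _ mA) (integrable_mkcond _ mA).
rewrite (_ : (fun x => ((f \_ A) x ^+ 2)%:E) = (fun x => (f x ^+ 2)%:E) \_ A)//.
by apply/funext => x; rewrite !patchE; case: ifP => //; rewrite expr0n.
Qed.

Lemma L2_on_measurable f : L2_on f -> measurable_fun A f.
Proof. by move=> /L2_onP[]. Qed.

Lemma ip_on_integrable f g : L2_on f -> L2_on g ->
  mu.-integrable A (fun x => (f x * g x)%:E).
Proof.
move=> Lf Lg; apply/(integrable_mkcond _ mA).
have /Lfun1_integrable := Lfun2_mul_Lfun1 Lf Lg.
congr (integrable _ _ _); apply/funext => x /=; rewrite !patchE.
by case: ifP => // _; rewrite mulr0.
Qed.

Lemma L2_on_complete : psd_complete L2_on ip_on.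
Proof.
have H := L2_on_psd; have HT := L2_psd mu.
move=> u Lu cu.
have [|eps eps0|w Lw cw] := @L2_complete _ _ _ mu (fun n => u n \_ A).
- by move=> n; exact: Lu.
- have [N HN] := cu _ eps0; exists N => m n Nm mn.
  have := HN m n Nm mn; rewrite ip_onE.
  by rewrite -scaleN1r addrC restrict_lin scaleN1r addrC.
have LwA : L2_on w.
  move: Lw => /Lfun2P[mw iw]; apply/L2_onP; split; first exact: measurable_funTS.
  exact: integrableS iw.
exists w => // eps eps0; have [N HN] := cw _ eps0; exists N => n Nn.
apply: le_trans (HN n Nn).
have LwuT := psdB_closed HT Lw (Lu n).
have LwuA := psdB_closed H LwA (Lu n).
rewrite /ip_on Rintegral_mkcond; apply: le_Rintegral => //.
- rewrite (_ : EFin \o _ = (fun x => ((w - u n) x * (w - u n) x)%:E) \_ A).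
    by apply/(integrable_mkcond _ mA); exact: ip_on_integrable.
  by apply/funext => x /=; rewrite !patchE; case: ifP.
- by apply/Lfun1_integrable; exact: Lfun2_mul_Lfun1.
move=> x _; rewrite patchE !fctE patchE; case: ifP => // _.
by rewrite -expr2 sqr_ge0.
Qed.

Lemma L2_onM f (c : T -> R) (C : R) : measurable_fun A c -> (forall x, A x -> `|c x| <= C) ->
  L2_on f -> L2_on (fun x => c x * f x).
Proof.
move=> mc cC /L2_onP[mf if2]; apply/L2_onP; split; first exact: measurable_funM.
apply: (@le_integrable _ _ _ mu A _ _ (fun x => ((C ^+ 2)%:E * (f x ^+ 2)%:E)%E)) => //.
- by apply/measurable_EFinP/measurable_funX/measurable_funM.
- move=> x Ax; rewrite -EFinM /= lee_fin !ger0_norm ?sqr_ge0//; last first.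
    by apply: mulr_ge0; exact: sqr_ge0.
  have C0 : 0 <= C by apply: le_trans (cC _ Ax).
  rewrite exprMn ler_wpM2r ?sqr_ge0// -[leLHS]real_normK ?num_real//.
  by rewrite ler_sqr ?nnegrE ?cC.
- exact: integrableZl.
Qed.

Lemma L2_on_bounded f (C : R) : (mu A < +oo)%E -> measurable_fun A f ->
  (forall x, A x -> `|f x| <= C) -> L2_on f.
Proof.
move=> muA mf fC; have : L2_on (cst 1).
  apply/L2_onP; split; first exact: measurable_cst.
  rewrite (_ : (fun _ => _) = EFin \o cst 1); last first.
    by apply/funext => x /=; rewrite expr1n.
  apply: measurable_bounded_integrable => //.
  by exists 1; split => // y y1 x _ /=; rewrite normr1 ltW.
move=> /(L2_onM mf fC); under eq_fun do rewrite mulr1.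
exact.
Qed.

Lemma ip_on_movel f g (c : T -> R) : ip_on (fun x => c x * f x) g = ip_on f (fun x => c x * g x).
Proof. by apply: eq_Rintegral => x _; ring. Qed.

Lemma ip_on_ae f : L2_on f -> ip_on f f = 0 -> ae_eq mu A f (cst 0).
Proof.
move=> Lf ff; have /L2_onP[mf if2] := Lf.
have /integrableP[mf2 _] := if2.
have [] := (ae_eq_integral_abs mu mA mf2).1; last first.
  move=> N [mN N0 H]; exists N; split => //.
  apply: subset_trans H => x /=; apply: contra_not => H Ax.
  by have [/eqP] := H Ax; rewrite sqrf_eq0 => /eqP.
under eq_integral do rewrite gee0_abs ?lee_fin ?sqr_ge0//.
rewrite -[LHS]fineK ?(integrable_fin_num mA)//; congr EFin.
by rewrite -[RHS]ff; apply: eq_Rintegral => x _; rewrite expr2.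
Qed.

Lemma ae_ip_on f : L2_on f -> ae_eq mu A f (cst 0) -> ip_on f f = 0.
Proof.
move=> Lf f0; have /L2_onP[mf if2] := Lf.
rewrite /ip_on /Rintegral (@ae_eq_integral _ _ _ mu A (cst 0))//.
- by rewrite integral0.
- by apply/measurable_EFinP/measurable_funM.
- by apply: filterS f0 => x /= + Ax => /(_ Ax) ->; rewrite mul0r.
Qed.

End L2_on.

(** * Smooth functions *)

Section smooth_basics.
Context {R : realType} {V W : normedModType R}.
Implicit Types (f g : V -> W).

Lemma smooth_differentiable f x : smooth f -> differentiable f x.
Proof. by move=> sf; exact: (sf [::]). Qed.

Lemma smooth_derive f u : smooth f -> smooth ('D_u f).
Proof. by move=> sf s x; have := sf (rcons s u) x; rewrite foldr_rcons. Qed.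

Lemma smooth_continuous f : smooth f -> continuous f.
Proof.
by move=> sf x; apply/differentiable_continuous/smooth_differentiable.
Qed.

Lemma smooth_derivable f x u : smooth f -> derivable f x u.
Proof. by move=> sf; apply/diff_derivable/smooth_differentiable. Qed.

(** A class stable under one derivation is stable along any list of directions. Each closure
    property of [smooth] then only requires a class of formulas that derivation does not leave. *)
Lemma smooth_coind (P : set (V -> W)) :
  (forall f, P f -> (forall x, differentiable f x) /\ forall u, P ('D_u f)) ->
  P `<=` smooth.
Proof.
move=> HP f Pf s.
suff : P (foldr (fun u g => 'D_u g) f s) by move=> /HP[].
by elim: s => [//|u s /HP[_]]; exact.
Qed.

Lemma smooth_cst (c : W) : smooth (cst c : V -> W).
Proof.
apply: (smooth_coind (P := [set f | exists c, f = cst c])); last by exists c.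
move=> _ [{}c ->]; split => [x|u]; first exact: differentiable_cst.
by exists 0; apply/funext => x; rewrite derive_cst.
Qed.

Lemma smoothD f g : smooth f -> smooth g -> smooth (fun x => f x + g x).
Proof.
move=> sf sg; apply: (smooth_coind
  (P := [set h | exists f g, [/\ smooth f, smooth g & h = fun x => f x + g x]]));
  last by exists f, g.
move=> _ [{sf}f [{sg}g [sf sg ->]]]; split => [x|u].
  by apply: differentiableD; exact: smooth_differentiable.
exists ('D_u f), ('D_u g); split; [exact: smooth_derive|exact: smooth_derive|].
by apply/funext => x; rewrite -deriveD//; exact: smooth_derivable.
Qed.

Lemma smoothZ (c : R) f : smooth f -> smooth (fun x => c *: f x).
Proof.
move=> sf; apply: (smooth_coind
  (P := [set h | exists2 f, smooth f & h = fun x => c *: f x])); last by exists f.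
move=> _ [{sf}f sf ->]; split => [x|u].
  by apply: differentiableZ; exact: smooth_differentiable.
exists ('D_u f); first exact: smooth_derive.
by apply/funext => x; rewrite -deriveZ//; exact: smooth_derivable.
Qed.

(** Serves functions glued from local formulas. Differentiability passes from [g] to [f] because the
    first order expansion of one is an expansion of the other. *)
Lemma smooth_local f :
  (forall x : V, exists2 g : V -> W, smooth g & \forall y \near x, f y = g y) ->
  smooth f.
Proof.
apply: (smooth_coind
  (P := [set f : V -> W | forall x : V,
    exists2 g : V -> W, smooth g & \forall y \near x, f y = g y])).
move=> {}f lf; split => [x|u x]; have [g sg fg] := lf x.
  have dg := smooth_differentiable x sg.
  have fgx : f x = g x by exact: (nbhs_singleton fg).
  have fE : f \o shift x = cst (f x) + 'd g x +o_ 0 id.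
    apply/eqaddoP => eps eps0.
    have /eqaddoP/(_ _ eps0) := diff_locally dg; rewrite -fgx.
    have : \forall y \near 0, (f \o shift x) y = (g \o shift x) y.
      move: fg; rewrite (near_shift 0 x); apply: filterS => y /=.
      by rewrite subr0.
    apply: filterS2 => y fy /=; rewrite /GRing.add/= /GRing.opp/= /shift/=.
    by move: fy => /= ->.
  have dfg := diff_unique (diff_continuous dg) fE.
  by apply/diff_locallyP; rewrite dfg; split => //; exact: diff_continuous.
exists ('D_u g); first exact: smooth_derive.
have [->|u0] := eqVneq u 0.
  by apply: nearW => y; rewrite !derive0.
by apply: filterS (near_join fg) => y fgy; exact: near_eq_derive.
Qed.

Lemma derive_smoothD f x u w : smooth f -> 'D_(u + w) f x = 'D_u f x + 'D_w f x.
Proof.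
by move=> sf; rewrite !deriveE ?raddfD//; exact: smooth_differentiable.
Qed.

Lemma derive_smoothZ f x (c : R) u : smooth f -> 'D_(c *: u) f x = c *: 'D_u f x.
Proof.
by move=> sf; rewrite !deriveE ?linearZ//; exact: smooth_differentiable.
Qed.

End smooth_basics.

Section smooth_mul.
Context {R : realType} {V : normedModType R}.
Implicit Types (f g : V -> R).

(** A single product is not stable under derivation; by the Leibniz rule the finite sums of products
    of smooth functions, the class [Q], are. *)
Lemma smoothM f g : smooth f -> smooth g -> smooth (fun x => f x * g x).
Proof.
pose P n := [set h | exists s : seq ((V -> R) * (V -> R)),
  [/\ size s = n, forall p, List.In p s -> smooth p.1 /\ smooth p.2 &
  h = fun x => \sum_(p <- s) p.1 x * p.2 x]].
pose Q : set (V -> R) := [set h | exists s : seq ((V -> R) * (V -> R)),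
  (forall p, List.In p s -> smooth p.1 /\ smooth p.2) /\
  h = fun x => \sum_(p <- s) p.1 x * p.2 x].
move=> sf sg; apply: (smooth_coind (P := Q)); last first.
  exists [:: (f, g)]; split; first by move=> p /= [<-//|//].
  by apply/funext => x; rewrite big_seq1.
move=> _ [s [Hs ->]]; elim: s Hs => [|[a b] s IH] Hs.
  split=> [x|u].
    rewrite (_ : (fun _ => _) = cst 0); first exact: differentiable_cst.
    by apply/funext => y; rewrite big_nil.
  exists [::]; split=> //; apply/funext => x; rewrite big_nil.
  rewrite (_ : (fun _ => _) = cst 0) ?derive_cst//.
  by apply/funext => y; rewrite big_nil.
have [/= sa sb] : smooth a /\ smooth b by apply: (Hs (a, b)); left.
have /IH[df Df] : forall p, List.In p s -> smooth p.1 /\ smooth p.2.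
  by move=> p ps; apply: Hs; right.
have -> : (fun x => \sum_(p <- (a, b) :: s) p.1 x * p.2 x) =
    (a * b) + (fun x => \sum_(p <- s) p.1 x * p.2 x).
  by apply/funext => x; rewrite big_cons.
have dab x : differentiable (a * b) x.
  by apply: differentiableM; exact: smooth_differentiable.
split=> [x|u]; first exact: differentiableD.
have [s' [Hs' Es']] := Df u.
exists [:: ('D_u a, b), (a, 'D_u b) & s']; split.
  move=> p /= [<-|[<-|]] /=; last exact: Hs'.
    by split => //; exact: smooth_derive.
  by split => //; exact: smooth_derive.
apply/funext => x; rewrite !big_cons/= addrA.
rewrite deriveD; [|exact: diff_derivable|exact: diff_derivable].
rewrite deriveM; [|exact: smooth_derivable|exact: smooth_derivable].
congr (_ + _); last exact: (congr1 (@^~ x) Es').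
by rewrite addrC; congr (_ + _); rewrite mulrC.
Qed.

Lemma smooth_prod (I : Type) (r : seq I) (F : I -> V -> R) :
  (forall i, smooth (F i)) -> smooth (fun x => \prod_(i <- r) F i x).
Proof.
move=> sF; elim: r => [|i r IH].
  rewrite (_ : (fun _ => _) = cst 1); first exact: smooth_cst.
  by apply/funext => x; rewrite big_nil.
rewrite (_ : (fun _ => _) = fun x => F i x * \prod_(j <- r) F j x).
  exact: smoothM.
by apply/funext => x; rewrite big_cons.
Qed.

Lemma smooth_shift (f : V -> R) (c : V) : smooth f -> smooth (fun x => f (x + c)).
Proof.
move=> sf; apply: (smooth_coind
  (P := [set h | exists2 f, smooth f & h = fun x => f (x + c)])); last by exists f.
move=> _ [{sf}f sf ->]; split => [x|u].
  apply: (@differentiable_comp _ _ _ _ (fun x => x + c) f).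
    by apply: differentiableD.
  exact: smooth_differentiable.
exists ('D_u f); first exact: smooth_derive.
apply/funext => x; rewrite /derive/=.
by under eq_fun do rewrite -addrA.
Qed.

End smooth_mul.

Section smooth_comp.
Context {R : realType} {V V' W : normedModType R}.

Lemma smooth_comp_linear (l : {linear V -> V'}) (f : V' -> W) :
  continuous l -> smooth f -> smooth (f \o l).
Proof.
move=> cl sf; apply: (smooth_coind
  (P := [set h | exists2 f : V' -> W, smooth f & h = f \o l])); last by exists f.
move=> _ [{sf}f sf ->]; split => [x|u].
  apply: differentiable_comp; first exact: linear_differentiable.
  exact: smooth_differentiable.
exists ('D_(l u) f); first exact: smooth_derive.
apply/funext => x; rewrite /derive/=.
by under eq_fun do rewrite linearP.
Qed.

Lemma smooth_scale (f : V -> W) (c : R) : smooth f -> smooth (fun x => f (c *: x)).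
Proof.
move=> sf; apply: (smooth_coind
  (P := [set h | exists c1 (f : V -> W), smooth f /\ h = fun x => c1 *: f (c *: x)])).
  move=> _ [c1 [{sf}f [sf ->]]]; split => [x|u].
    apply: differentiableZ.
    apply: (@differentiable_comp _ _ _ _ (fun x => c *: x) f).
      by apply: differentiableZ.
    exact: smooth_differentiable.
  exists (c1 * c), ('D_u f); split; first exact: smooth_derive.
  apply/funext => x.
  have df : differentiable f (c *: x) by exact: smooth_differentiable.
  have ds : differentiable (fun x : V => c *: x) x by apply: differentiableZ.
  have dfs : differentiable (fun x => f (c *: x)) x.
    exact: (@differentiable_comp _ _ _ _ (fun x => c *: x) f).
  rewrite deriveE; last exact: differentiableZ.
  rewrite diffZ// !deriveE// -scalerA.
  rewrite (@diff_comp _ _ _ _ (fun x => c *: x) f)//=.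
  by rewrite -[X in 'd f _ X]/('d ( *:%R c) x u) diff_val linearZ.
by exists 1, f; split => //; apply/funext => x; rewrite scale1r.
Qed.

End smooth_comp.

Section smooth_line.
Context {R : realType} {V W : normedModType R}.
Implicit Types (f : V -> W) (x u : V).

Lemma differentiable_line (x u : V) (s : R) :
  differentiable (fun s : R => x + s *: u) s.
Proof. by apply: differentiableD => //; exact: differentiableZl. Qed.

Lemma line_continuous (x u : V) : continuous (fun s : R => x + s *: u).
Proof. by move=> s; exact/differentiable_continuous/differentiable_line. Qed.

Lemma derive_line f x u (s : R) : smooth f ->
  'D_1 (fun s : R => f (x + s *: u)) s = 'D_u f (x + s *: u).
Proof.
move=> sf; rewrite /derive/=; congr (lim _).
have E h : x + (h *: (1 : R) + s) *: u = h *: u + (x + s *: u).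
  by rewrite -[h *: 1]/(h * 1) mulr1 scalerDl addrCA.
by under eq_fun do rewrite E.
Qed.

Lemma smooth_line f x u : smooth f -> smooth (fun s : R => f (x + s *: u)).
Proof.
move=> sf; apply: (smooth_coind (P := [set h | exists (c : R) (f : V -> W),
    smooth f /\ h = fun s : R => c *: f (x + s *: u)])).
  move=> _ [c [{sf}f [sf ->]]].
  have df s : differentiable (fun s : R => f (x + s *: u)) s.
    apply: (@differentiable_comp _ _ _ _ (fun s : R => x + s *: u) f).
      exact: differentiable_line.
    exact: smooth_differentiable.
  split => [s|w]; first exact: differentiableZ.
  exists (c * w), ('D_u f); split; first exact: smooth_derive.
  apply/funext => s; rewrite deriveZ; last exact: diff_derivable.
  rewrite -(derive_line x u s sf) !deriveE// -scalerA.
  by rewrite -{1}[w]mulr1 -[w * 1]/(w *: 1) linearZ.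
by exists 1, f; split => //; apply/funext => s; rewrite scale1r.
Qed.

End smooth_line.

(** * Smooth bump functions on the line *)

Section bump.
Context {R : realType}.
Implicit Types (x y : R) (n : nat).

(** The powers [x ^- n] are what differentiating [exp (- 1 / x)] produces; the span of this family
    is stable under derivation. *)
Definition flat_exp n x : R := if 0 < x then x ^- n * expR (- x^-1) else 0.

Lemma flat_exp_ge0 n x : 0 <= flat_exp n x.
Proof.
rewrite /flat_exp; case: ifPn => // x0.
by rewrite mulr_ge0 ?expR_ge0// invr_ge0 exprn_ge0// ltW.
Qed.

(** With [y = 1 / x] the claim is [y ^+ n.+1 <= n.+1 ^+ n.+1 * exp y], which is the inequality
    [y / n.+1 <= exp (y / n.+1)] raised to the power n + 1. A linear bound suffices for the limit at
    0. *)
Lemma flat_exp_le n x : flat_exp n x <= n.+1%:R ^+ n.+1 * `|x|.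
Proof.
rewrite /flat_exp; case: ifPn => [x0|_]; last by rewrite mulr_ge0 ?exprn_ge0.
rewrite gtr0_norm// ler_pdivrMl ?exprn_gt0// mulrCA -exprSr -exprMn expRN.
rewrite -[leRHS]invrK lef_pV2 ?posrE ?invr_gt0 ?expR_gt0 ?exprn_gt0 ?mulr_gt0//.
rewrite -exprVn invfM mulrC.
have -> : expR x^-1 = expR (x^-1 / n.+1%:R) ^+ n.+1.
  by rewrite -expRM_natl mulrC divfK.
rewrite lerXn2r ?nnegrE ?expR_ge0 ?divr_ge0 ?invr_ge0 ?(ltW x0)//.
by apply: le_trans (expR_ge1Dx _); rewrite lerDr.
Qed.

Lemma is_derive_flat_exp n x :
  is_derive x 1 (flat_exp n) (flat_exp n.+2 x - n%:R * flat_exp n.+1 x).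
Proof.
have [x0|x0|x0] := ltgtP 0 x; last rewrite -x0.
- have xn0 : x != 0 by rewrite gt_eqF.
  apply: (near_eq_is_derive (f := (fun y => (y^-1) ^+ n * expR (- y^-1)))).
    near=> y; rewrite /flat_exp ifT ?exprVn//; near: y.
    exact: lt_nbhsr.
  rewrite /flat_exp x0.
  have dV : is_derive x 1 (fun y : R => y^-1) (- x ^- 2).
    have := is_deriveV (f := id) xn0 (is_derive_id x 1).
    by rewrite /GRing.scale/= mulr1.
  have dE : is_derive x 1 (fun y : R => expR (- y^-1)) (expR (- x^-1) * x ^- 2).
    apply: (is_derive1_comp (f := expR) (g := fun y => - y^-1)).
    by rewrite -[x ^- 2]opprK; exact: is_deriveN.
  have dX := is_deriveX n dV.
  have := is_deriveM dX dE.
  congr (is_derive _ _ _ _); rewrite /GRing.scale/=.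
    by apply/funext => y; rewrite fctE exprfctE.
  have -> : ((fun y : R => y^-1) ^+ n) x = x^-1 ^+ n by rewrite exprfctE.
  case: n {dX} => [|n] /=; first by rewrite !expr0; field.
  by rewrite -!exprVn !exprS; ring.
- apply: (near_eq_is_derive (f := cst 0)).
    near=> y; rewrite /flat_exp ifF//; apply/negbTE; rewrite -leNgt.
    by apply/ltW; near: y; exact: lt_nbhsl.
  by rewrite /flat_exp ltNge (ltW x0)/= mulr0 subrr; exact: is_derive_cst.
have f0 m : flat_exp m 0 = 0 by rewrite /flat_exp ltxx.
rewrite !f0 mulr0 subrr.
(* The difference quotient of [flat_exp n] at 0 is [flat_exp n.+1] itself, which tends to 0 by its
   linear bound. *)
have cv : h^-1 *: (flat_exp n (h *: 1 + 0) - flat_exp n 0) @[h --> 0^'] --> (0 : R).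
  apply: (@cvg_trans _ ((flat_exp n.+1 h) @[h --> 0^'])).
    apply: near_eq_cvg; near=> h.
    have h0 : h != 0 by near: h; exact: nbhs_dnbhs_neq.
    rewrite f0 subr0 addr0 /GRing.scale/= mulr1 /flat_exp; case: ifP => _.
      by rewrite exprS invfM mulrA.
    by rewrite mulr0.
  apply: cvg_within_filter; apply/cvgr0Pnorm_le => eps eps0.
  pose c : R := n.+2%:R ^+ n.+2.
  have c0 : 0 < c by rewrite exprn_gt0.
  have ce0 : 0 < c^-1 * eps by rewrite mulr_gt0// invr_gt0.
  apply: filterS (nbhs0_le ce0) => h hc; rewrite ger0_norm ?flat_exp_ge0//.
  by apply: le_trans (flat_exp_le _ _) _; rewrite -/c -ler_pdivlMl.
by apply: DeriveDef; [apply/cvg_ex; exists 0|exact/cvg_lim].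
Unshelve. all: by end_near. Qed.

Lemma derive_scalar (f : R -> R) (u x : R) : differentiable f x ->
  'D_u f x = u * 'D_1 f x.
Proof.
move=> df; rewrite !deriveE// -[u in LHS]mulr1 -[u * 1]/(u *: 1).
by rewrite linearZ.
Qed.

Lemma smooth_flat_exp n : smooth (flat_exp n).
Proof.
pose P := [set h : R -> R | exists s : seq (R * nat),
  h = fun x => \sum_(p <- s) p.1 * flat_exp p.2 x].
apply: (smooth_coind (P := P)); last first.
  by exists [:: (1, n)]; apply/funext => x; rewrite big_seq1 mul1r.
move=> _ [s ->].
have dP x : is_derive x 1 (fun x => \sum_(p <- s) p.1 * flat_exp p.2 x)
    (\sum_(p <- s) p.1 * (flat_exp p.2.+2 x - p.2%:R * flat_exp p.2.+1 x)).
  elim: s => [|p s IH].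
    rewrite big_nil (_ : (fun _ => _) = cst 0); first exact: is_derive_cst.
    by apply/funext => y; rewrite big_nil.
  rewrite big_cons (_ : (fun _ => _) = (fun y => p.1 * flat_exp p.2 y) +
    (fun x => \sum_(p <- s) p.1 * flat_exp p.2 x)); last first.
    by apply/funext => y; rewrite big_cons.
  apply: is_deriveD; have := is_derive_flat_exp p.2 x => H.
  exact: (is_deriveZ p.1).
have df x : differentiable (fun x => \sum_(p <- s) p.1 * flat_exp p.2 x) x.
  by apply/derivable1_diffP; have [] := dP x.
split => // u.
exists (flatten [seq [:: (u * p.1, p.2.+2); (- u * p.1 * p.2%:R, p.2.+1)] | p <- s]).
apply/funext => x; rewrite derive_scalar// (derive_val (is_derive := dP x)).
elim: s {dP df} => [|p s IH]; first by rewrite !big_nil mulr0.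
by rewrite /= !big_cons/= mulrDr IH; ring.
Qed.

(** The dilation by [n.+1] makes the sequence tend pointwise to the indicator function of the open
    interval, with values in [0, 1] throughout. *)
Definition itv_bump (a b : R) n x : R :=
  flat_exp 0 (n.+1%:R * (x - a)) * flat_exp 0 (n.+1%:R * (b - x)).

Lemma smooth_itv_bump a b n : smooth (itv_bump a b n).
Proof.
apply: smoothM.
  apply: (smooth_shift (f := fun x => flat_exp 0 (n.+1%:R * x)) (- a)).
  exact: (smooth_scale _ (smooth_flat_exp 0)).
have -> : (fun x => flat_exp 0 (n.+1%:R * (b - x))) =
    (fun x => flat_exp 0 (- n.+1%:R * (x - b))).
  by apply/funext => x; rewrite mulNr -mulrN opprB.
apply: (smooth_shift (f := fun x => flat_exp 0 (- n.+1%:R * x)) (- b)).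
exact: (smooth_scale _ (smooth_flat_exp 0)).
Qed.

Lemma flat_exp0_le1 x : flat_exp 0 x <= 1.
Proof.
rewrite /flat_exp; case: ifPn => // x0; rewrite expr0 invr1 mul1r.
by rewrite -expR0 ler_expR oppr_le0 invr_ge0 ltW.
Qed.

Lemma itv_bump_itv a b n x : 0 <= itv_bump a b n x <= 1.
Proof.
by rewrite mulr_ge0 ?flat_exp_ge0//= mulr_ile1// ?flat_exp_ge0// flat_exp0_le1.
Qed.

Lemma flat_exp0_gt0 x : (flat_exp 0 x != 0) = (0 < x).
Proof.
rewrite /flat_exp; case: ifPn; last by rewrite eqxx.
by move=> x0; rewrite expr0 invr1 mul1r gt_eqF// expR_gt0.
Qed.

Lemma itv_bump_neq0 a b n x : (itv_bump a b n x != 0) = (a < x < b).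
Proof.
by rewrite /itv_bump mulf_eq0 negb_or !flat_exp0_gt0 !pmulr_rgt0// !subr_gt0.
Qed.

Lemma flat_exp0_cvg x : 0 < x -> flat_exp 0 (n.+1%:R * x) @[n --> \oo] --> (1 : R).
Proof.
move=> x0.
rewrite (_ : (fun _ => _) = fun n : nat => expR (- (n.+1%:R^-1 * x^-1))); last first.
  apply/funext => n; rewrite /flat_exp mulr_gt0//.
  by rewrite expr0 invr1 mul1r invfM.
rewrite -[X in _ --> X]expR0; apply: continuous_cvg; first exact: continuous_expR.
rewrite -oppr0; apply: cvgN; rewrite -(mul0r x^-1).
by apply: cvgMl; exact: cvg_harmonic.
Qed.

Lemma itv_bump_cvg a b x : a < x < b -> itv_bump a b n x @[n --> \oo] --> (1 : R).
Proof.
move=> /andP[ax xb]; rewrite -[X in _ --> X]mulr1.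
by apply: cvgM; apply: flat_exp0_cvg; rewrite subr_gt0.
Qed.

End bump.

(** * Lebesgue measure and lattices of translations *)

Lemma measurable_countable_base d (T : measurableType d) (I : countType)
    (B : I -> set T) (O : set T) :
  (forall i, measurable (B i)) ->
  (forall x, O x -> exists i, B i x /\ B i `<=` O) -> measurable O.
Proof.
move=> mB HO.
rewrite (_ : O = \bigcup_n (if unpickle n is Some i then
    if `[< B i `<=` O >] then B i else set0 else set0)).
  apply: bigcupT_measurable => n; case: unpickle => [i|]; last exact: measurable0.
  by case: ifP => _; [exact: mB|exact: measurable0].
apply/seteqP; split => [x /HO[i [Bx BO]]|x [n _]].
  by exists (pickle i) => //; rewrite pickleK ifT//; exact/asboolP.
by case: unpickle => // i; case: asboolP => // BO /BO.
Qed.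

Lemma measurable_of_open_preimage d (T : measurableType d) (R : realType)
    (f : T -> R) :
  (forall a, measurable (f @^-1` `]a, +oo[)) -> measurable_fun setT f.
Proof.
move=> H; apply: (measurability _ (RGenOInfty.measurableE R)) => //.
by move=> _ [_ [a ->] <-]; rewrite setTI; exact: H.
Qed.

(** Bundles the pushforward as a measure, the form in which the uniqueness of Lebesgue and product
    measures can be applied to it. *)
Lemma pushforward_measureP d1 d2 (T1 : measurableType d1) (T2 : measurableType d2)
    (R : realType) (mu : {measure set T1 -> \bar R}) (f : T1 -> T2) :
  measurable_fun setT f ->
  exists m : {measure set T2 -> \bar R}, m = pushforward mu f :> (set T2 -> \bar R).
Proof.
move=> mf.
by exists (measure_function_pushforward__canonical__measure_function_Measure mu mf).
Qed.

Section boxes.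
Context {R : realType} {n : nat}.
Local Notation V := 'rV[R]_n.
Implicit Types (a b x y : V).

Definition box a b : set V := [set x | forall i, a ord0 i < x ord0 i < b ord0 i].
Definition cbox a b : set V := [set x | forall i, a ord0 i <= x ord0 i <= b ord0 i].

Lemma box_cbox a b : box a b `<=` cbox a b.
Proof. by move=> x abx i; have /andP[/ltW -> /ltW ->] := abx i. Qed.

Lemma measurable_box a b : measurable (box a b).
Proof.
rewrite (_ : box a b = \bigcap_(i in [set: 'I_n])
    ((fun x : V => x ord0 i) @^-1` `]a ord0 i, b ord0 i[)).
  apply: fin_bigcap_measurable => [|i _]; first exact: finite_finset.
  rewrite -[X in measurable X]setTI; apply: (@measurable_coord_rV _ R n i) => //.
by apply/seteqP; split => x abx i => [_|]; have := abx i; rewrite /= in_itv/=; exact.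
Qed.

Lemma rV_norm_lt x (e : R) : 0 < e -> (forall i, `|x ord0 i| < e) -> `|x| < e.
Proof.
move=> e0 H; have : ball_ (fun z : V => `|z|) 0 e (- x).
  rewrite -mx_norm_ball; split => // i j; rewrite !mxE /ball/= sub0r opprK.
  by rewrite (ord1 i); exact: H.
by rewrite /ball_/= sub0r opprK.
Qed.

Lemma rV_coord_le x i : `|x ord0 i| <= `|x|.
Proof.
rewrite [leRHS]mx_normrE; apply: (le_bigmax _ (fun i => `|x i.1 i.2|) (ord0, i)).
Qed.

Lemma cbox_closed a b : closed (cbox a b).
Proof.
rewrite (_ : cbox a b = \bigcap_(i in [set: 'I_n])
    ((fun x : V => x ord0 i) @^-1` `[a ord0 i, b ord0 i])).
  apply: closed_bigI => i _; apply: preimage_closed; last exact: itv_closed.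
  by move=> x _; exact: coord_continuous.
by apply/seteqP; split => x abx i => [_|]; have := abx i; rewrite /= in_itv/=; exact.
Qed.

Definition ratbox (q : 'rV[rat]_n * 'rV[rat]_n) : V * V :=
  (map_mx ratr q.1, map_mx ratr q.2).

Lemma ratbox_basis x (e : R) : 0 < e -> exists q,
  box (ratbox q).1 (ratbox q).2 x /\
  forall y, cbox (ratbox q).1 (ratbox q).2 y -> `|x - y| < e.
Proof.
move=> e0.
have /choice[f Hf] : forall i, exists q : rat * rat,
    x ord0 i - e / 2 < ratr q.1 < x ord0 i /\ x ord0 i < ratr q.2 < x ord0 i + e / 2.
  move=> i; have e20 : 0 < e / 2 by rewrite divr_gt0.
  have /rat_in_itvoo[q1 /itvP q1x] : x ord0 i - e / 2 < x ord0 i by rewrite ltrBlDr ltrDl.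
  have /rat_in_itvoo[q2 /itvP q2x] : x ord0 i < x ord0 i + e / 2 by rewrite ltrDl.
  by exists (q1, q2); rewrite /= !q1x !q2x.
exists (\row_i (f i).1, \row_i (f i).2); rewrite /ratbox/=; split.
  by move=> i; rewrite !mxE; have [/andP[_ ->] /andP[-> _]] := Hf i.
move=> y /= yab; apply: rV_norm_lt => // i; rewrite !mxE.
have := yab i; rewrite !mxE; have [/andP[? ?] /andP[? ?]] := Hf i.
by move=> /andP[? ?]; rewrite ltr_norml; apply/andP; split; lra.
Qed.

Lemma ratbox_open_basis (O : set V) x : open O -> O x -> exists q,
  box (ratbox q).1 (ratbox q).2 x /\ cbox (ratbox q).1 (ratbox q).2 `<=` O.
Proof.
move=> oO Ox; have /nbhs_ballP[e /= e0 eO] := open_nbhs_nbhs (conj oO Ox).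
have [q [qx qe]] := ratbox_basis x e0; exists q; split => // y /qe xy.
by apply: eO; rewrite -ball_normE.
Qed.

(** The sigma-algebra is generated by the coordinates, so topology enters through the countable base
    of rational boxes. *)
Lemma open_measurable_rV (O : set V) : open O -> measurable O.
Proof.
move=> oO; apply: (measurable_countable_base
  (B := fun q => box (ratbox q).1 (ratbox q).2)) => [q|x Ox].
  exact: measurable_box.
have [q [qx qO]] := ratbox_open_basis oO Ox; exists q; split => //.
exact: subset_trans (@box_cbox _ _) qO.
Qed.

Lemma closed_measurable_rV (C : set V) : closed C -> measurable C.
Proof.
move=> cC; rewrite -[C]setCK; apply: measurableC; apply: open_measurable_rV.
exact: closed_openC.
Qed.

Lemma continuous_measurable_rV (f : V -> R) : continuous f -> measurable_fun setT f.
Proof.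
move=> cf; apply: measurable_of_open_preimage => a; apply: open_measurable_rV.
by move/continuousP : cf; apply; exact: rray_open.
Qed.

Lemma open_measurable_time_rV (O : set (R * V)) : open O ->
  measurable (O : set (measurableTypeR R * V)).
Proof.
move=> oO; apply: (measurable_countable_base (T := (measurableTypeR R * V)%type)
  (B := fun q : (rat * rat) * ('rV[rat]_n * 'rV[rat]_n) =>
    `]ratr q.1.1, ratr q.1.2[ `*` box (ratbox q.2).1 (ratbox q.2).2)) => [q|[t x] Ox].
  by apply: measurableX; [exact: measurable_itv|exact: measurable_box].
have /nbhs_ballP[e /= e0 eO] := open_nbhs_nbhs (conj oO Ox).
have [q [qx qe]] := ratbox_basis x e0.
have /rat_in_itvoo[q1 /itvP q1x] : t - e < t by rewrite ltrBlDr ltrDl.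
have /rat_in_itvoo[q2 /itvP q2x] : t < t + e by rewrite ltrDl.
exists ((q1, q2), q); split => /=.
  by split => //=; rewrite in_itv/= q1x q2x.
move=> [s y] [/=]; rewrite in_itv/= => /andP[s1 s2] /(@box_cbox _ _)/qe xy.
apply: eO; split => /=; last by rewrite -ball_normE.
rewrite /ball/= ltr_norml.
have t1 : t - e < ratr q1 by rewrite q1x.
have t2 : ratr q2 < t + e by rewrite q2x.
by apply/andP; split; lra.
Qed.

Lemma continuous_measurable_time_rV (f : R * V -> R) : continuous f ->
  measurable_fun setT (f : measurableTypeR R * V -> R).
Proof.
move=> cf; apply: measurable_of_open_preimage => a; apply: open_measurable_time_rV.
by move/continuousP : cf; apply; exact: rray_open.
Qed.

End boxes.

Section lebesgue_rV_theory.
Context {R : realType}.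

Lemma lebesgue_measure_shift (c : R) (A : set (measurableTypeR R)) : measurable A ->
  lebesgue_measure ((fun x => x + c) @^-1` A) = lebesgue_measure A.
Proof.
move=> mA.
have mc : measurable_fun setT (fun x : measurableTypeR R => x + c).
  by apply: measurable_funD.
have [m mE] := @pushforward_measureP _ _ (measurableTypeR R) (measurableTypeR R)
  R lebesgue_measure _ mc.
rewrite [RHS](lebesgue_measure_unique (mu := m)) ?mE// => X [[a b] _ <-].
rewrite /pushforward; transitivity (lebesgue_measure `]a - c, b - c]).
  rewrite !lebesgue_measure_itv/= !lte_fin ltrD2r.
  by case: ifP => // _; rewrite -!EFinB; congr EFin; ring.
congr (lebesgue_measure _).
by apply/seteqP; split => x /=; rewrite !in_itv/= ltrBlDr lerBrDr.
Qed.

Lemma measurable_shift_rV n (c : 'rV[R]_n) :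
  measurable_fun setT (fun x : 'rV[R]_n => x + c).
Proof.
apply: measurable_fun_rVP => i.
apply: (eq_measurable_fun (fun x : 'rV[R]_n => x ord0 i + c ord0 i)) => [x _|].
  by rewrite mxE.
by apply: measurable_funD => //; exact: measurable_coord_rV.
Qed.

Lemma measurable_preimage_shift n (c : 'rV[R]_n) A : measurable A ->
  measurable ((fun x : 'rV[R]_n => x + c) @^-1` A).
Proof.
by move=> mA; rewrite -[X in measurable X]setTI; exact: measurable_shift_rV.
Qed.

Lemma cons_rV_head n (p : measurableTypeR R * 'rV[R]_n) :
  cons_rV p ord0 ord0 = p.1.
Proof. by rewrite -[in RHS](cons_rVK p). Qed.

Lemma cons_rV_tail n (p : measurableTypeR R * 'rV[R]_n) i :
  cons_rV p ord0 (lift ord0 i) = p.2 ord0 i.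
Proof. by rewrite -[in RHS](cons_rVK p) /= mxE. Qed.

(** Induction on the dimension: in the coordinates of [cons_rV] a translation is a product of
    translations, and by uniqueness of the product measure it is enough to compare rectangles. *)
Lemma lebesgue_rV_shift n (c : 'rV[R]_n) A : measurable A ->
  lebesgue_rV n ((fun x => x + c) @^-1` A) = lebesgue_rV n A.
Proof.
elim: n c A => [|n IH] c A mA.
  congr (lebesgue_rV 0 _); apply/seteqP; split => x /=;
  by rewrite (thinmx0 c) addr0.
pose P := (@lebesgue_measure R \x @lebesgue_rV R n)%E.
pose c' : 'rV[R]_n := \row_i c ord0 (lift ord0 i).
pose sg (p : measurableTypeR R * 'rV[R]_n) : measurableTypeR R * 'rV[R]_n :=
  (p.1 + c ord0 ord0, p.2 + c').
have msg : measurable_fun setT sg.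
  apply/measurable_fun_pairP; split.
    by apply: measurable_funD => //; exact: measurable_fst.
  apply: (measurableT_comp (measurable_shift_rV c')).
  exact: measurable_snd.
have [m mE] := pushforward_measureP (@lebesgue_measure R \x @lebesgue_rV R n)%E msg.
have consE p : cons_rV p + c = cons_rV (sg p).
  rewrite -[LHS](uncons_rVK) -[RHS](uncons_rVK) cons_rVK.
  rewrite /uncons_rV/=; congr cons_rV; congr pair.
    by rewrite mxE cons_rV_head.
  apply/rowP => i.
  transitivity (cons_rV p ord0 (lift ord0 i) + c ord0 (lift ord0 i)).
    by rewrite mxE [LHS]mxE.
  by rewrite cons_rV_tail !mxE.
change (P (@cons_rV R n @^-1` ((fun x => x + c) @^-1` A)) = P (@cons_rV R n @^-1` A)).
rewrite [RHS](product_measure_unique (m' := m)).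
- rewrite mE /pushforward; congr (P _).
  by apply/seteqP; split => p /=; rewrite consE.
- move=> A1 A2 mA1 mA2; rewrite mE /pushforward.
  rewrite (_ : sg @^-1` (A1 `*` A2) =
    ((fun x => x + c ord0 ord0) @^-1` A1) `*` ((fun x => x + c') @^-1` A2))//.
  have E1 := lebesgue_measure_shift (c ord0 ord0) mA1.
  have E2 := IH c' _ mA2.
  apply: (etrans _ (congr2 mule E1 E2)).
  apply: product_measure1E; last exact: measurable_preimage_shift.
  by rewrite -[X in measurable X]setTI; apply: measurable_funD.
- by rewrite -[X in measurable X]setTI; exact: measurable_cons_rV.
Qed.

Lemma lebesgue_rV_box n (a b : 'rV[R]_n) : (lebesgue_rV n (box a b) < +oo)%E.
Proof.
elim: n a b => [|n IH] a b.
  by rewrite /= diracE ltry.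
pose P := (@lebesgue_measure R \x @lebesgue_rV R n)%E.
change (P (@cons_rV R n @^-1` box a b) < +oo)%E.
have -> : @cons_rV R n @^-1` box a b = `]a ord0 ord0, b ord0 ord0[ `*`
    box (\row_i a ord0 (lift ord0 i)) (\row_i b ord0 (lift ord0 i)).
  apply/seteqP; split => p /=.
    move=> abp; split.
      by rewrite in_itv/= -cons_rV_head; exact: abp.
    by move=> i; have := abp (lift ord0 i); rewrite cons_rV_tail !mxE.
  move=> [p1 p2] i.
  have [->|[j ->]] : i = ord0 \/ exists j, i = lift ord0 j.
    by case: (unliftP ord0 i) => [j ->|->]; [right; exists j|left].
    by move: p1; rewrite in_itv/= cons_rV_head.
  by have := p2 j; rewrite cons_rV_tail !mxE.
rewrite /P product_measure1E//; last exact: measurable_box.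
rewrite lte_mul_pinfty//.
  rewrite ge0_fin_numE//; apply: (@le_lt_trans _ _
    (lebesgue_measure `]a ord0 ord0, b ord0 ord0[)); first exact: lexx.
  by rewrite lebesgue_measure_itv/=; case: ifP => _; rewrite ?ltry.
Qed.

Lemma lebesgue_rV_bounded n (A : set 'rV[R]_n) (r : R) : measurable A ->
  (forall x, A x -> `|x| < r) -> (lebesgue_rV n A < +oo)%E.
Proof.
move=> mA Ar.
apply: le_lt_trans (lebesgue_rV_box (const_mx (- r)) (const_mx r)).
apply: le_measure; rewrite ?inE//; first exact: measurable_box.
move=> x Ax i; rewrite !mxE -ltr_norml.
by apply: le_lt_trans (rV_coord_le x i) (Ar _ Ax).
Qed.

Lemma compact_rV_bounded n (K : set 'rV[R]_n) : compact K ->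
  exists2 r : R, 0 < r & forall x, K x -> `|x| < r.
Proof.
move=> /compact_bounded[M [_ HM]]; exists (`|M| + 2); first by rewrite ltr_wpDl.
move=> x Kx; have : `|x| <= `|M| + 1.
  by apply: HM => //; rewrite (le_lt_trans (ler_norm M))// ltrDl.
by move=> /le_lt_trans; apply; rewrite ltrD2l ltr1n.
Qed.

End lebesgue_rV_theory.

Section integral_shift.
Context {R : realType} {n : nat}.
Local Notation V := 'rV[R]_n.
Local Notation mu := (lebesgue_rV n).

Lemma ge0_integral_shift (c : V) (A : set V) (h : V -> \bar R) : measurable A ->
  measurable_fun setT h -> (forall x, (0 <= h x)%E) ->
  (\int[mu]_(x in (fun x => x + c)%R @^-1` A) h (x + c)%R = \int[mu]_(x in A) h x)%E.
Proof.
move=> mA mh h0.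
have mc := measurable_shift_rV c.
have [m mE] := pushforward_measureP mu mc.
transitivity (\int[m]_(x in A) h x)%E; last first.
  apply: eq_measure_integral => X mX _; rewrite mE.
  exact: lebesgue_rV_shift.
transitivity (\int[pushforward mu (fun x => x + c)%R]_(x in A) h x)%E.
  by rewrite ge0_integral_pushforward//; exact: measurable_funTS.
by apply: eq_measure_integral => X mX _; rewrite mE.
Qed.

End integral_shift.

(** * Lattices of translations and their fundamental domains *)

Section lattice.
Context {R : realType} {n : nat}.
Local Notation V := 'rV[R]_n.
Local Notation mu := (lebesgue_rV n).
Variable G : set V.
Hypothesis hG : translation_lattice G.

Lemma lattice0 : G 0.
Proof. by have [] := hG. Qed.

Lemma latticeB u w : G u -> G w -> G (u - w).
Proof. by have [_ H _] := hG; exact: H. Qed.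

Lemma latticeN u : G u -> G (- u).
Proof. by move=> Gu; rewrite -sub0r; apply: latticeB => //; exact: lattice0. Qed.

Lemma latticeD u w : G u -> G w -> G (u + w).
Proof. by move=> Gu Gw; rewrite -[w]opprK; apply: latticeB => //; exact: latticeN. Qed.

(** A rational box around u of radius less than [r / 2] contains no other point of G, so boxes
    number the points injectively. The values are optional because G may be finite. *)
Lemma lattice_enum : exists l : nat -> option V,
  [/\ forall k u, l k = Some u -> G u,
      forall u, G u -> exists k, l k = Some u &
      forall j k u, l j = Some u -> l k = Some u -> j = k].
Proof.
have [_ _ [r r0 Hr]] := hG.
have r20 : 0 < r / 2 by rewrite divr_gt0.
have /choice[q Hq] := fun u : V => ratbox_basis u r20.
pose code u := pickle (q u).
have code_inj u w : G u -> G w -> code u = code w -> u = w.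
  move=> Gu Gw /(pcan_inj pickleK) uw; apply/eqP; rewrite -subr_eq0; apply/eqP.
  apply: Hr; first exact: latticeB.
  have [ux _] := Hq u; have [wx Hw] := Hq w.
  have := Hw u; rewrite -uw => /(_ (box_cbox ux)).
  by rewrite distrC => /lt_trans; apply; rewrite ltr_pdivrMr// mulr_natr mulr2n ltrDr.
pose l k := if pselect (exists u, G u /\ code u = k) is left H
  then Some (projT1 (cid H)) else None.
have lP k u : l k = Some u -> G u /\ code u = k.
  rewrite /l; case: pselect => // H [<-]; exact: (projT2 (cid H)).
exists l; split => [k u /lP[]//|u Gu|j k u /lP[_ <-] /lP[_ <-]//].
exists (code u); rewrite /l; case: pselect => [H|[]]; last by exists u.
have [Gc cc] := projT2 (cid H).
by congr Some; exact: code_inj.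
Qed.

Section domains.
Variables (D D' : set V).
Hypotheses (hD : fundamental_domain G D) (hD' : fundamental_domain G D').

(** Cut [D] into the pieces that a translation by a vector of G carries into [D']. The translated
    pieces partition [D'], and neither the measure, nor [E], nor [h] changes under these
    translations. *)
Lemma ge0_integral_domain (E : set V) (h : V -> \bar R) :
  measurable E ->
  measurable_fun setT h -> (forall x, (0 <= h x)%E) ->
  (forall x u, G u -> h (x + u)%R = h x) ->
  (forall x u, G u -> E x -> E (x + u)%R) ->
  (\int[mu]_(x in D `&` E) h x = \int[mu]_(x in D' `&` E) h x)%E.
Proof.
move=> mE mh h0 hper Eper; have [l [lG lsurj linj]] := lattice_enum.
have [mD HD] := hD; have [mD' HD'] := hD'.
pose F k := if l k is Some u then D `&` ((fun x => x - u) @^-1` D') `&` E else set0.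
pose F' k := if l k is Some u then D' `&` ((fun x => x + u) @^-1` D) `&` E else set0.
have mF k : measurable (F k).
  rewrite /F; case: (l k) => // u; do 2!apply: measurableI => //.
  exact: measurable_preimage_shift.
have mF' k : measurable (F' k).
  rewrite /F'; case: (l k) => // u; do 2!apply: measurableI => //.
  exact: measurable_preimage_shift.
have DF : D `&` E = \bigcup_k F k.
  apply/seteqP; split => [x [Dx Ex]|x [k _]].
    have [u [[Gu D'u] _]] := HD' x; have [k lk] := lsurj _ Gu.
    by exists k => //; rewrite /F lk.
  by rewrite /F; case: (l k) => // u [[]].
have DF' : D' `&` E = \bigcup_k F' k.
  apply/seteqP; split => [x [Dx Ex]|x [k _]].
    have [u [[Gu Du] _]] := HD x; have [k lk] := lsurj _ (latticeN Gu).
    by exists k => //; rewrite /F' lk.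
  by rewrite /F'; case: (l k) => // u [[]].
have tF : trivIset setT F.
  move=> j k _ _ [x []]; rewrite /F.
  case lj : (l j) => [u|//]; case lk : (l k) => [w|//] [[_ /= D1] _] [[_ /= D2] _].
  have [z [_ Hz]] := HD' x.
  have zu := Hz u (conj (lG _ _ lj) D1); have zw := Hz w (conj (lG _ _ lk) D2).
  by apply: linj lj _; rewrite -zu zw.
have tF' : trivIset setT F'.
  move=> j k _ _ [x []]; rewrite /F'.
  case lj : (l j) => [u|//]; case lk : (l k) => [w|//] [[_ /= D1] _] [[_ /= D2] _].
  have [z [_ Hz]] := HD x.
  have := Hz (- u); rewrite opprK => /(_ (conj (latticeN (lG _ _ lj)) D1)) zu.
  have := Hz (- w); rewrite opprK => /(_ (conj (latticeN (lG _ _ lk)) D2)) zw.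
  by apply: linj lj _; rewrite -[u]opprK -zu zw opprK.
rewrite DF DF' !ge0_integral_bigcup//; try exact: measurable_funTS.
apply: eq_eseriesr => k _; rewrite /F /F'; case lk: (l k) => [u|]; last first.
  by rewrite !integral_set0.
rewrite -(ge0_integral_shift u)//; last first.
  do 2!apply: measurableI => //; exact: measurable_preimage_shift.
have Gu := lG _ _ lk.
rewrite (_ : _ @^-1` _ = D' `&` (fun x => x + u) @^-1` D `&` E); last first.
  apply/seteqP; split => x /=; rewrite addrK => -[[? ?] ?]; split => //.
    by rewrite -(addrK u x); apply: Eper => //; exact: latticeN.
  exact: Eper.
by apply: eq_integral => x _; exact: hper.
Qed.

End domains.

Section domain.
Variable D : set V.
Hypothesis hD : fundamental_domain G D.

Lemma fundamental_domain_shift c :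
  fundamental_domain G ((fun x => x + c) @^-1` D).
Proof.
have [mD HD] := hD; split; first exact: measurable_preimage_shift.
move=> x; have [u [[Gu Du] Hu]] := HD (x + c); exists u; split => /=.
  by split => //; rewrite addrAC.
by move=> w [Gw Dw]; apply: Hu; split => //; rewrite addrAC.
Qed.

(** Translating the integrand amounts to translating [D], and a translate of [D] is again a
    fundamental domain. *)
Lemma ge0_integral_domain_shift c (h : V -> \bar R) :
  measurable_fun setT h -> (forall x, (0 <= h x)%E) ->
  (forall x u, G u -> h (x + u)%R = h x) ->
  (\int[mu]_(x in D) h (x + c)%R = \int[mu]_(x in D) h x)%E.
Proof.
move=> mh h0 hper; have hDc := fundamental_domain_shift (- c).
have [mD HD] := hD.
have := ge0_integral_domain hD hDc measurableT mh h0 hper (fun _ _ _ _ => I).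
rewrite !setIT => ->; rewrite -[RHS](ge0_integral_shift c)//; last first.
  exact: measurable_preimage_shift.
by rewrite -comp_preimage (_ : _ \o _ = id)//; apply/funext => x /=; rewrite addrK.
Qed.

Lemma integral_domain_shift c (h : V -> R) :
  measurable_fun setT h -> (forall x u, G u -> h (x + u) = h x) ->
  (\int[mu]_(x in D) (h (x + c)%R)%:E = \int[mu]_(x in D) (h x)%:E)%E.
Proof.
move=> mh hper; rewrite integralE [RHS]integralE.
have mEh : measurable_fun setT (EFin \o h) by exact/measurable_EFinP.
have perp x u : G u -> ((EFin \o h)^\+)%E (x + u) = ((EFin \o h)^\+)%E x.
  by move=> Gu; rewrite !funeposE/= hper.
have pern x u : G u -> ((EFin \o h)^\-)%E (x + u) = ((EFin \o h)^\-)%E x.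
  by move=> Gu; rewrite !funenegE/= hper.
congr (_ - _)%E.
- have H := ge0_integral_domain_shift c (measurable_funepos mEh)
    (fun x => funepos_ge0 _ x) perp.
  by etransitivity; [|exact: H]; apply: eq_integral => x _; rewrite !funeposE.
- have H := ge0_integral_domain_shift c (measurable_funeneg mEh)
    (fun x => funeneg_ge0 _ x) pern.
  by etransitivity; [|exact: H]; apply: eq_integral => x _; rewrite !funenegE.
Qed.

(** The pieces of [D] in the translates of [K], moved back into [K], are disjoint, so their measures
    add up to at most that of [K]. *)
Lemma domain_measure_lt_pinfty (M K : set V) : measurable M -> compact K ->
  (forall x, M x -> exists y u, [/\ K y, G u & x = y + u]) ->
  (mu (M `&` D) < +oo)%E.
Proof.
move=> mM cK MK; have [l [lG lsurj linj]] := lattice_enum.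
have [mD HD] := hD.
have [r r0 Kr] := compact_rV_bounded cK.
have mK : measurable K.
  by apply: closed_measurable_rV; exact: compact_closed.
pose F k := if l k is Some u then D `&` ((fun x => x - u) @^-1` K) else set0.
pose F' k := if l k is Some u then ((fun x => x + u) @^-1` D) `&` K else set0.
have mF k : measurable (F k).
  rewrite /F; case: (l k) => // u; apply: measurableI => //.
  exact: measurable_preimage_shift.
have mF' k : measurable (F' k).
  rewrite /F'; case: (l k) => // u; apply: measurableI => //.
  exact: measurable_preimage_shift.
have tF' : trivIset setT F'.
  move=> j k _ _ [x []]; rewrite /F'.
  case lj : (l j) => [u|//]; case lk : (l k) => [w|//] [/= D1 _] [/= D2 _].
  have [z [_ Hz]] := HD x.
  have := Hz (- u); rewrite opprK => /(_ (conj (latticeN (lG _ _ lj)) D1)) zu.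
  have := Hz (- w); rewrite opprK => /(_ (conj (latticeN (lG _ _ lk)) D2)) zw.
  by apply: linj lj _; rewrite -[u]opprK -zu zw opprK.
have FF' k : mu (F k) = mu (F' k).
  rewrite /F /F'; case: (l k) => [u|//].
  rewrite -(lebesgue_rV_shift u); last first.
    by apply: measurableI => //; exact: measurable_preimage_shift.
  by congr (mu _); apply/seteqP; split => x /=; rewrite addrK.
apply: (@le_lt_trans _ _ (mu (\bigcup_k F k))).
  apply: le_measure; rewrite ?inE; first exact: measurableI.
    exact: bigcupT_measurable.
  move=> x [/MK[y [u [Ky Gu xE]]] Dx]; have [k lk] := lsurj _ Gu.
  by exists k => //; rewrite /F lk; split => //=; rewrite xE addrK.
apply: (@le_lt_trans _ _ (\sum_(k <oo) mu (F k))%E).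
  by apply: generalized_Boole_inequality => //; exact: bigcupT_measurable.
rewrite (eq_eseriesr (fun k _ => FF' k)).
have -> : (\sum_(k <oo) mu (F' k) = mu (\bigcup_k F' k))%E.
  rewrite measure_bigcup//.
  by apply: eq_eseriesl => k; rewrite in_setT.
apply: (@le_lt_trans _ _ (mu K)); last exact: lebesgue_rV_bounded mK Kr.
apply: le_measure; rewrite ?inE//; first exact: bigcupT_measurable.
by move=> x [k _]; rewrite /F'; case: (l k) => // u [].
Qed.

End domain.
End lattice.

(** * Test functions *)

Section segment_FTC.
Context {R : realType}.

Lemma smooth_FTC (f : R -> R) (a b : R) : a < b -> smooth f ->
  \int[lebesgue_measure]_(t in `[a, b]) 'D_1 f t = f b - f a.
Proof.
move=> ab sf; rewrite /Rintegral (@continuous_FTC2 _ _ f)//.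
- by apply: continuous_subspaceT; apply: smooth_continuous; exact: smooth_derive.
- split => //.
  + by move=> x _; exact: smooth_derivable.
  + by apply: cvg_at_right_filter; exact: smooth_continuous.
  + by apply: cvg_at_left_filter; exact: smooth_continuous.
- by move=> x _; rewrite derive1E.
Qed.

End segment_FTC.

Section test_function_theory.
Context {R : realType} {V : normedModType R}.
Variables (G A : set V).
Implicit Types psi : V -> R.

Lemma test_smooth psi : test_function G A psi -> smooth psi.
Proof. by case. Qed.

Lemma test_vanish psi x : test_function G A psi -> ~ A° x ->
  \forall y \near x, psi y = 0.
Proof.
move=> [_ _ sA] Ax.
have : (~` closure [set x | psi x != 0]) x by move=> /sA.
rewrite -interiorC /interior/=.
by apply: filterS => y /= /negP; rewrite negbK => /eqP.
Qed.

Lemma test_derive psi u : test_function G A psi -> test_function G A ('D_u psi).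
Proof.
move=> tpsi; have [spsi ppsi sA] := tpsi; split.
- exact: smooth_derive.
- move=> w x Gw; rewrite -[RHS](near_eq_derive (f := fun y => psi (y + w))).
    rewrite /derive/=.
    by under eq_fun do rewrite addrA.
  by apply: nearW => y; exact: ppsi.
- move=> x cx; apply: contrapT => Ax.
  have := near_join (test_vanish tpsi Ax).
  move=> /cx[y [/= /negP + /= Hy]]; apply.
  rewrite (near_eq_derive (g := cst 0)) ?derive_cst//.
Qed.

Lemma test_zero psi x : test_function G A psi -> ~ A x -> psi x = 0.
Proof.
move=> tpsi Ax; have : ~ A° x by move=> /interior_subset.
by move=> /(test_vanish tpsi)/nbhs_singleton.
Qed.

End test_function_theory.

Section periodic_integration.
Context {R : realType} {d : nat}.
Local Notation V := 'rV[R]_d.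
Local Notation mu := (lebesgue_rV d).
Variables (G M D : set V).
Hypotheses (hM : flat_manifold G M) (hD : fundamental_domain G D).

Let hG := flat_lattice hM.

Lemma flat_measurable : measurable M.
Proof. by apply: closed_measurable_rV; exact: flat_closed hM. Qed.

Lemma domain_measurable : measurable D.
Proof. by have [] := hD. Qed.

Lemma flat_domain_measurable : measurable (M `&` D).
Proof. by apply: measurableI; [exact: flat_measurable|exact: domain_measurable]. Qed.

Lemma flat_measure_lt_pinfty : (mu (M `&` D) < +oo)%E.
Proof.
have [K cK KM] := flat_compact hM.
exact: (domain_measure_lt_pinfty hG hD flat_measurable cK KM).
Qed.

(** Representatives are needed inside M itself, where the flow is controlled. *)
Lemma flat_core : exists2 K : set V, compact K /\ K `<=` M &
  forall x, M x -> exists y u, [/\ K y, G u & x = y + u].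
Proof.
have [K cK KM] := flat_compact hM; exists (K `&` M).
  by split => //; apply: compact_closedI => //; exact: flat_closed hM.
move=> x Mx; have [y [u [Ky Gu xE]]] := KM _ Mx; exists y, u; split => //.
split => //; rewrite -(addrK u y) -xE.
by apply: (flat_invariant hM) => //; exact: latticeN.
Qed.

Lemma periodic_continuous_bounded (f : V -> R) : continuous f -> Defs.periodic G f ->
  exists C, forall x, M x -> `|f x| <= C.
Proof.
move=> cf pf; have [K [cK KM] MK] := flat_core.
have : compact (f @` K) by apply: continuous_compact => //; exact: continuous_subspaceT.
move=> /compact_bounded[C [_ HC]]; exists (C + 1) => x /MK[y [u [Ky Gu ->]]].
by rewrite pf//; apply: (HC (C + 1)) => /=; [rewrite ltrDl|exists y].
Qed.

Lemma test_bounded psi : test_function G M psi -> exists C, forall x, `|psi x| <= C.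
Proof.
move=> tpsi; have [spsi ppsi _] := tpsi.
have [C HC] := periodic_continuous_bounded (smooth_continuous spsi) ppsi.
exists `|C| => x; have [Mx|Mx] := pselect (M x).
  by apply: le_trans (HC _ Mx) _; exact: ler_norm.
by rewrite (test_zero tpsi Mx) normr0.
Qed.

Lemma test_measurable psi : test_function G M psi -> measurable_fun setT psi.
Proof. by move=> [spsi _ _]; apply: continuous_measurable_rV; exact: smooth_continuous. Qed.

Lemma test_L2 psi : test_function G M psi -> L2_M M D psi.
Proof.
move=> tpsi; have [C HC] := test_bounded tpsi.
apply: (L2_on_bounded flat_domain_measurable flat_measure_lt_pinfty).
  by apply: measurable_funTS; exact: test_measurable.
by move=> x _; exact: HC.
Qed.

Lemma test_integrable psi : test_function G M psi ->
  mu.-integrable D (EFin \o psi).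
Proof.
move=> tpsi; have [C HC] := test_bounded tpsi.
have mD := domain_measurable; have mpsi := test_measurable tpsi.
rewrite -(setIidl (@subsetT _ D)).
have : mu.-integrable (M `&` D) (EFin \o psi).
  apply: measurable_bounded_integrable flat_measure_lt_pinfty _ _.
  - exact: flat_domain_measurable.
  - exact: measurable_funTS.
  - exists C; split; first exact: num_real.
    by move=> y Cy x _ /=; exact: le_trans (HC x) (ltW Cy).
rewrite (integrable_mkcond _ flat_domain_measurable) setIT => H.
apply/(integrable_mkcond _ mD); move: H; congr (integrable _ _ _).
apply/funext => x; rewrite !patchE; case: ifPn => [|xMD].
  by rewrite inE => -[_ Dx]; rewrite mem_set.
case: ifPn => //; rewrite inE => Dx /=; rewrite (test_zero tpsi)// => Mx.
by move/negP: xMD; apply; rewrite inE.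
Qed.

Lemma test_integral_domain psi : test_function G M psi ->
  \int[mu]_(x in M `&` D) psi x = \int[mu]_(x in D) psi x.
Proof.
move=> tpsi; rewrite Rintegral_mkcond [RHS]Rintegral_mkcond.
apply: eq_Rintegral => x _; rewrite !patchE; case: ifPn => [|xMD].
  by rewrite inE => -[_ Dx]; rewrite mem_set.
case: ifPn => //; rewrite inE => Dx /=; rewrite (test_zero tpsi)// => Mx.
by move/negP: xMD; apply; rewrite inE.
Qed.

(* Averaging [psi (x + u) - psi x = \int_0^1 'D_u psi (x + s u) ds] over a
   fundamental domain: the left side integrates to 0 and, for each s, the
   translated integrand has the same integral as ['D_u psi]. *)
Lemma test_derive_integral psi u : test_function G M psi ->
  \int[mu]_(x in M `&` D) 'D_u psi x = 0.
Proof.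
move=> tpsi; have tDpsi := test_derive u tpsi.
rewrite test_integral_domain//; have mD := domain_measurable.
set g := 'D_u psi in tDpsi *.
have [spsi ppsi _] := tpsi; have [sg pg _] := tDpsi.
have mg := test_measurable tDpsi; have ig := test_integrable tDpsi.
have mpsi := test_measurable tpsi; have ipsi := test_integrable tpsi.
pose I01 : set (measurableTypeR R) := `[0, 1]%classic.
pose F (p : measurableTypeR R * V) : \bar R :=
  ((g (p.2 + p.1 *: u)) * \1_(I01 `*` D) p)%:E.
have cstI (c : \bar R) : (\int[lebesgue_measure]_(t in I01) c = c)%E.
  rewrite integral_cst; last exact: measurable_itv.
  rewrite -[RHS]mule1; congr (_ * _)%E.
  transitivity (lebesgue_measure `[(0 : R), 1]); first by [].
  by rewrite lebesgue_measure_itv/= lte_fin ltr01 sube0.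
have mI01 : measurable (I01 `*` D) by apply: measurableX => //; exact: measurable_itv.
have mF : measurable_fun setT F.
  apply/measurable_EFinP/measurable_funM; last exact: measurable_indic.
  apply: continuous_measurable_time_rV => p.
  apply: (@continuous_comp _ _ _ (fun p : R * V => p.2 + p.1 *: u) g).
    apply: cvgD; first exact: cvg_snd.
    by apply: cvgZr_tmp; exact: cvg_fst.
  exact: smooth_continuous.
have FE t x : F (t, x) = if (t \in I01) && (x \in D)
    then (g (x + t *: u))%:E else 0%E.
  rewrite /F/= indicE in_setX; case: ifP => _; by rewrite ?mulr1 ?mulr0.
have normFE t x : `|F (t, x)|%E = if (t \in I01) && (x \in D)
    then `|(g (x + t *: u))%:E|%E else 0%E.
  by rewrite FE; case: ifP => //; rewrite abse0.
have shiftabs t : (\int[mu]_(x in D) `|(g (x + t *: u))%:E| =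
    \int[mu]_(x in D) `|(g x)%:E|)%E.
  apply: (ge0_integral_domain_shift hG hD (t *: u) (h := fun x => `|(g x)%:E|%E)) => //.
    by apply: measurableT_comp => //; exact/measurable_EFinP.
  by move=> x w Gw; rewrite pg.
have iF : (lebesgue_measure \x mu)%E.-integrable setT F.
  apply/integrable12ltyP => //.
  rewrite (_ : (fun _ => _) =
      ((fun t => \int[mu]_(x in D) `|(g x)%:E|)%E \_ I01)); last first.
    apply/funext => t; rewrite patchE; case: ifPn => tI.
      rewrite -(shiftabs t) [RHS]integral_mkcond; apply: eq_integral => x _.
      by rewrite normFE tI patchE.
    by rewrite integral0_eq// => x _; rewrite normFE (negbTE tI).
  by rewrite -integral_mkcond cstI; have /integrableP[] := ig.
have := Fubini iF.
have -> : (\int[lebesgue_measure]_t \int[mu]_x F (t, x) = \int[mu]_(x in D) (g x)%:E)%E.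
  rewrite (_ : (fun _ => _) = ((fun t => \int[mu]_(x in D) (g x)%:E)%E \_ I01)); last first.
    apply/funext => t; rewrite patchE; case: ifPn => tI.
      rewrite -(integral_domain_shift hG hD (t *: u) mg
        (fun x w Gw => pg w x Gw)).
      rewrite [RHS]integral_mkcond; apply: eq_integral => x _.
      by rewrite FE tI patchE.
    by rewrite integral0_eq// => x _; rewrite FE (negbTE tI).
  by rewrite -integral_mkcond cstI.
have -> : (\int[mu]_x \int[lebesgue_measure]_t F (t, x) =
    \int[mu]_(x in D) (psi (x + u) - psi x)%:E)%E.
  rewrite [RHS]integral_mkcond; apply: eq_integral => x _; rewrite patchE.
  case: ifPn => xD; last first.
    by rewrite integral0_eq// => t _; rewrite FE (negbTE xD) andbF.
  pose f (s : R) := psi (x + s *: u).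
  have sf : smooth f by exact: smooth_line.
  have Df t : 'D_1 f t = g (x + t *: u) by exact: derive_line.
  have := smooth_FTC ltr01 sf.
  rewrite /f scale1r scale0r addr0 => <-.
  rewrite /Rintegral fineK; last first.
    apply: integrable_fin_num; first exact: measurable_itv.
    apply: continuous_compact_integrable; first exact: segment_compact.
    by apply: continuous_subspaceT; apply: smooth_continuous; exact: smooth_derive.
  rewrite [RHS]integral_mkcond; apply: eq_integral => t _.
  by rewrite FE xD andbT patchE /= Df.
move=> E1; rewrite /Rintegral E1.
have ishift : mu.-integrable D (fun x => (psi (x + u))%:E).
  apply/integrableP; split.
    apply/measurable_EFinP/measurable_funTS.
    exact: (measurableT_comp mpsi (measurable_shift_rV u)).
  have -> : (\int[mu]_(x in D) `|(psi (x + u))%:E| = \int[mu]_(x in D) `|(psi x)%:E|)%E.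
    apply: (ge0_integral_domain_shift hG hD u (h := fun x => `|(psi x)%:E|%E)) => //.
      by apply: measurableT_comp => //; exact/measurable_EFinP.
    by move=> x w Gw; rewrite ppsi.
  by have /integrableP[] := ipsi.
under eq_integral do rewrite EFinB.
rewrite integralB// (integral_domain_shift hG hD u mpsi (fun x w Gw => ppsi w x Gw)) subee//.
exact: integrable_fin_num.
Qed.

End periodic_integration.

(** * The boundary is a null set *)

Section boundary.
Context {R : realType} {d : nat}.
Local Notation V := 'rV[R]_d.
Local Notation mu := (lebesgue_rV d).

(** For every N, the first N translates are disjoint in [B], so [N * mu Z <= mu B]. *)
Lemma null_of_disjoint_translates (Z B : set V) (s : nat -> V) :
  measurable Z -> measurable B -> (mu B < +oo)%E ->
  (forall k z, Z z -> B (z + s k)) ->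
  (forall j k z z', Z z -> Z z' -> z + s j = z' + s k -> j = k) ->
  mu Z = 0%E.
Proof.
move=> mZ mB Boo ZB disj.
pose F k := (fun x => x - s k) @^-1` Z.
have mF k : measurable (F k) by exact: measurable_preimage_shift.
have muF k : mu (F k) = mu Z by exact: lebesgue_rV_shift.
have FB k : F k `<=` B by move=> x /= /(ZB k); rewrite subrK.
have ZN N : (N%:R%:E * mu Z <= mu B)%E.
  have -> : (N%:R%:E * mu Z = mu (\big[setU/set0]_(i < N) F i))%E.
    rewrite measure_bigsetU_ord//.
      rewrite (eq_bigr (fun=> mu Z)); last by move=> i _; exact: muF.
      by rewrite sumr_const card_ord mule_natl.
    move=> j k _ _ [x [/= Zj Zk]]; apply/val_inj.
    by apply: (disj j k _ _ Zj Zk); rewrite !subrK.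
  apply: le_measure; rewrite ?inE//; first exact: bigsetU_measurable.
  by rewrite -bigcup_mkord => x [k _]; exact: FB.
have Zfin : mu Z \is a fin_num.
  rewrite ge0_fin_numE//; apply: le_lt_trans Boo.
  by have := ZN 1%N; rewrite mul1e.
apply/eqP; rewrite eq_le measure_ge0 andbT -(fineK Zfin) lee_fin.
apply/ler_addgt0Pl => eps eps0; rewrite addr0.
have Bfin : mu B \is a fin_num by rewrite ge0_fin_numE.
pose N := (Num.truncn (fine (mu B) / eps)).+1.
have := ZN N; rewrite -(fineK Zfin) -(fineK Bfin) -EFinM lee_fin => H.
have NB : fine (mu B) <= N%:R * eps.
  by rewrite -ler_pdivrMr// ltW// truncnS_gt.
have N0 : 0 < N%:R :> R by rewrite ltr0n.
by rewrite -(ler_pM2l N0); exact: le_trans H NB.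
Qed.

(** Countably many rational boxes cover [A], each meeting it in a negligible set. *)
Lemma negligible_local (A : set V) : measurable A ->
  (forall x, A x -> exists2 e : R, 0 < e & mu.-negligible (A `&` ball x e)) ->
  mu A = 0%E.
Proof.
move=> mA HA; apply: measure_negligible => //.
pose F n := if unpickle n is Some q then
  if `[< mu.-negligible (A `&` box (ratbox q).1 (ratbox q).2) >]
  then A `&` box (@ratbox R d q).1 (ratbox q).2 else set0 else set0.
have : mu.-negligible (\bigcup_k F k).
  apply: negligible_bigcup => k; rewrite /F; case: unpickle => [q|].
    by case: asboolP => // _; exact: negligible_set0.
  exact: negligible_set0.
apply: negligibleS => x Ax; have [e e0 nA] := HA _ Ax.
have [q [qx qe]] := ratbox_basis x e0.
exists (pickle q) => //; rewrite /F pickleK ifT//; apply/asboolP.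
apply: negligibleS nA => y [Ay qy]; split => //.
by rewrite -ball_normE; apply: qe; exact: box_cbox.
Qed.

Variables (G M : set V).
Hypothesis hM : flat_manifold G M.

Lemma derive_oppdir (f : V -> R) x u : smooth f -> 'D_(- u) f x = - 'D_u f x.
Proof. by move=> sf; rewrite -scaleN1r derive_smoothZ// scaleN1r. Qed.

(** Up to a change of sign the direction makes the derivative at p positive, and by continuity it
    stays positive on a ball. *)
Lemma boundary_chart p : M p -> ~ M° p -> exists (rho : V -> R) u (e : R),
  [/\ smooth rho, 0 < e & forall y, ball p e y ->
    0 < 'D_u rho y /\ (M y <-> rho y <= 0)].
Proof.
move=> Mp ip; have [rho [srho [u0 u0p] Hp]] := flat_boundary hM Mp ip.
have [u up] : exists u, 0 < 'D_u rho p.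
  have [H|H|H] := ltgtP ('D_u0 rho p) 0; last by rewrite H eqxx in u0p.
    by exists (- u0); rewrite derive_oppdir// oppr_gt0.
  by exists u0.
have Hd : \forall y \near p, 0 < 'D_u rho y.
  have : {for p, continuous ('D_u rho)}.
    by apply: smooth_continuous; exact: smooth_derive.
  by move=> /cvgr_gt; apply.
have : nbhs p [set y | 0 < 'D_u rho y /\ (M y <-> rho y <= 0)].
  exact: filterI Hd Hp.
move=> /nbhs_ballP[e /= e0 eH].
by exists rho, u, e; split => // y /eH.
Qed.

Lemma chart_interior p (rho : V -> R) (e : R) z : smooth rho ->
  (forall y, ball p e y -> rho y <= 0 -> M y) ->
  ball p e z -> rho z < 0 -> M° z.
Proof.
move=> srho He bz rz.
have N1 : \forall y \near z, rho y < 0.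
  have cz : {for z, continuous rho} by exact: smooth_continuous.
  by move: cz => /cvgr_lt; apply.
have N2 : \forall y \near z, ball p e y.
  by apply: open_nbhs_nbhs; split => //; exact: ball_open.
by apply: filterS2 N1 N2 => y ry by_; apply: He => //; exact: ltW.
Qed.

(* Translates of a small piece of the boundary along a direction that is
   transversal to it are disjoint, and infinitely many fit in a bounded set. *)
Lemma boundary_null : mu (M `\` M°) = 0%E.
Proof.
have mM := flat_measurable hM.
have mI : measurable M° by apply: open_measurable_rV; exact: open_interior.
apply: negligible_local => [|p [Mp ip]]; first exact: measurableD.
have [rho [u [e [srho e0 He]]]] := boundary_chart Mp ip.
pose Z := (M `\` M°) `&` ball p (e / 2).
have e20 : 0 < e / 2 by rewrite divr_gt0.
exists (e / 2) => //; rewrite -/Z.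
have mZ : measurable Z.
  by apply: measurableI; [exact: measurableD|apply: open_measurable_rV; exact: ball_open].
have Z0 z : Z z -> rho z = 0.
  move=> [[Mz iz] bz].
  have bz' : ball p e z by apply: le_ball bz; lra.
  have [_ Hz] := He _ bz'; apply/eqP; rewrite eq_le (Hz.1 Mz)/= leNgt.
  apply/negP => rz; apply: iz; apply: chart_interior srho _ bz' rz.
  by move=> y by_ ry; have [_ Hy] := He _ by_; exact/Hy.
apply/negligibleP => //.
have u_neq0 : u != 0.
  have [up _] := He p (ballxx _ e0).
  by apply: contraTneq up => ->; rewrite derive0 ltxx.
have nu0 : 0 < `|u| by rewrite normr_gt0.
(* Strictly decreasing lengths, at most [e / 2] once multiplied by [|u|], so the translates do not
   leave the ball of the chart. *)
pose t (k : nat) : R := (e / 2) / `|u| / k.+1%:R.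
have t0 k : 0 < t k by rewrite !divr_gt0.
have tu k : t k * `|u| <= e / 2.
  rewrite /t mulrAC divfK ?gt_eqF// ler_pdivrMr// ler_peMr ?(ltW e20)//.
  by rewrite ler1n.
have tdec j k : (j < k)%N -> t k < t j.
  move=> jk; rewrite /t ltr_pM2l ?divr_gt0// ltf_pV2 ?posrE//.
  by rewrite ltr_nat.
have ballZ z k : Z z -> forall s, 0 <= s -> s <= t k -> ball p e (z + s *: u).
  move=> [_ bz] s s0 st; rewrite -ball_normE /ball_/= opprD addrA.
  have pz : `|p - z| < e / 2 by move: bz; rewrite -ball_normE.
  apply: le_lt_trans (ler_normB _ _) _.
  rewrite normrZ ger0_norm// [e]splitr; apply: ltr_leD => //.
  by apply: le_trans (tu k); rewrite ler_wpM2r.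
have mono z k : Z z -> forall s, 0 < s -> s <= t k -> 0 < rho (z + s *: u).
  move=> Zz s s0 st.
  have sf := smooth_line z u srho.
  have := @gtr0_derive1_incr R (fun s => rho (z + s *: u)) 0 s _ _ _ 0 s.
  rewrite scale0r addr0 (Z0 _ Zz); apply => //.
  - by move=> x _; exact: smooth_derivable.
  - move=> x; rewrite in_itv/= => /andP[x0 xs].
    rewrite derive1E (derive_line z u x srho).
    have [] := He (z + x *: u) => //.
    by apply: ballZ Zz _ (ltW x0) _; exact: le_trans (ltW xs) st.
  - by apply: continuous_subspaceT; exact: smooth_continuous.
apply: (@null_of_disjoint_translates Z (ball p e) (fun k => t k *: u)) => //.
- by apply: open_measurable_rV; exact: ball_open.
- apply: (@lebesgue_rV_bounded _ _ _ (`|p| + e)).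
    by apply: open_measurable_rV; exact: ball_open.
  move=> x; rewrite -ball_normE /= => px.
  have -> : x = p - (p - x) by rewrite subKr.
  by apply: le_lt_trans (ler_normB _ _) _; rewrite ltrD2l.
- by move=> k z Zz; apply: ballZ Zz _ (ltW (t0 k)) (lexx _).
move=> j k z z' Zz Zz' E.
have disj j1 k1 z1 z2 : Z z1 -> Z z2 -> (j1 < k1)%N ->
    z1 + t j1 *: u = z2 + t k1 *: u -> False.
  move=> Zz1 Zz2 jk E1.
  have := mono z1 j1 Zz1 (t j1 - t k1); rewrite subr_gt0 tdec// lerBlDr lerDl ltW//.
  move=> /(_ isT isT); rewrite scalerBl addrA E1 addrK (Z0 _ Zz2) ltxx.
  by [].
have [jk|kj|//] := ltngtP j k.
- by have := disj _ _ _ _ Zz Zz' jk E.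
- by have := disj _ _ _ _ Zz' Zz kj (esym E).
Qed.

(** From a boundary point, a small step against the direction in which the defining function
    increases makes it negative, hence ends in the interior. Bounds on the interior thereby extend
    to M by continuity. *)
Lemma flat_closure_interior : M `<=` closure M°.
Proof.
move=> p Mp; have [ip|ip] := pselect (M° p); first exact: subset_closure.
have [rho [u [e [srho e0 He]]]] := boundary_chart Mp ip.
have rp : rho p <= 0 by have [_ Hp] := He p (ballxx _ e0); exact/Hp.
move=> B Bp.
have cvp : (p + (- s) *: u) @[s --> (0 : R)] --> p.
  under eq_fun do rewrite scaleNr -scalerN.
  by have := @line_continuous R V p (- u) 0; rewrite /continuous_at scale0r addr0.
have /nbhs_ballP[del /= del0 Hdel] : nbhs (0 : R)
    [set s | B (p + (- s) *: u) /\ ball p e (p + (- s) *: u)].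
  have : nbhs p (B `&` ball p e) by apply: filterI => //; exact: nbhsx_ballx.
  by move=> /cvp.
have ballP s : 0 <= s <= del / 2 ->
    B (p + (- s) *: u) /\ ball p e (p + (- s) *: u).
  move=> /andP[s0 s1]; apply: Hdel; rewrite -ball_normE /= sub0r normrN ger0_norm//.
  by lra.
have d20 : 0 < del / 2 by rewrite divr_gt0.
exists (p + (- (del / 2)) *: u); split; last first.
  by have [] := ballP (del / 2); rewrite ?lexx ?ltW.
have [_ b2] : B (p + (- (del / 2)) *: u) /\ ball p e (p + (- (del / 2)) *: u).
  by apply: ballP; rewrite lexx ltW.
apply: (chart_interior srho _ b2).
  by move=> y by_ ry; have [_ Hy] := He _ by_; exact/Hy.
have sf := smooth_line p u srho.
apply: lt_le_trans rp.
have := @gtr0_derive1_incr R (fun s => rho (p + s *: u)) (- (del / 2)) 0 _ _ _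
  (- (del / 2)) 0; rewrite scale0r addr0; apply => //.
- by move=> x _; exact: smooth_derivable.
- move=> x; rewrite in_itv/= => /andP[x1 x0].
  rewrite derive1E (derive_line p u x srho).
  have [_ bx] := ballP (- x) ltac:(lra); rewrite opprK in bx.
  by have [] := He _ bx.
- by apply: continuous_subspaceT; exact: smooth_continuous.
- by rewrite oppr_lt0.
Qed.

End boundary.

(** * The fundamental lemma of the calculus of variations *)

Section box_generation.
Context {R : realType} {d : nat}.
Local Notation V := 'rV[R]_d.

Definition boxes : set (set V) := [set A | exists a b, A = box a b].

Lemma boxes_setI : setI_closed boxes.
Proof.
move=> _ _ [a [b ->]] [a' [b' ->]].
exists (\row_i Num.max (a ord0 i) (a' ord0 i)),
  (\row_i Num.min (b ord0 i) (b' ord0 i)).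
apply/seteqP; split => [x [xab xab'] i|x xab].
  rewrite !mxE gt_max lt_min.
  by have /andP[-> ->] := xab i; have /andP[-> ->] := xab' i.
by split=> i; have := xab i; rewrite !mxE gt_max lt_min;
  move=> /andP[/andP[? ?] /andP[? ?]]; apply/andP.
Qed.

(** The preimage of an open interval under one coordinate is the union over n of boxes whose other
    sides are []- n, n[]. *)
Lemma measurable_boxes : @measurable _ V = <<s boxes >>.
Proof.
apply/seteqP; split; last first.
  apply: smallest_sub; first exact: sigma_algebra_measurable.
  by move=> _ [a [b ->]]; exact: measurable_box.
pose GT := g_sigma_algebraType boxes.
have coorP (i : 'I_d) : forall Y : set (measurableTypeR R), measurable Y ->
    @measurable _ GT ((fun x : V => x ord0 i) @^-1` Y).
  have -> : @measurable _ (measurableTypeR R) = <<s @RGenOpens.G R >>.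
    exact: RGenOpens.measurableE.
  apply: (@smallest_sub _ _ _ [set Y | @measurable _ GT ((fun x : V => x ord0 i) @^-1` Y)]).
    split => /=.
    - by rewrite preimage_set0; exact: measurable0.
    - by move=> A mA; rewrite setTD preimage_setC; exact: measurableC.
    - by move=> F mF; rewrite preimage_bigcup; exact: bigcupT_measurable.
  move=> _ [x [y ->]] /=.
  rewrite (_ : _ @^-1` _ = \bigcup_n
    box (\row_j if j == i then x else - n%:R) (\row_j if j == i then y else n%:R)).
    by apply: bigcupT_measurable => n; apply: sub_sigma_algebra; do 2!eexists.
  apply/seteqP; split => [z /=|z [n _]]; last first.
    by move=> /(_ i); rewrite !mxE eqxx /= in_itv.
  rewrite in_itv/= => xzy; exists (Num.truncn `|z|).+1 => // j; rewrite !mxE.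
  case: eqP => [->//|_]; rewrite -ltr_norml.
  by apply: le_lt_trans (rV_coord_le z j) _; exact: truncnS_gt.
apply: (@smallest_sub _ _ _ (@measurable _ GT)).
  exact: (@sigma_algebra_measurable _ GT).
rewrite -bigcup_seq/=; apply: bigcup_sub => i _ _ [B mB <-] /=.
by rewrite setTI; exact: coorP.
Qed.

End box_generation.

(** * Periodized bump functions *)

Section periodization.
Context {R : realType} {d : nat}.
Local Notation V := 'rV[R]_d.
Variables (G M D : set V).
Hypotheses (hM : flat_manifold G M) (hD : fundamental_domain G D).

Let hG := flat_lattice hM.

Definition saturate (Y : set V) : set V := [set x | exists2 u, G u & Y (x - u)].

Lemma measurable_saturate Y : measurable Y -> measurable (saturate Y).
Proof.
move=> mY; have [l [lG lsurj _]] := lattice_enum hG.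
rewrite (_ : saturate Y = \bigcup_k
    (if l k is Some u then (fun x => x - u) @^-1` Y else set0)).
  apply: bigcupT_measurable => k; case: (l k) => [u|]; last exact: measurable0.
  exact: measurable_preimage_shift.
apply/seteqP; split => [x [u Gu Yu]|x [k _]].
  by have [k lk] := lsurj _ Gu; exists k => //; rewrite lk.
by case lk : (l k) => [u|//] Yu; exists u => //; exact: lG lk.
Qed.

Definition separation (r : R) := 0 < r /\ forall u, G u -> `|u| < r -> u = 0.

(** The closed box lies in the interior, so the support of a bump does too; its diameter is small
    against the separation of G, so near any point at most one lattice translate of it is met. *)
Definition good_box (r : R) (a b : V) := cbox a b `<=` M° /\
  forall x y, cbox a b x -> cbox a b y -> `|x - y| < r / 4.

Section good_box.
Variables (r : R) (a b : V).
Hypotheses (hr : separation r) (hab : good_box r a b).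

(** The vector [u - w] is shorter than [r / 4 * 3 + r / 4 = r], hence 0. *)
Lemma good_box_unique x y u w : `|x - y| < r / 4 * 3 -> G u -> G w ->
  cbox a b (x - u) -> cbox a b (y - w) -> u = w.
Proof.
move=> xy Gu Gw xu yw; have [r0 Hr] := hr; have [_ Hab] := hab.
apply/eqP; rewrite -subr_eq0; apply/eqP/Hr; first exact: (latticeB hG).
have -> : u - w = (x - y) - ((x - u) - (y - w)).
  by apply/rowP => i; rewrite !mxE; ring.
apply: le_lt_trans (ler_normB _ _) _.
by have := Hab _ _ xu yw; lra.
Qed.

Definition box_bump m (x : V) : R :=
  \prod_(i < d) itv_bump (a ord0 i) (b ord0 i) m (x ord0 i).

Lemma smooth_box_bump m : smooth (box_bump m).
Proof.
apply: smooth_prod => i.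
have lin : linear (fun x : V => x ord0 i) by move=> c x y; rewrite !mxE.
pose l : {linear V -> R} := HB.pack (fun x : V => x ord0 i)
  (GRing.isLinear.Build _ _ _ _ _ lin).
apply: (smooth_comp_linear (l := l)); last exact: smooth_itv_bump.
exact: coord_continuous.
Qed.

Lemma box_bump_neq0 m x : box_bump m x != 0 <-> box a b x.
Proof.
split => [/prodf_neq0 H i|H].
  by rewrite -(itv_bump_neq0 _ _ m); exact: H.
by apply/prodf_neq0 => i _; rewrite itv_bump_neq0; exact: H.
Qed.

Lemma box_bump_itv m x : 0 <= box_bump m x <= 1.
Proof.
apply/andP; split.
  by apply: prodr_ge0 => i _; have /andP[] := itv_bump_itv (a ord0 i) (b ord0 i) m (x ord0 i).
by apply: prodr_ile1 => i _; exact: itv_bump_itv.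
Qed.

Lemma box_bump_cvg x : box a b x -> box_bump m x @[m --> \oo] --> (1 : R).
Proof.
move=> xab; rewrite -[X in _ --> X](big1_eq (R := R) (op := *%R) (index_enum 'I_d) xpredT).
by apply: cvg_big => [|i _]; [exact: mul_continuous|exact/itv_bump_cvg/xab].
Qed.

(** The sum of all lattice translates of [box_bump m], reduced to its only term that can be nonzero;
    in a good box the chosen translate is the only candidate. *)
Definition periodized m (x : V) : R :=
  if pselect (exists u, G u /\ box a b (x - u)) is left H
  then box_bump m (x - projT1 (cid H)) else 0.

Lemma periodizedE m x u : G u -> box a b (x - u) -> periodized m x = box_bump m (x - u).
Proof.
move=> Gu xu; rewrite /periodized; case: pselect => [H|[]]; last by exists u.
have [Gw xw] := projT2 (cid H).
congr (box_bump m (x - _)); apply: good_box_unique Gw Gu _ _; last 2 first.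
- exact: box_cbox xw.
- exact: box_cbox xu.
by rewrite subrr normr0 mulr_gt0// divr_gt0//; have [] := hr.
Qed.

Lemma periodized0 m x : ~ saturate (box a b) x -> periodized m x = 0.
Proof.
move=> nx; rewrite /periodized; case: pselect => // H; exfalso; apply: nx.
by have [u [Gu xu]] := H; exists u.
Qed.

Lemma periodized_neq0 m x : periodized m x != 0 -> saturate (box a b) x.
Proof. by move=> nz; apply: contrapT => /(periodized0 m)/eqP; exact/negP. Qed.

Let r4_gt0 : 0 < r / 4. Proof. by have [r0 _] := hr; rewrite divr_gt0. Qed.

(** Two points within [r / 4] of x are less than [r / 2] apart, so if both meet a translate of the
    box it is the same translate. *)
Lemma periodized_local m x : (exists2 u, G u &
    forall y, `|x - y| < r / 4 -> periodized m y = box_bump m (y - u)) \/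
  (forall y, `|x - y| < r / 4 -> periodized m y = 0).
Proof.
have [[y [u [xy Gu yu]]]|H] := pselect
    (exists y u, [/\ `|x - y| < r / 4, G u & box a b (y - u)]); last first.
  right => y xy; apply: periodized0 => -[u Gu yu]; apply: H.
  by exists y, u.
left; exists u => // z xz.
have [[w [Gw zw]]|nz] := pselect (exists w, G w /\ box a b (z - w)).
  rewrite (periodizedE _ Gw zw); congr (box_bump m (z - _)).
  apply: (@good_box_unique z y) => //; try exact: box_cbox.
  have -> : z - y = (x - y) - (x - z) by apply/rowP => i; rewrite !mxE; ring.
  by apply: le_lt_trans (ler_normB _ _) _; have := r4_gt0; lra.
rewrite periodized0; last by move=> [w Gw zw]; apply: nz; exists w.
apply/esym/eqP/negPn/negP => /box_bump_neq0 zu.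
by apply: nz; exists u.
Qed.

Lemma near_r4 (x : V) : \forall y \near x, `|x - y| < r / 4.
Proof.
have : nbhs x (ball x (r / 4)) by exact: nbhsx_ballx.
by apply: filterS => y; rewrite -ball_normE.
Qed.

Lemma cvg_shift (x u : V) : (fun y : V => y - u) @ x --> x - u.
Proof.
have : differentiable (fun y : V => y + - u) x by apply: differentiableD.
by move=> /differentiable_continuous.
Qed.

Lemma interior_lattice x u : G u -> M° x -> M° (x + u).
Proof.
move=> Gu Mx; rewrite /interior/= -[x + u]addr0.
have : \forall y \near x + u, M (y - u).
  have cv : (fun y : V => y - u) @ (x + u) --> x.
    by rewrite -{2}(addrK u x); exact: cvg_shift.
  exact: cv Mx.
rewrite addr0; apply: filterS => y My.
by rewrite -(subrK u y); exact: (flat_invariant hM).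
Qed.

Lemma periodized_test m : test_function G M (periodized m).
Proof.
split.
- apply: smooth_local => x; have [[u Gu H]|H] := periodized_local m x.
    exists (fun y => box_bump m (y + - u)).
      by apply: smooth_shift; exact: smooth_box_bump.
    by apply: filterS (near_r4 x).
  exists (cst 0); first exact: smooth_cst.
  by apply: filterS (near_r4 x).
- move=> u x Gu; have [[w Gw xw]|H] := pselect (saturate (box a b) x).
    have Gwu := latticeD hG Gw Gu.
    rewrite (periodizedE m Gw xw) (@periodizedE m (x + u) (w + u))//.
      by rewrite opprD addrACA subrr addr0.
    by rewrite opprD addrACA subrr addr0.
  rewrite (periodized0 _ H) periodized0// => -[w Gw xw]; apply: H.
  by exists (w - u); [exact: (latticeB hG)|rewrite opprB addrA].
(* Points of the support near x lie in a single translate of the box, so x lies in the corresponding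
   closed box, and this is in the interior of M. *)
- move=> x cx; have [Mab _] := hab.
  have [y [/= /periodized_neq0[u Gu yu] xy]] := cx _ (near_r4 x).
  suff xu : cbox a b (x - u) by rewrite -(subrK u x); apply: interior_lattice => //; exact: Mab.
  apply: (@cbox_closed R d a b) => B Bx.
  have N1 : \forall z \near x, B (z - u).
    have cv : (fun z : V => z - u) @ x --> x - u.
      exact: cvg_shift.
    exact: cv Bx.
  have [z [/= /periodized_neq0[w Gw zw] [Bz xz]]] := cx _ (filterI N1 (near_r4 x)).
  exists (z - u); split => //; apply: box_cbox.
  suff <- : w = u by [].
  apply: (@good_box_unique z y) => //; try exact: box_cbox.
  have -> : z - y = (x - y) - (x - z) by apply/rowP => i; rewrite !mxE; ring.
  by apply: le_lt_trans (ler_normB _ _) _; have := r4_gt0; lra.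
Qed.

Lemma periodized_itv m x : 0 <= periodized m x <= 1.
Proof.
by rewrite /periodized; case: pselect => *; rewrite ?box_bump_itv ?lexx ?ler01.
Qed.

Lemma periodized_cvg x :
  periodized m x @[m --> \oo] --> (\1_(saturate (box a b)) x : R).
Proof.
have [[u Gu xu]|H] := pselect (saturate (box a b) x).
  rewrite indicE mem_set; last by exists u.
  under eq_fun do rewrite (periodizedE _ Gu xu).
  exact: box_bump_cvg.
rewrite indicE memNset//; under eq_fun do rewrite (periodized0 _ H).
exact: cvg_cst.
Qed.

End good_box.
End periodization.

Section fundamental_lemma.
Context {R : realType} {d : nat}.
Local Notation V := 'rV[R]_d.
Local Notation mu := (lebesgue_rV d).
Variables (G M D : set V).
Hypotheses (hM : flat_manifold G M) (hD : fundamental_domain G D).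

Let hG := flat_lattice hM.
Let mMD := flat_domain_measurable hM hD.
Let MDoo := flat_measure_lt_pinfty hM hD.

Lemma cst_L2 (c : R) : L2_M M D (cst c).
Proof. by apply: (L2_on_bounded mMD MDoo (C := `|c|)) => //. Qed.

Lemma L2_M_integrable g : L2_M M D g -> mu.-integrable (M `&` D) (EFin \o g).
Proof.
move=> Lg; have := ip_on_integrable mMD Lg (cst_L2 1).
by under eq_fun do rewrite mulr1.
Qed.

Variable g : V -> R.
Hypotheses (Lg : L2_M M D g)
  (orth : forall psi, test_function G M psi -> ip_M M D g psi = 0).

Let ig := L2_M_integrable Lg.
Let mg : measurable_fun (M `&` D) g := L2_on_measurable mMD Lg.

Variable r : R.
Hypothesis hr : separation G r.

(** Periodized bumps are test functions that tend to the indicator function of the saturated box;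
    [|g|] dominates. *)
Lemma integral_saturate_box a b : good_box M r a b ->
  (\int[mu]_(x in (M `&` D) `&` saturate G (box a b)) (g x)%:E = 0)%E.
Proof.
move=> hab; have mS := measurable_saturate hM (measurable_box a b).
pose S := saturate G (box a b).
have := @dominated_convergence _ _ _ mu _ mMD
  (fun n x => (g x * periodized G a b n x)%:E) (fun x => (g x * \1_S x)%:E)
  (fun x => `|(g x)%:E|%E).
case=> //.
- move=> n; apply/measurable_EFinP/measurable_funM => //.
  by apply: measurable_funTS; exact: test_measurable (periodized_test hM hr hab n).
- by apply/measurable_EFinP/measurable_funM => //; exact: measurable_indic.
- apply: nearW => x _; apply: cvg_EFin; first exact: nearW.
  by apply: cvgM; [exact: cvg_cst|exact: (periodized_cvg hM hr hab)].
- exact: integrable_abse.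
- apply: nearW => x n _; rewrite /= lee_fin normrM.
  have /andP[p0 p1] := periodized_itv G a b n x.
  by rewrite (ger0_norm p0) ler_piMr.
move=> _ _ cv.
rewrite integral_mkcondr.
have -> : (\int[mu]_(x in M `&` D) ((EFin \o g) \_ S) x =
    \int[mu]_(x in M `&` D) (g x * \1_S x)%:E)%E.
  apply: eq_integral => x _; rewrite patchE indicE.
  by case: ifP => _; rewrite ?mulr1 ?mulr0.
have E0 n : (\int[mu]_(x in M `&` D) (g x * periodized G a b n x)%:E = 0)%E.
  have Lp := test_L2 hM hD (periodized_test hM hr hab n).
  rewrite -[LHS]fineK; last exact: integrable_fin_num (ip_on_integrable mMD Lg Lp).
  by congr EFin; apply: orth; exact: (periodized_test hM hr hab n).
move: cv => /=; under eq_fun do rewrite E0.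
by move=> /cvg_lim <- //; rewrite lim_cst.
Qed.

Variables a0 b0 : V.
Hypothesis hab0 : good_box M r a0 b0.

Let T (Y : set V) := saturate G (Y `&` box a0 b0).

Let mT Y : measurable Y -> measurable (T Y).
Proof.
move=> mY; apply: (measurable_saturate hM).
by apply: measurableI => //; exact: measurable_box.
Qed.

Let T_unique x u w : G u -> G w -> box a0 b0 (x - u) -> box a0 b0 (x - w) -> u = w.
Proof.
move=> Gu Gw xu xw.
apply: (good_box_unique hM hr hab0 (x := x) (y := x)) => //; try exact: box_cbox.
by rewrite subrr normr0; have [r0 _] := hr; rewrite !mulr_gt0 ?invr_gt0.
Qed.

Lemma good_box_setI a b : exists a' b', good_box M r a' b' /\
  box a b `&` box a0 b0 = box a' b'.
Proof.
pose a' : V := \row_i Num.max (a ord0 i) (a0 ord0 i).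
pose b' : V := \row_i Num.min (b ord0 i) (b0 ord0 i).
have sub : cbox a' b' `<=` cbox a0 b0.
  move=> x xab i; have := xab i; rewrite !mxE ge_max le_min.
  by move=> /andP[/andP[_ ->] /andP[_ ->]].
exists a', b'; split.
  split; first by apply: subset_trans sub _; exact: hab0.1.
  by move=> x y /sub xab /sub yab; exact: hab0.2.
apply/seteqP; split => [x [xab xab'] i|x xab].
  rewrite !mxE gt_max lt_min.
  by have /andP[-> ->] := xab i; have /andP[-> ->] := xab' i.
by split=> i; have := xab i; rewrite !mxE gt_max lt_min;
  move=> /andP[/andP[? ?] /andP[? ?]]; apply/andP.
Qed.

Let iT Y : measurable Y -> mu.-integrable ((M `&` D) `&` T Y) (EFin \o g).
Proof.
move=> mY; apply: integrableS ig => //.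
by apply: measurableI => //; exact: mT.
Qed.

(** Dynkin induction from boxes. Points over the fixed box [box a0 b0] have a unique lattice
    representative there, so [T] turns complements and disjoint unions into relative complements and
    disjoint unions. *)
Lemma integral_saturate Y : measurable Y ->
  (\int[mu]_(x in (M `&` D) `&` T Y) (g x)%:E = 0)%E.
Proof.
rewrite measurable_boxes.
apply: (@dynkin_induction _ V boxes
  (fun Y => (\int[mu]_(x in (M `&` D) `&` T Y) (g x)%:E = 0)%E)).
- exact: measurable_boxes.
- exact: boxes_setI.
- by rewrite /T setTI; exact: integral_saturate_box.
- move=> _ [a [b ->]]; have [a' [b' [gab E]]] := good_box_setI a b.
  by rewrite /T E; exact: integral_saturate_box.
- move=> S mS HS.
  have disj : [disjoint (M `&` D) `&` T S & (M `&` D) `&` T (~` S)].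
    apply/disj_setPS => x [[_ [u Gu [Su xu]]] [_ [w Gw [Sw xw]]]].
    by apply: Sw; rewrite -(T_unique Gu Gw xu xw).
  have E : (M `&` D) `&` T setT =
      ((M `&` D) `&` T S) `|` ((M `&` D) `&` T (~` S)).
    rewrite -setIUr; congr (_ `&` _); apply/seteqP; split => x.
      move=> [u Gu [_ xu]]; have [Sx|Sx] := pselect (S (x - u)).
        by left; exists u.
      by right; exists u.
    by move=> [[u Gu [_ xu]]|[u Gu [_ xu]]]; exists u.
  have := integral_saturate_box hab0; rewrite -[box a0 b0]setTI -/(T setT) E.
  rewrite integral_setU//.
  + by rewrite HS add0e.
  + by apply: measurableI => //; exact: mT.
  + by apply: measurableI => //; apply: mT; exact: measurableC.
  + by rewrite -E; apply/measurable_EFinP; apply: measurable_funS mg.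
- move=> F mF tF HF.
  have E : (M `&` D) `&` T (\bigcup_k F k) = \bigcup_k ((M `&` D) `&` T (F k)).
    rewrite -setI_bigcupr; congr (_ `&` _); apply/seteqP; split => x.
      by move=> [u Gu [[k _ Fk] xu]]; exists k => //; exists u.
    by move=> [k _ [u Gu [Fk xu]]]; exists u => //; split => //; exists k.
  rewrite E integral_bigcup.
  + by apply: eseries0 => k _ _; exact: HF.
  + apply/trivIsetP => j k _ _ jk; rewrite -subset0.
    move=> x [[_ [u Gu [Su xu]]] [_ [w Gw [Sw xw]]]].
    have uw := T_unique Gu Gw xu xw; rewrite -uw in Sw.
    move/trivIsetP : tF => /(_ j k I I jk); rewrite -subset0 => /(_ (x - u)).
    by apply.
  + by move=> k; apply: measurableI => //; exact: mT.
  + by rewrite -E; apply: iT; exact: bigcupT_measurable.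
Qed.

(** Every measurable subset [E] of the saturated box within [M] and [D] is cut out by some [T Y],
    with [Y] the saturation of [E]: two points of [D] that differ by a lattice vector coincide. *)
Lemma ae_saturate : ae_eq mu ((M `&` D) `&` T setT) (EFin \o g) (cst 0%E).
Proof.
have mTT : measurable ((M `&` D) `&` T setT) by apply: measurableI => //; exact: mT.
apply: integral_ae_eq => //; first exact: iT.
move=> E ET mE; rewrite [RHS]integral0_eq//.
pose Y : set V := [set y | exists2 u, G u & E (y + u)].
have YE : Y = saturate G E.
  apply/seteqP; split => y [u Gu Eu]; exists (- u) => //; rewrite ?opprK//;
  exact: (latticeN hG).
have mY : measurable Y by rewrite YE; exact: measurable_saturate hM _ _.
have EY : E = (M `&` D) `&` T Y.
  apply/seteqP; split => [x Ex|x [[Mx Dx] [u Gu [[w Gw Ew] xu]]]].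
    have [MDx [u Gu [_ xu]]] := ET _ Ex; split => //; exists u => //; split => //.
    by exists u => //; rewrite subrK.
  have [[_ Dw] _] := ET _ Ew.
  have [_ HD] := hD; have [z [_ Hz]] := HD x.
  have z0 : z = 0 by apply: Hz; rewrite subr0; split => //; exact: (lattice0 hG).
  have zw : z = u - w.
    apply: Hz; split; first exact: (latticeB hG).
    by rewrite opprB addrA addrAC.
  by move: Ew; rewrite addrAC -addrA -opprB -zw z0 oppr0 addr0.
by rewrite EY; exact: integral_saturate.
Qed.

End fundamental_lemma.

Section fundamental_lemma_flat.
Context {R : realType} {d : nat}.
Local Notation V := 'rV[R]_d.
Local Notation mu := (lebesgue_rV d).
Variables (G M D : set V).
Hypotheses (hM : flat_manifold G M) (hD : fundamental_domain G D).

(** Countably many rational good boxes cover the interior of M, and the boundary is null. *)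
Lemma fundamental_lemma (g : V -> R) : L2_M M D g ->
  (forall psi, test_function G M psi -> ip_M M D g psi = 0) ->
  ip_M M D g g = 0.
Proof.
move=> Lg orth; have mMD := flat_domain_measurable hM hD.
apply: (ae_ip_on mMD Lg).
have [_ _ [r r0 Hr]] := flat_lattice hM.
have hr : separation G r by [].
pose B q := (box (@ratbox R d q).1 (ratbox q).2).
pose F n := if unpickle n is Some q then
  if `[< good_box M r (@ratbox R d q).1 (ratbox q).2 >] then
  ((M `&` D) `&` saturate G (B q)) `&` [set x | g x != 0] else set0 else set0.
have nF : mu.-negligible (\bigcup_k F k).
  apply: negligible_bigcup => k; rewrite /F; case: unpickle => [q|]; last first.
    exact: negligible_set0.
  case: asboolP => gq; last exact: negligible_set0.
  have [N [mN N0 HN]] := ae_saturate hM hD Lg orth hr gq.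
  exists N; split => // x [[MDx Sx] gx]; apply: HN => /= H.
  have : (g x)%:E = 0%E by apply: H; split => //; rewrite setTI.
  by move=> [gx0]; move: gx; rewrite /= gx0 eqxx.
have nb : mu.-negligible (M `\` M°).
  exists (M `\` M°); split => //.
    apply: measurableD; first exact: (flat_measurable hM).
    by apply: open_measurable_rV; exact: open_interior.
  exact: (boundary_null hM).
have := negligibleU nF nb; apply: negligibleS => x /= /not_implyP[MDx gx].
have [ix|ix] := pselect (M° x); last by right; split => //; case: MDx.
left.
have /nbhs_ballP[e /= e0 eM] : nbhs x M° by apply: open_nbhs_nbhs; split => //; exact: open_interior.
(* The bound [e] keeps the box in the interior; [r / 8] around x makes its diameter less than
   [r / 4]. *)
have m0 : 0 < Num.min e (r / 8) by rewrite lt_min e0 divr_gt0.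
have [q [qx Hq]] := ratbox_basis x m0.
have gq : good_box M r (ratbox q).1 (ratbox q).2.
  split => [y /Hq|y z /Hq + /Hq]; rewrite !lt_min.
    by move=> /andP[xy _]; apply: eM; rewrite -ball_normE.
  move=> /andP[_ xy] /andP[_ xz].
  have -> : y - z = (x - z) - (x - y) by apply/rowP => i; rewrite !mxE; ring.
  by apply: le_lt_trans (ler_normB _ _) _; lra.
exists (pickle q) => //; rewrite /F pickleK ifT; last exact/asboolP.
split; last by apply/eqP.
split => //; exists 0; first exact: (lattice0 (flat_lattice hM)).
by rewrite subr0.
Qed.

End fundamental_lemma_flat.

(** * The pullback metrics of the flow *)

Section sum_of_squares.
Context {R : realType} {n : nat}.
Local Notation V := 'rV[R]_n.
Implicit Types (p q w : V) (J : 'M[R]_n).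

Definition dot p q : R := (p *m q^T) ord0 ord0.

Lemma dotE p q : dot p q = \sum_i p ord0 i * q ord0 i.
Proof. by rewrite /dot mxE; under eq_bigr do rewrite mxE. Qed.

Lemma dot_psd : psd_form setT dot.
Proof.
split => //.
- by move=> p q _ _; rewrite !dotE; apply: eq_bigr => i _; rewrite mulrC.
- move=> c p q w _ _ _; rewrite !dotE mulr_sumr -big_split /=.
  by apply: eq_bigr => i _; rewrite !mxE mulrDl mulrA.
- by move=> p _; rewrite dotE sumr_ge0// => i _; rewrite -expr2 sqr_ge0.
Qed.

Lemma dot_cauchy p q : dot p q ^+ 2 <= dot p p * dot q q.
Proof. by apply: (cauchy_schwarz dot_psd). Qed.

Lemma dot_ge0 p : 0 <= dot p p.
Proof. exact: (psd_ge0 dot_psd). Qed.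

Lemma dot_eq0 p : dot p p = 0 -> p = 0.
Proof.
rewrite dotE => /eqP; rewrite psumr_eq0 => [/allP h|i _]; last first.
  by rewrite -expr2 sqr_ge0.
apply/rowP => i; rewrite mxE; apply/eqP.
by have := h i (mem_index_enum _); rewrite -expr2 sqrf_eq0.
Qed.

Lemma dot_tr p q J : dot (p *m J) q = dot p (q *m J^T).
Proof. by rewrite /dot trmx_mul trmxK mulmxA. Qed.

Variables (J : 'M[R]_n) (k : R).
Hypothesis k_ge0 : 0 <= k.
Hypothesis lowJ : forall w, dot w w <= k * dot (w *m J) (w *m J).
Hypothesis upJ : forall w, dot (w *m J) (w *m J) <= k * dot w w.

Lemma bilip_unitmx : J \in unitmx.
Proof.
rewrite -row_free_unit -kermx_eq0; apply/eqP/row_matrixP => i.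
rewrite row0; apply: dot_eq0; apply/le_anti; rewrite dot_ge0 andbT.
apply: le_trans (lowJ _) _; rewrite -row_mul mulmx_ker row0.
by rewrite (psd0l dot_psd)// mulr0.
Qed.

Let sq_cancel (x y : R) : 0 <= x -> 0 <= y -> x ^+ 2 <= k * x * y -> x <= k * y.
Proof.
move=> x0 y0; have [->|xn0] := eqVneq x 0; first by rewrite mulr_ge0.
by rewrite expr2 -mulrA mulrCA ler_pM2l// lt_neqAle eq_sym xn0.
Qed.

(** Cauchy-Schwarz applied to [dot x (x *m J^T *m J)] leaves the norm of [x *m J^T] on both sides,
    where one power cancels; the lower bound for the transpose is obtained likewise. *)
Lemma bilip_tr_le x : dot (x *m J^T) (x *m J^T) <= k * dot x x.
Proof.
apply: sq_cancel; rewrite ?dot_ge0//.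

have {1}-> : dot (x *m J^T) (x *m J^T) = dot x (x *m J^T *m J).
  by rewrite dot_tr trmxK.
apply: le_trans (dot_cauchy _ _) _.
by rewrite mulrC ler_wpM2r ?dot_ge0.
Qed.

Lemma bilip_tr_ge x : dot x x <= k * dot (x *m J^T) (x *m J^T).
Proof.
apply: sq_cancel; rewrite ?dot_ge0//.
have xE : x *m invmx J *m J = x by rewrite mulmxKV// bilip_unitmx.
have {1}-> : dot x x = dot (x *m invmx J) (x *m J^T).
  by rewrite -dot_tr xE.
apply: le_trans (dot_cauchy _ _) _.
rewrite ler_wpM2r ?dot_ge0//.
by have := lowJ (x *m invmx J); rewrite xE.
Qed.

Let unitJT : J^T \in unitmx.
Proof. by rewrite unitmx_tr bilip_unitmx. Qed.

Lemma metric_unitmx : J *m J^T \in unitmx.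
Proof. by rewrite unitmx_mul bilip_unitmx. Qed.

(** As a Gram form the inverse metric is visibly symmetric and positive, and its bounds become those
    of the transposed matrix. *)
Lemma inv_metric_dot p q : (p *m invmx (J *m J^T) *m q^T) ord0 ord0 =
  dot (p *m invmx J^T) (q *m invmx J^T).
Proof.
have -> : invmx (J *m J^T) = invmx J^T *m invmx J.
  apply: (can_inj (mulKmx metric_unitmx)).
  by rewrite mulmxV ?metric_unitmx// mulmxA -(mulmxA J) mulmxV// mulmx1 mulmxV// bilip_unitmx.
by rewrite /dot trmx_mul trmx_inv trmxK !mulmxA.
Qed.

Lemma inv_metric_ge p : dot p p <= k * (p *m invmx (J *m J^T) *m p^T) ord0 ord0.
Proof.
rewrite inv_metric_dot -{1 2}[p](mulmxKV unitJT).
exact: bilip_tr_le.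
Qed.

Lemma inv_metric_le p : (p *m invmx (J *m J^T) *m p^T) ord0 ord0 <= k * dot p p.
Proof.
rewrite inv_metric_dot -{3 4}[p](mulmxKV unitJT).
exact: bilip_tr_ge.
Qed.

Lemma entry_form (A : 'M[R]_n) i j :
  A i j = ((delta_mx ord0 i : V) *m A *m (delta_mx ord0 j : V)^T) ord0 ord0.
Proof.
rewrite -rowE mxE (bigD1 j)//= big1 => [|l lj].
  by rewrite !mxE !eqxx mulr1 addr0.
by rewrite !mxE (negbTE lj) andbF mulr0.
Qed.

Lemma dot_delta i : dot (delta_mx ord0 i : V) (delta_mx ord0 i : V) = 1.
Proof.
rewrite dotE (bigD1 i)//= big1 => [|l li].
  by rewrite !mxE !eqxx mulr1 addr0.
by rewrite !mxE (negbTE li) andbF mulr0.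
Qed.

(** Positivity at [q + p] and [q - p] bounds the mixed term by half the sum of the two diagonal
    ones. *)
Lemma inv_metric_entry i j : `|invmx (J *m J^T) i j| <= k.
Proof.
rewrite entry_form inv_metric_dot.
have := inv_metric_le (delta_mx ord0 i : V); rewrite inv_metric_dot dot_delta.
have := inv_metric_le (delta_mx ord0 j : V); rewrite inv_metric_dot dot_delta.
move: (_ *m _) (_ *m _) => p q qk pk.
have := dot_ge0 (q + p); have := dot_ge0 (q - p).
rewrite (@psd_sqD _ _ _ _ dot_psd q p)// (@psd_sqB _ _ _ _ dot_psd q p)//.
rewrite (psdC dot_psd (f := q) (g := p))// ler_norml.
by move=> h1 h2; apply/andP; split; lra.
Qed.

Lemma inv_metricC i j : invmx (J *m J^T) i j = invmx (J *m J^T) j i.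
Proof. by rewrite !entry_form !inv_metric_dot; apply: (psdC dot_psd). Qed.

End sum_of_squares.

(** * Gronwall estimates and the flow *)

Section gronwall.
Context {R : realType}.

(** The integrating factor [expR (- c * s)] makes the product nonincreasing. Both signs of [c] occur
    below: lower bounds come from applying this to [- h]. *)
Lemma gronwall (h dh : R -> R) (c b : R) :
  (forall t, 0 <= t <= b -> is_derive t 1 h (dh t)) ->
  (forall t, 0 <= t <= b -> dh t <= c * h t) ->
  forall t, 0 <= t <= b -> h t <= expR (c * t) * h 0.
Proof.
move=> hd hle t /andP[t0 tb].
pose g s := expR (- c * s) * h s.
have gd s : 0 <= s <= b ->
    is_derive s 1 g (expR (- c * s) * (dh s - c * h s)).
  move=> sb; have [hds hdE] := hd s sb.
  have [ld lE] : is_derive s 1 (fun s => expR (- c * s)) (expR (- c * s) * (- c)).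
    apply: (@is_derive1_comp _ expR (fun s => - c * s)).
    rewrite -[X in is_derive _ _ _ X](mulr1 (- c)).
    exact: (@is_deriveZ _ _ _ id (- c) s 1 1).
  split; first exact: derivableM.
  rewrite (deriveM ld hds) lE hdE /= -![_ *: _]/(_ * _).
  ring.
have : g t <= g 0.
  apply: (@ler0_derive1_nincr _ g 0 b) => //.
  - move=> s; rewrite in_itv/= => /andP[s0 sb].
    by have [] := gd s; rewrite ?(ltW s0) ?(ltW sb).
  - move=> s; rewrite in_itv/= => /andP[s0 sb].
    have sb' : 0 <= s <= b by rewrite !ltW.
    have [_ gE] := gd s sb'.
    by rewrite derive1E gE pmulr_rle0 ?expR_gt0// subr_le0 hle.
  - apply: derivable_within_continuous => s; rewrite in_itv/= => sb.
    by have [] := gd s sb.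
rewrite /g mulr0 expR0 mul1r mulNr expRN.
by rewrite ler_pdivrMl ?expR_gt0.
Qed.

End gronwall.

Section smooth_coord.
Context {R : realType} {W : normedModType R} {n : nat}.
Local Notation V := 'rV[R]_n.

Lemma derive_coord (f : W -> V) i u p : derivable f p u ->
  'D_u (fun p => f p ord0 i) p = 'D_u f p ord0 i.
Proof. by move=> df; rewrite derive_mx// mxE. Qed.

Lemma smooth_coord (f : W -> V) i : smooth f -> smooth (fun p => f p ord0 i).
Proof.
move=> sf; apply: (smooth_coind (P := [set h | exists2 f : W -> V, smooth f &
    h = fun p => f p ord0 i])); last by exists f.
move=> _ [{sf}f sf ->]; split => [x|u].
  apply: (@differentiable_comp _ _ _ _ f (fun x : V => x ord0 i)).
    exact: smooth_differentiable.
  exact: differentiable_coord.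
exists ('D_u f); first exact: smooth_derive.
by apply/funext => p; rewrite derive_coord//; exact: smooth_derivable.
Qed.

End smooth_coord.

Section time_space.
Context {R : realType} {d : nat}.
Local Notation V := 'rV[R]_d.
Implicit Types (f : R * V -> R).

Lemma rect_bounded f (b rho : R) : continuous f ->
  exists2 C, 0 <= C & forall t x, 0 <= t <= b -> `|x| <= rho -> `|f (t, x)| <= C.
Proof.
move=> cf.
have cK : compact (`[0, b] `*` (cbox (const_mx (- rho)) (const_mx rho) : set V)).
  apply: compact_setX; first exact: segment_compact.
  apply: bounded_closed_compact; last exact: cbox_closed.
  exists `|rho|; split; first exact: num_real.
  move=> m rm x hx; apply/ltW/rV_norm_lt => [|i].
    exact: le_lt_trans rm.
  have := hx i; rewrite !mxE -ler_norml => /le_lt_trans; apply.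
  exact: le_lt_trans (ler_norm _) rm.
have := compact_bounded (continuous_compact (continuous_subspaceT cf) cK).
move=> /pinfty_ex_gt0[C C0 hC]; exists C; first exact: ltW.
move=> t x tb xr; apply: hC; exists (t, x) => //; split => //=.
by move=> i; rewrite !mxE -ler_norml (le_trans (rV_coord_le x i)).
Qed.

Lemma dir_decomp (w : V) :
  ((0 : R), w) = \sum_i w ord0 i *: ((0 : R), delta_mx ord0 i : V).
Proof.
apply: injective_projections.
  by rewrite (raddf_sum fst) big1//= => i _; rewrite scaler0.
by rewrite (raddf_sum snd) /= {1}(row_sum_delta w).
Qed.

Lemma derive_space f (p : R * V) (w : V) : smooth f ->
  'D_(0, w) f p = \sum_i w ord0 i * 'D_(0, delta_mx ord0 i) f p.
Proof.
move=> sf; have df := smooth_differentiable p sf.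
rewrite dir_decomp deriveE// linear_sum; apply: eq_bigr => i _.
by rewrite linearZ /= deriveE.
Qed.

Lemma derive_slice (W : normedModType R) (f : R * V -> W) t x (w : V) :
  'D_w (fun x => f (t, x)) x = 'D_(0, w) f (t, x).
Proof.
rewrite /derive; congr (lim _).
suff -> : (fun h : R => h^-1 *: (f (t, h *: w + x) - f (t, x))) =
  (fun h : R => h^-1 *: (f (h *: ((0 : R), w) + (t, x)) - f (t, x))) by [].
apply/funext => h; congr (_ *: (f _ - _)).
by apply: injective_projections; rewrite /= ?scaler0 ?add0r.
Qed.

Lemma smooth_slice (W : normedModType R) (f : R * V -> W) t : smooth f ->
  smooth (fun x => f (t, x)).
Proof.
move=> sf; apply: (smooth_coind (P := [set h | exists2 f : R * V -> W, smooth f &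
    h = fun x => f (t, x)])); last by exists f.
move=> _ [{sf}f sf ->]; split => [x|u].
  apply: (@differentiable_comp _ _ _ _ (fun x => (t, x)) f).
    exact: differentiable_pair.
  exact: smooth_differentiable.
exists ('D_(0, u) f); first exact: smooth_derive.
by apply/funext => x; exact: derive_slice.
Qed.

End time_space.

Section flow.
Context {R : realType} {d : nat}.
Local Notation V := 'rV[R]_d.
Variables (tau : R) (G M : set V) (hM : flat_manifold G M).
Variables (v phi : R -> V -> V).
Hypotheses (hv : velocity_field tau G v) (hphi : flow_map tau M v phi).
Let hG := flat_lattice hM.

(** Mean value theorem along the segment from y to x, which stays in the ball of radius [rho]; there
    the space derivatives are bounded uniformly in time by compactness. *)
Lemma velocity_lipschitz rho : exists2 L, 0 <= L & forall t x y i,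
  0 <= t <= tau -> `|x| <= rho -> `|y| <= rho ->
  `|v t x ord0 i - v t y ord0 i| <= L * \sum_j `|x ord0 j - y ord0 j|.
Proof.
pose f i (p : R * V) := v p.1 p.2 ord0 i.
have sf i : smooth (f i) by apply: smooth_coord; case: hv.
have /choice[C hC] (ij : 'I_d * 'I_d) : exists C, 0 <= C /\ forall t x,
    0 <= t <= tau -> `|x| <= rho ->
    `|'D_(0, delta_mx ord0 ij.2) (f ij.1) (t, x)| <= C.
  have [C C0 hC] := @rect_bounded _ _ ('D_(0, delta_mx ord0 ij.2) (f ij.1)) tau rho
    (smooth_continuous (smooth_derive _ (sf _))).
  by exists C.
exists (\sum_ij C ij); first by rewrite sumr_ge0// => ij _; have [] := hC ij.
move=> t x y i tt xr yr.
pose g s := f i ((t, y) + s *: ((0 : R), x - y)).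
have sg : smooth g by exact: smooth_line.
have := @MVT _ g (fun s => 'D_1 g s) 0 1 ltr01.
case => [s _||s]; first by split => //; exact: smooth_derivable.
  exact/continuous_subspaceT/smooth_continuous.
rewrite in_itv/= => /andP[s0 s1].
have -> : g 1 = v t x ord0 i.
  by rewrite /g/f/= scaler0 addr0 scale1r addrCA subrr addr0.
have -> : g 0 = v t y ord0 i.
  by rewrite /g/f/= !scale0r !addr0.
rewrite subr0 mulr1 => ->; rewrite derive_line// derive_space//.
have nz : `|y + s *: (x - y)| <= rho.
  have -> : y + s *: (x - y) = (1 - s) *: y + s *: x.
    by apply/rowP => j; rewrite !mxE; ring.
  apply: le_trans (ler_normD _ _) _; rewrite !normrZ.
  rewrite ger0_norm; last by rewrite subr_ge0 ltW.
  rewrite gtr0_norm//.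
  have -> : rho = (1 - s) * rho + s * rho by ring.
  by apply: lerD; apply: ler_wpM2l; rewrite // ?subr_ge0 ltW.
have -> : (t, y) + s *: ((0 : R), x - y) = (t, y + s *: (x - y)).
  by apply: injective_projections; rewrite /= ?scaler0 ?addr0.
apply: le_trans (ler_norm_sum _ _ _) _.
rewrite mulr_sumr ler_sum// => j _; rewrite !mxE normrM mulrC ler_wpM2r//.
have [_ /(_ _ _ tt nz) /= h] := hC (i, j).
apply: le_trans h _; rewrite (bigD1 (i, j))//= lerDl sumr_ge0// => ij _.
by have [] := hC ij.
Qed.

Definition solution (y : R -> V) := forall t, 0 <= t <= tau ->
  is_derive t 1 y (v t (y t)).

(** The squared distance h of two solutions satisfies [|h'| <= C * h]. Gronwall for h gives
    uniqueness, and for [- h] it keeps trajectories apart, which is where the lower bound on the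
    Jacobian comes from. *)
Lemma solution_gap rho : exists C, forall y1 y2 : R -> V,
  solution y1 -> solution y2 ->
  (forall t, 0 <= t <= tau -> `|y1 t| <= rho) ->
  (forall t, 0 <= t <= tau -> `|y2 t| <= rho) ->
  forall t, 0 <= t <= tau ->
    dot (y1 t - y2 t) (y1 t - y2 t) <=
      expR (C * t) * dot (y1 0 - y2 0) (y1 0 - y2 0) /\
    dot (y1 0 - y2 0) (y1 0 - y2 0) <=
      expR (C * t) * dot (y1 t - y2 t) (y1 t - y2 t).
Proof.
have [L L0 hL] := velocity_lipschitz rho.
exists (2 * d%:R * L) => y1 y2 s1 s2 b1 b2 t tt.
pose dl s i := y1 s ord0 i - y2 s ord0 i.
pose h s := \sum_i dl s i ^+ 2.
have hE s : dot (y1 s - y2 s) (y1 s - y2 s) = h s.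
  by rewrite dotE; apply: eq_bigr => i _; rewrite !mxE expr2.
pose dv s i := v s (y1 s) ord0 i - v s (y2 s) ord0 i.
pose dh s := \sum_i 2 * dl s i * dv s i.
have coordD (y : R -> V) s i : solution y -> 0 <= s <= tau ->
    is_derive s 1 (fun s => y s ord0 i) (v s (y s) ord0 i).
  move=> sy ss; have [yd yE] := sy s ss.
  by split; [move/derivable_mxP : yd | rewrite derive_coord// yE].
have hd s : 0 <= s <= tau -> is_derive s 1 h (dh s).
  move=> ss; rewrite /h /dh.
  have -> : (fun s => \sum_i dl s i ^+ 2) = \sum_i (fun s => dl s i ^+ 2).
    by apply/funext => r; rewrite fct_sumE.
  apply: is_derive_sum => i.
  have Hd : is_derive s 1 (dl ^~ i) (dv s i).
    by apply: is_deriveB; exact: coordD.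
  have -> : (fun s => dl s i ^+ 2) = dl ^~ i * dl ^~ i.
    by apply/funext => r; rewrite expr2.
  apply: is_derive_eq; rewrite -![_ *: _]/(_ * _) /=.
  ring.
have hb s : 0 <= s <= tau -> `|dh s| <= 2 * d%:R * L * h s.
  move=> ss; apply: le_trans (ler_norm_sum _ _ _) _.
  (* The constant comes from [2 * |dl i| * |dl j| <= dl i ^+ 2 + dl j ^+ 2], summed over all pairs
     of coordinates. *)
  have -> : 2 * d%:R * L * h s = \sum_i \sum_j L * (dl s i ^+ 2 + dl s j ^+ 2).
    under eq_bigr do rewrite -mulr_sumr big_split/= sumr_const card_ord -/(h s).
    rewrite -mulr_sumr big_split/= sumr_const card_ord sumrMnl -/(h s).
    by rewrite -mulr_natl; ring.
  apply: ler_sum => i _; rewrite !normrM.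
  have := hL s (y1 s) (y2 s) i ss (b1 s ss) (b2 s ss).
  move=> /(ler_wpM2l (_ : 0 <= `|2| * `|dl s i|)) h1.
  apply: le_trans (h1 _) _; first by rewrite mulr_ge0.
  rewrite mulrCA mulr_sumr mulr_sumr ler_sum// => j _.
  rewrite ler_wpM2l// normr_nat.
  rewrite -(real_normK (num_real (dl s i))) -(real_normK (num_real (dl s j))).
  rewrite -/(dl s j); have := sqr_ge0 (`|dl s i| - `|dl s j|).
  by move: `|dl s i| `|dl s j| => p q; nra.
rewrite !hE; split.
  apply: (gronwall hd) tt => s ss.
  by apply: le_trans (hb s ss); exact: ler_norm.
have hNd s : 0 <= s <= tau -> is_derive s 1 (- h) (- dh s).
  by move=> ss; apply: is_deriveN; exact: hd.
have := gronwall hNd (c := - (2 * d%:R * L)) _ tt.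
rewrite -[X in X <= _]/(- h t) -[X in _ <= _ * X]/(- h 0) => H.
have {}H : - h t <= expR (- (2 * d%:R * L) * t) * - h 0.
  apply: H => s ss; rewrite -[X in _ <= _ * X]/(- h s) mulrNN.
  by apply: le_trans (hb s ss); rewrite -normrN ler_norm.
rewrite mulrN lerN2 mulNr expRN mulrC in H.
by rewrite mulrC -ler_pdivrMr ?expR_gt0.
Qed.

Lemma flow_solution x : M x -> solution (phi^~ x).
Proof. by move=> Mx t tt; have [_ h] := hphi; have [_ /(_ t tt)] := h x Mx. Qed.

Lemma flow0 x : M x -> phi 0 x = x.
Proof. by move=> Mx; have [_ h] := hphi; have [] := h x Mx. Qed.

Lemma flow_rect_bounded r : exists rho, forall t x,
  0 <= t <= tau -> `|x| <= r -> `|phi t x| <= rho.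
Proof.
have [sphi _] := hphi.
have /choice[C hC] (i : 'I_d) : exists C, 0 <= C /\ forall t x,
    0 <= t <= tau -> `|x| <= r -> `|phi t x ord0 i| <= C.
  have [C C0 hC] := @rect_bounded _ _ (fun p => phi p.1 p.2 ord0 i) tau r
    (smooth_continuous (smooth_coord _ sphi)).
  by exists C.
exists (\sum_i C i + 1) => t x tt xr; apply/ltW/rV_norm_lt.
  by rewrite ltr_wpDl// sumr_ge0// => i _; have [] := hC i.
move=> i; have [_ /(_ t x tt xr) h] := hC i.
apply: le_lt_trans h _; rewrite (bigD1 i)//= -addrA ltrDl ltr_wpDl//.
by rewrite sumr_ge0// => j _; have [] := hC j.
Qed.

(** As the velocity is periodic, [phi t x + u] solves the equation with initial value [x + u], and
    the gap estimate gives uniqueness. *)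
Lemma flow_equivariant t x u : 0 <= t <= tau -> M x -> G u ->
  phi t (x + u) = phi t x + u.
Proof.
move=> tt Mx Gu; have Mxu := flat_invariant hM Mx Gu.
have [rho1 h1] := flow_rect_bounded (`|x + u|).
have [rho2 h2] := flow_rect_bounded `|x|.
have [C hC] := solution_gap (Num.max rho1 (rho2 + `|u|)).
have s2 : solution (fun s => phi s x + u).
  move=> s ss; have [sd sE] := flow_solution Mx ss.
  have [_ /(_ s ss) [pv _]] := hv.
  have cu : derivable (cst u : R -> V) s 1 by exact: derivable_cst.
  have D1 : derivable (fun s => phi s x + u) s 1 by exact: derivableD.
  apply: (DeriveDef D1); rewrite (pv u (phi s x) Gu).
  by rewrite (deriveD sd cu) sE derive_cst addr0.
have [||+ _] := hC (phi^~ (x + u)) (fun s => phi s x + u) (flow_solution Mxu) s2 _ _ t tt.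
- by move=> s ss; rewrite le_max h1.
- move=> s ss; rewrite le_max; apply/orP; right.
  by apply: le_trans (ler_normD _ _) _; rewrite lerD2r h2.
rewrite !flow0// subrr (psd0l (dot_psd (n := d)))// mulr0 => h.
apply/eqP; rewrite -subr_eq0; apply/eqP/dot_eq0/le_anti.
by rewrite h dot_ge0.
Qed.

(** By equivariance x may be moved into the compact core. The restriction to distance at most 1 then
    keeps z in a fixed ball, so a single constant serves all of M. *)
Lemma flow_bilipschitz : exists2 k : R, 0 < k & forall t x z,
  0 <= t <= tau -> M x -> M z -> `|z - x| <= 1 ->
  dot (phi t z - phi t x) (phi t z - phi t x) <= k * dot (z - x) (z - x) /\
  dot (z - x) (z - x) <= k * dot (phi t z - phi t x) (phi t z - phi t x).
Proof.
have [K [cK KM] MK] := flat_core hM.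
have [r r0 hr] := compact_rV_bounded cK.
have [rho hrho] := flow_rect_bounded (r + 1).
have [C hC] := solution_gap rho.
exists (expR (`|C| * tau)); first exact: expR_gt0.
move=> t x z tt Mx Mz zx.
have [y [u [Ky Gu xE]]] := MK x Mx.
have My := KM y Ky.
have Mzu : M (z - u) by apply: (flat_invariant hM Mz); exact: (latticeN hG Gu).
have zxE : z - x = (z - u) - y by rewrite xE opprD addrA addrAC.
rewrite zxE.
have -> : phi t z - phi t x = phi t (z - u) - phi t y.
  rewrite xE -{1}(subrK u z) (flow_equivariant tt Mzu Gu) (flow_equivariant tt My Gu).
  by rewrite opprD addrACA subrr addr0.
have yr : `|y| <= r + 1 by rewrite (le_trans (ltW (hr _ Ky)))// lerDl.
have zr : `|z - u| <= r + 1.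
  have -> : z - u = y + (z - x) by rewrite zxE [y + _]addrC subrK.
  by apply: le_trans (ler_normD _ _) _; rewrite lerD// ltW// hr.
have [||h1 h2] := hC (phi^~ (z - u)) (phi^~ y) (flow_solution Mzu)
    (flow_solution My) _ _ t tt.
- by move=> s ss; exact: hrho.
- by move=> s ss; exact: hrho.
rewrite !flow0// in h1 h2.
have le_e : expR (C * t) <= expR (`|C| * tau).
  rewrite ler_expR; have /andP[t0 tT] := tt.
  apply: le_trans (ler_norm _) _; rewrite normrM (ger0_norm t0).
  by rewrite ler_wpM2l.
split; [apply: le_trans h1 _ | apply: le_trans h2 _];
  by rewrite ler_wpM2r ?dot_ge0.
Qed.

Lemma flow_slice_smooth t : smooth (phi t).
Proof. by have [sphi _] := hphi; exact: (smooth_slice t sphi). Qed.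

Lemma dot_continuous : continuous (fun z : V => dot z z).
Proof.
move=> z; apply: differentiable_continuous.
have -> : (fun z : V => dot z z) = \sum_i (fun z : V => z ord0 i * z ord0 i).
  by apply/funext => y; rewrite dotE fct_sumE.
apply: differentiable_sum => i.
by apply: differentiableM; exact: differentiable_coord.
Qed.

(** Difference quotients inherit both bounds. At an interior point every direction stays in M for
    small steps, where the bilipschitz estimate is available. *)
Lemma flow_derive_interior : exists2 k : R, 0 < k & forall t x w,
  0 <= t <= tau -> M° x ->
  dot ('D_w (phi t) x) ('D_w (phi t) x) <= k * dot w w /\
  dot w w <= k * dot ('D_w (phi t) x) ('D_w (phi t) x).
Proof.
have [k k0 hk] := flow_bilipschitz; exists k => // t x w tt Mx.
pose z (h : R) := h^-1 *: (phi t (h *: w + x) - phi t x).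
have cz : z h @[h --> 0^'] --> 'D_w (phi t) x.
  have dz : derivable (phi t) x w by exact/smooth_derivable/flow_slice_smooth.
  exact: dz.
have cdz : dot (z h) (z h) @[h --> 0^'] --> dot ('D_w (phi t) x) ('D_w (phi t) x).
  by apply: (cvg_comp _ (fun z : V => dot z z) cz); exact: dot_continuous.
have nM : \forall h \near (0 : R)^', M (h *: w + x) /\ `|h *: w| <= 1.
  apply: nbhs_dnbhs.
  have : nbhs x (M° `&` ball x 1).
    by apply: filterI; [exact: nbhs_interior|exact: nbhsx_ballx].
  have := @line_continuous R V x w 0; rewrite /continuous_at scale0r addr0.
  move=> cl nx.
  have {}nx : nbhs (0 : R) [set s | (M° `&` ball x 1) (x + s *: w)] by exact: cl.
  apply: filterS nx => h /= [/interior_subset Mh bh].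
  rewrite addrC; split => //.
  by move: bh; rewrite -ball_normE /= opprD addNKr normrN => /ltW.
have nB : \forall h \near (0 : R)^',
    dot (z h) (z h) <= k * dot w w /\ dot w w <= k * dot (z h) (z h).
  near=> h.
  have h0 : h != 0 by near: h; exact: nbhs_dnbhs_neq.
  have [Mh bh] : M (h *: w + x) /\ `|h *: w| <= 1 by near: h.
  have [|h1 h2] := hk t x (h *: w + x) tt (interior_subset Mx) Mh.
    by rewrite addrK.
  rewrite addrK in h1 h2.
  have E : phi t (h *: w + x) - phi t x = h *: z h by rewrite scalerA mulfV// scale1r.
  rewrite E in h1 h2.
  have sqZ (y : V) : dot (h *: y) (h *: y) = h ^+ 2 * dot y y.
    by rewrite (psdZl (dot_psd (n := d)))// (psdZr (dot_psd (n := d)))// mulrA expr2.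
  have h20 : 0 < h ^+ 2 by rewrite exprn_even_gt0.
  by rewrite !sqZ ![k * (_ * _)]mulrCA !ler_pM2l// in h1 h2.
split.
  by apply: cvgr_to_le cdz _; apply: filterS nB => h [].
rewrite mulrC -ler_pdivrMr//.
apply: cvgr_to_ge cdz _; apply: filterS nB => h [_ hh].
by rewrite ler_pdivrMr// mulrC.
Unshelve. all: by end_near.
Qed.

Lemma flat_closure_le (f : V -> R) (a b : R) : continuous f ->
  (forall x, M° x -> a <= f x <= b) -> forall x, M x -> a <= f x <= b.
Proof.
move=> cf hf x Mx; rewrite !leNgt -negb_or; apply/negP => /orP fx.
have nx : nbhs x [set y | f y < a \/ b < f y].
  case: fx => fx.
    by apply: filterS (cvgr_lt (f x) (cf x) _ fx) => y; left.
  by apply: filterS (cvgr_gt (f x) (cf x) _ fx) => y; right.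
have [y [My /=]] := flat_closure_interior hM Mx nx.
by have /andP[] := hf y My; rewrite !leNgt => /negP ? /negP ? [].
Qed.

(** The derivative is continuous and the interior is dense in M. *)
Lemma jacobian_bilip : exists2 k : R, 0 < k & forall t x w,
  0 <= t <= tau -> M x ->
  dot (w *m 'J (phi t) x) (w *m 'J (phi t) x) <= k * dot w w /\
  dot w w <= k * dot (w *m 'J (phi t) x) (w *m 'J (phi t) x).
Proof.
have [k k0 hk] := flow_derive_interior; exists k => // t x w tt Mx.
rewrite -deriveEjacobian; last exact: (smooth_differentiable _ (flow_slice_smooth t)).
have cD (y : V) : dot ('D_w (phi t) z) ('D_w (phi t) z) @[z --> y] -->
    dot ('D_w (phi t) y) ('D_w (phi t) y).
  apply: (cvg_comp _ (fun z : V => dot z z)); last exact: dot_continuous.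
  exact: (smooth_continuous (smooth_derive w (flow_slice_smooth t))).
have /andP[h1 h2] : dot w w / k <= dot ('D_w (phi t) x) ('D_w (phi t) x) <= k * dot w w.
  apply: (flat_closure_le cD) Mx => y My; have [-> h] := hk t y w tt My.
  by rewrite ler_pdivrMr// mulrC h.
by split => //; rewrite mulrC -ler_pdivrMr.
Qed.

Definition metric_coef i j (p : R * V) : R :=
  invmx (pullback_metric phi p.1 p.2) i j.

Lemma pullback_metricE t x : pullback_metric phi t x =
  'J (phi t) x *m ('J (phi t) x)^T.
Proof. by rewrite /pullback_metric /flow_jacobian trmxK. Qed.

Lemma metric_bounds : exists2 k : R, 0 < k & forall t x, 0 <= t <= tau -> M x ->
  [/\ pullback_metric phi t x \in unitmx,
      forall i j, `|metric_coef i j (t, x)| <= k,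
      forall i j, metric_coef i j (t, x) = metric_coef j i (t, x) &
      forall q : V, dot q q <= k * grad_dot phi t x q q].
Proof.
have [k k0 hk] := jacobian_bilip; exists k => // t x tt Mx.
have h1 w : dot w w <= k * dot (w *m 'J (phi t) x) (w *m 'J (phi t) x).
  by have [] := hk t x w tt Mx.
have h2 w : dot (w *m 'J (phi t) x) (w *m 'J (phi t) x) <= k * dot w w.
  by have [] := hk t x w tt Mx.
rewrite /metric_coef /grad_dot /= pullback_metricE.
split; first exact: (metric_unitmx h1).
- by move=> i j; exact: (inv_metric_entry (ltW k0) h1).
- by move=> i j; exact: (inv_metricC h1).
- by move=> q; exact: (inv_metric_ge (ltW k0) h1 h2).
Qed.

Lemma grad_dotE t x (p q : V) : grad_dot phi t x p q =
  \sum_i \sum_j metric_coef i j (t, x) * p ord0 i * q ord0 j.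
Proof.
rewrite /grad_dot mxE exchange_big; apply: eq_bigr => j _ /=.
rewrite !mxE mulr_suml; apply: eq_bigr => i _.
by rewrite [_ * p _ _]mulrC.
Qed.

End flow.

(** * Measurability of the inverse metric *)

Section metric_measurable.
Context d (T : measurableType d) (R : realType).

Lemma measurable_det n (A : T -> 'M[R]_n) :
  (forall i j, measurable_fun setT (fun x => A x i j)) ->
  measurable_fun setT (fun x => \det (A x)).
Proof.
move=> mA; apply: measurable_sum => s; apply: measurable_funM => //.
by apply: measurable_prod => i _.
Qed.

Lemma measurable_adj n (A : T -> 'M[R]_n) i j :
  (forall i j, measurable_fun setT (fun x => A x i j)) ->
  measurable_fun setT (fun x => \adj (A x) i j).
Proof.
move=> mA; rewrite /adjugate.
under eq_fun do rewrite mxE /cofactor.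
apply: measurable_funM => //; apply: measurable_det => k l.
under eq_fun do rewrite !mxE.
exact: mA.
Qed.

End metric_measurable.

Section metric_coef_measurable.
Context {R : realType} {d : nat}.
Local Notation V := 'rV[R]_d.
Variables (tau : R) (G M : set V) (hM : flat_manifold G M).
Variables (v phi : R -> V -> V).
Hypotheses (hv : velocity_field tau G v) (hphi : flow_map tau M v phi).

Lemma measurable_jacobian i j :
  measurable_fun setT (fun p : measurableTypeR R * V => 'J (phi p.1) p.2 i j).
Proof.
have [sphi _] := hphi.
have -> : (fun p : measurableTypeR R * V => 'J (phi p.1) p.2 i j) =
    'D_(0, delta_mx ord0 i) (fun p => phi p.1 p.2 ord0 j).
  apply/funext => -[t x] /=.
  have dphi : differentiable (phi t) x.
    exact: (smooth_differentiable _ (flow_slice_smooth hphi t)).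
  transitivity (((delta_mx ord0 i : V) *m 'J (phi t) x) ord0 j).
    by rewrite -rowE [RHS]mxE.
  rewrite -deriveEjacobian// -derive_coord; last exact: diff_derivable.
  exact: (derive_slice (fun p => phi p.1 p.2 ord0 j)).
apply: continuous_measurable_time_rV; apply: smooth_continuous.
exact/smooth_derive/smooth_coord.
Qed.

Lemma measurable_metric_coef i j (A : set (measurableTypeR R * V)) :
  measurable A -> A `<=` `[0, tau] `*` M ->
  measurable_fun A (metric_coef phi i j : measurableTypeR R * V -> R).
Proof.
move=> mA AM.
pose P (p : measurableTypeR R * V) := pullback_metric phi p.1 p.2.
have mP k l : measurable_fun setT (fun p => P p k l).
  rewrite /P; under eq_fun do rewrite pullback_metricE mxE.
  apply: measurable_sum => m; apply: measurable_funM.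
    exact: measurable_jacobian.
  by under eq_fun do rewrite mxE; exact: measurable_jacobian.
have [k _ hk] := metric_bounds hM hv hphi.
(* Cramer's rule, with the inverse of the determinant written as a real power; the two agree because
   the determinant of the metric is a square, hence nonnegative. *)
apply: (eq_measurable_fun (fun p => (\det (P p)) `^ (-1) * \adj (P p) i j)).
  move=> p /set_mem /AM [/=]; rewrite in_itv/= => tt Mx.
  have [uP _ _ _] := hk _ _ tt Mx.
  rewrite /metric_coef /invmx uP [RHS]mxE powR_inv1//.
  by rewrite /P pullback_metricE det_mulmx det_tr -expr2 sqr_ge0.
apply: (@measurable_funS _ _ _ _ setT) => //.
apply: measurable_funM; last exact: measurable_adj.
apply: (measurableT_comp (measurable_powR _)); exact: measurable_det.
Qed.

End metric_coef_measurable.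

(** * Products of time and space *)

Section slices.
Context d1 d2 (T1 : measurableType d1) (T2 : measurableType d2) (R : realType).
Variable m1 : {sigma_finite_measure set T1 -> \bar R}.
Variable m2 : {sigma_finite_measure set T2 -> \bar R}.
Variables (A1 : set T1) (A2 : set T2) (mA1 : measurable A1) (mA2 : measurable A2).
Local Notation m12 := (m1 \x m2)%E.
Local Notation A12 := (A1 `*` A2).
Implicit Types f g : T1 * T2 -> R.

Lemma measurable_rect : measurable A12.
Proof. exact: measurableX. Qed.

Let restrict_slice1 f x y : ((EFin \o f) \_ A12) (x, y) =
  if y \in A2 then ((fun x => (f (x, y))%:E) \_ A1) x else 0%E.
Proof. by rewrite /patch in_setX; case: (x \in A1); case: (y \in A2). Qed.

Let restrict_slice2 f x y : ((EFin \o f) \_ A12) (x, y) =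
  if x \in A1 then ((fun y => (f (x, y))%:E) \_ A2) y else 0%E.
Proof. by rewrite /patch in_setX; case: (x \in A1); case: (y \in A2). Qed.

Lemma integrable_slice1 f : m12.-integrable A12 (EFin \o f) ->
  {ae m2, forall y, A2 y -> m1.-integrable A1 (fun x => (f (x, y))%:E)}.
Proof.
move=> /(integrable_mkcond _ measurable_rect) /ae_integrable2.
apply: filterS => y + A2y; under eq_fun do rewrite restrict_slice1 mem_set//.
by move=> /(integrable_mkcond _ mA1).
Qed.

Lemma integrable_slice2 f : m12.-integrable A12 (EFin \o f) ->
  {ae m1, forall x, A1 x -> m2.-integrable A2 (fun y => (f (x, y))%:E)}.
Proof.
move=> /(integrable_mkcond _ measurable_rect) /ae_integrable1.
apply: filterS => x + A1x; under eq_fun do rewrite restrict_slice2 mem_set//.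
by move=> /(integrable_mkcond _ mA2).
Qed.

(** The inner integral is real valued: on the null set of bad slices [fine] turns it into 0, so it
    agrees with the extended one only almost everywhere. *)
Lemma fubini_slice1 f : m12.-integrable A12 (EFin \o f) ->
  m2.-integrable A2 (fun y => (\int[m1]_(x in A1) f (x, y))%:E) /\
  \int[m2]_(y in A2) (\int[m1]_(x in A1) f (x, y)) = \int[m12]_(p in A12) f p.
Proof.
move=> iF; have ig := (integrable_mkcond _ measurable_rect).1 iF.
pose g := (EFin \o f) \_ A12; pose G := fubini_G m1 g.
have mG : measurable_fun setT G by exact: measurable_fubini_G ig.
have GE y : A2 y -> G y = (\int[m1]_(x in A1) (f (x, y))%:E)%E.
  move=> A2y; rewrite /G /fubini_G [RHS]integral_mkcond; apply: eq_integral => x _.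
  by rewrite /g restrict_slice1 mem_set.
have G0 y : ~ A2 y -> G y = 0%E.
  move=> A2y; rewrite /G /fubini_G; apply: integral0_eq => x _.
  by rewrite /g restrict_slice1 memNset.
have G_ub y : (`|G y| <= \int[m1]_x `|g (x, y)|)%E.
  apply: le_abse_integral => //.
  have mg : measurable_fun setT g by exact: measurable_int ig.
  exact: measurableT_comp mg _.
have iG : m2.-integrable setT G.
  apply/integrableP; split => //.
  apply: le_lt_trans ((integrable21ltyP m1 m2 (measurable_int _ ig)).1 ig).
  apply: ge0_le_integral => //; first exact: measurableT_comp.
  apply: (measurable_fun_fubini_tonelli_G (abse \o g)) => //=.
  by apply: measurableT_comp => //; exact: measurable_int ig.
have iGA : m2.-integrable A2 G by apply: integrableS iG.
have hE y : A2 y -> (\int[m1]_(x in A1) f (x, y)) = fine (G y).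
  by move=> A2y; rewrite GE.
have mh : measurable_fun A2 (fun y => (\int[m1]_(x in A1) f (x, y))%:E).
  apply: (eq_measurable_fun (EFin \o fine \o G)).
    by move=> y /set_mem A2y /=; rewrite hE.
  apply: (@measurable_funS _ _ _ _ setT) => //.
  by apply/measurable_EFinP; exact: measurableT_comp.
have aeE : ae_eq m2 A2 (fun y => (\int[m1]_(x in A1) f (x, y))%:E) G.
  have := integrable_ae mA2 iGA; apply: filterS => y Gy A2y.
  by rewrite hE// fineK// Gy.
split.
  apply: le_integrable iGA => // y A2y; rewrite hE//.
  by case: (G y) => [r| |] //=; rewrite ?normr0 leey.
rewrite /Rintegral (ae_eq_integral G)//; last exact: measurable_int iGA.
rewrite integral_mkcond.
have -> : G \_ A2 = G.
  apply/funext => y; rewrite /patch; case: ifPn => // /negP A2y.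
  by rewrite G0// => /mem_set.
by rewrite (integral21_prod_meas1 ig) -integral_mkcond.
Qed.

Lemma fubini_slice2 f : m12.-integrable A12 (EFin \o f) ->
  m1.-integrable A1 (fun x => (\int[m2]_(y in A2) f (x, y))%:E) /\
  \int[m1]_(x in A1) (\int[m2]_(y in A2) f (x, y)) = \int[m12]_(p in A12) f p.
Proof.
move=> iF; have ig := (integrable_mkcond _ measurable_rect).1 iF.
pose g := (EFin \o f) \_ A12; pose G := fubini_F m2 g.
have iG : m1.-integrable setT G by exact: integrable_fubini_F ig.
have mG : measurable_fun setT G by exact: measurable_int iG.
have GE x : A1 x -> G x = (\int[m2]_(y in A2) (f (x, y))%:E)%E.
  move=> A1x; rewrite /G /fubini_F [RHS]integral_mkcond; apply: eq_integral => y _.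
  by rewrite /g restrict_slice2 mem_set.
have G0 x : ~ A1 x -> G x = 0%E.
  move=> A1x; rewrite /G /fubini_F; apply: integral0_eq => y _.
  by rewrite /g restrict_slice2 memNset.
have iGA : m1.-integrable A1 G by apply: integrableS iG.
have hE x : A1 x -> (\int[m2]_(y in A2) f (x, y)) = fine (G x).
  by move=> A1x; rewrite GE.
have mh : measurable_fun A1 (fun x => (\int[m2]_(y in A2) f (x, y))%:E).
  apply: (eq_measurable_fun (EFin \o fine \o G)).
    by move=> x /set_mem A1x /=; rewrite hE.
  apply: (@measurable_funS _ _ _ _ setT) => //.
  by apply/measurable_EFinP; exact: measurableT_comp.
have aeE : ae_eq m1 A1 (fun x => (\int[m2]_(y in A2) f (x, y))%:E) G.
  have := integrable_ae mA1 iGA; apply: filterS => x Gx A1x.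
  by rewrite hE// fineK// Gx.
split.
  apply: le_integrable iGA => // x A1x; rewrite hE//.
  by case: (G x) => [r| |] //=; rewrite ?normr0 leey.
rewrite /Rintegral (ae_eq_integral G)//; last exact: measurable_int iGA.
rewrite integral_mkcond.
have -> : G \_ A1 = G.
  apply/funext => x; rewrite /patch; case: ifPn => // /negP A1x.
  by rewrite G0// => /mem_set.
by rewrite (integral12_prod_meas1 ig) -integral_mkcond.
Qed.

Local Notation L1 := (L2_on m1 A1).
Local Notation L2 := (L2_on m2 A2).
Local Notation L12 := (L2_on m12 A12).

Lemma L2_tensor (a : T1 -> R) (b : T2 -> R) : L1 a -> L2 b ->
  L12 (fun p => a p.1 * b p.2).
Proof.
move=> /(L2_onP _ mA1)[ma ia] /(L2_onP _ mA2)[mb ib]; apply/(L2_onP _ measurable_rect).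
have mab : measurable_fun A12 (fun p => a p.1 * b p.2).
  apply: measurable_funM.
    apply: (measurable_comp mA1) => [_ [p [Ap _] <-]//|//|].
    exact: measurable_funS measurable_fst.
  apply: (measurable_comp mA2) => [_ [p [_ Ap] <-]//|//|].
  exact: measurable_funS measurable_snd.
split => //.
pose g := (fun p : T1 * T2 => ((a p.1 * b p.2) ^+ 2)%:E) \_ A12.
have mab2 : measurable_fun A12 (fun p : T1 * T2 => ((a p.1 * b p.2) ^+ 2)%:E).
  by apply/measurable_EFinP; exact: measurable_funX.
have mg : measurable_fun setT g by apply/(measurable_restrictT _ measurable_rect).
apply/(integrable_mkcond _ measurable_rect)/integrable12ltyP => //.
have -> : (\int[m1]_x \int[m2]_y `|g (x, y)| =
    \int[m1]_(x in A1) \int[m2]_(y in A2) ((a x ^+ 2)%:E * (b y ^+ 2)%:E))%E.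
  rewrite [RHS]integral_mkcond; apply: eq_integral => x _.
  rewrite /patch; case: ifPn => A1x.
    rewrite [RHS]integral_mkcond; apply: eq_integral => y _.
    rewrite /g /patch in_setX A1x /=; case: ifPn => //=; rewrite ?normr0//.
    by rewrite ger0_norm ?sqr_ge0// exprMn EFinM.
  apply: integral0_eq => y _; rewrite /g /patch in_setX (negbTE A1x) /=.
  by rewrite normr0.
have mb2 : measurable_fun A2 (fun y => (b y ^+ 2)%:E) by exact: measurable_int ib.
have inner x : (\int[m2]_(y in A2) ((a x ^+ 2)%:E * (b y ^+ 2)%:E) =
    (a x ^+ 2)%:E * \int[m2]_(y in A2) (b y ^+ 2)%:E)%E.
  by rewrite ge0_integralZl// ?lee_fin ?sqr_ge0// => y _; rewrite lee_fin sqr_ge0.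
under eq_integral do rewrite inner.
rewrite ge0_integralZr//.
- apply: lte_mul_pinfty.
  + by apply: integral_ge0 => x _; rewrite lee_fin sqr_ge0.
  + by apply: integrable_fin_num.
  + by rewrite ltey_eq integrable_fin_num.
- exact: measurable_int ia.
- by move=> x _; rewrite lee_fin sqr_ge0.
- by apply: integral_ge0 => x _; rewrite lee_fin sqr_ge0.
Qed.

Let L2_slice1 f : L12 f -> {ae m2, forall y, A2 y -> L1 (fun x => f (x, y))}.
Proof.
move=> /(L2_onP _ measurable_rect)[mf i_f].
have := integrable_slice1 i_f; apply: filterS => y + A2y => /(_ A2y) iy.
apply/(L2_onP _ mA1); split => //.
apply: (measurable_comp measurable_rect (g := fun x => (x, y))) => //.
  by move=> _ [x Ax <-].
exact: measurable_funS (measurable_pair2 y).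
Qed.

Let L2_slice2 f : L12 f -> {ae m1, forall x, A1 x -> L2 (fun y => f (x, y))}.
Proof.
move=> /(L2_onP _ measurable_rect)[mf i_f].
have := integrable_slice2 i_f; apply: filterS => x + A1x => /(_ A1x) ix.
apply/(L2_onP _ mA2); split => //.
apply: (measurable_comp measurable_rect (g := fun y => (x, y))) => //.
  by move=> _ [y Ay <-].
exact: measurable_funS (measurable_pair1 x).
Qed.

Hypotheses (fin1 : (m1 A1 < +oo)%E) (fin2 : (m2 A2 < +oo)%E).

Lemma L2_on_cst d (T : measurableType d) (m : {measure set T -> \bar R}) A (c : R) :
  measurable A -> (m A < +oo)%E -> L2_on m A (cst c).
Proof.
by move=> mA Aoo; apply: (L2_on_bounded mA (C := `|c|)) => //; exact: measurable_cst.
Qed.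

(** A partial pairing, adjoint to tensoring with [a]; it reduces statements about [a p.1 * b p.2] to
    one factor at a time. *)
Definition slice1 f (a : T1 -> R) y := ip_on m1 A1 (fun x => f (x, y)) a.
Definition slice2 f (b : T2 -> R) x := ip_on m2 A2 (fun y => f (x, y)) b.

(** Cauchy-Schwarz on almost every slice bounds the square by [K], whose integrability is Fubini for
    [f * f]. *)
Lemma slice1_L2 f a : L12 f -> L1 a -> L2 (slice1 f a).
Proof.
move=> Lf La.
have La1 : L12 (fun p => a p.1 * cst 1 p.2) by apply: L2_tensor => //; exact: L2_on_cst.
have [imul _] := fubini_slice1 (ip_on_integrable measurable_rect Lf La1).
have [iff _] := fubini_slice1 (ip_on_integrable measurable_rect Lf Lf).
have mh : measurable_fun A2 (slice1 f a).
  apply/measurable_EFinP; apply: (eq_measurable_fun _ _ (measurable_int _ imul)).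
  by move=> y _ /=; congr EFin; apply: eq_Rintegral => x _ /=; rewrite mulr1.
apply/(L2_onP _ mA2); split => //.
pose K y := ((ip_on m1 A1 a a)%:E * (\int[m1]_(x in A1) (f (x, y) * f (x, y)))%:E)%E.
have iK : m2.-integrable A2 K by exact: integrableZl.
have mh2 : measurable_fun A2 (fun y => (slice1 f a y ^+ 2)%:E).
  by apply/measurable_EFinP; exact: measurable_funX.
apply/integrableP; split => //.
apply: le_lt_trans ((integrableP _ _ _ iK).2).
apply: ae_ge0_le_integral => //.
- exact: measurableT_comp.
- by apply: measurableT_comp => //; exact: measurable_int iK.
have := L2_slice1 Lf; apply: filterS => y Ly A2y.
rewrite /K -EFinM !abse_EFin lee_fin ger0_norm ?sqr_ge0//.
apply: le_trans (ler_norm _).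
have := cauchy_schwarz (L2_on_psd m1 A1) (Ly A2y) La.
by rewrite [ip_on _ _ (fun x => f (x, y)) _ * _]mulrC.
Qed.

Lemma slice1_ip f a b : L12 f -> L1 a -> L2 b ->
  ip_on m2 A2 (slice1 f a) b = ip_on m12 A12 f (fun p => a p.1 * b p.2).
Proof.
move=> Lf La Lb.
have i_f := ip_on_integrable measurable_rect Lf (L2_tensor La Lb).
have [im imE] := fubini_slice1 i_f.
rewrite [RHS]/ip_on -imE /ip_on /Rintegral; congr fine; apply: ae_eq_integral => //.
- apply/measurable_EFinP; apply: measurable_funM.
    exact: (L2_on_measurable mA2 (slice1_L2 Lf La)).
  exact: (L2_on_measurable mA2 Lb).
- exact: measurable_int im.
have := L2_slice1 Lf; apply: filterS => y Ly A2y; congr EFin.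
rewrite -[RHS]/(\int[m1]_(x in A1) (f (x, y) * (a x * b y))).
under [RHS]eq_Rintegral do rewrite mulrA.
rewrite RintegralZr//; exact: (ip_on_integrable mA1 (Ly A2y) La).
Qed.

Lemma slice2_L2 f b : L12 f -> L2 b -> L1 (slice2 f b).
Proof.
move=> Lf Lb.
have Lb1 : L12 (fun p => cst 1 p.1 * b p.2) by apply: L2_tensor => //; exact: L2_on_cst.
have [imul _] := fubini_slice2 (ip_on_integrable measurable_rect Lf Lb1).
have [iff _] := fubini_slice2 (ip_on_integrable measurable_rect Lf Lf).
have mh : measurable_fun A1 (slice2 f b).
  apply/measurable_EFinP; apply: (eq_measurable_fun _ _ (measurable_int _ imul)).
  by move=> x _ /=; congr EFin; apply: eq_Rintegral => y _ /=; rewrite mul1r.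
apply/(L2_onP _ mA1); split => //.
pose K x := ((ip_on m2 A2 b b)%:E * (\int[m2]_(y in A2) (f (x, y) * f (x, y)))%:E)%E.
have iK : m1.-integrable A1 K by exact: integrableZl.
have mh2 : measurable_fun A1 (fun x => (slice2 f b x ^+ 2)%:E).
  by apply/measurable_EFinP; exact: measurable_funX.
apply/integrableP; split => //.
apply: le_lt_trans ((integrableP _ _ _ iK).2).
apply: ae_ge0_le_integral => //.
- exact: measurableT_comp.
- by apply: measurableT_comp => //; exact: measurable_int iK.
have := L2_slice2 Lf; apply: filterS => x Lx A1x.
rewrite /K -EFinM !abse_EFin lee_fin ger0_norm ?sqr_ge0//.
apply: le_trans (ler_norm _).
have := cauchy_schwarz (L2_on_psd m2 A2) (Lx A1x) Lb.
by rewrite [ip_on _ _ (fun y => f (x, y)) _ * _]mulrC.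
Qed.

Lemma slice2_ip f a b : L12 f -> L1 a -> L2 b ->
  ip_on m1 A1 (slice2 f b) a = ip_on m12 A12 f (fun p => a p.1 * b p.2).
Proof.
move=> Lf La Lb.
have i_f := ip_on_integrable measurable_rect Lf (L2_tensor La Lb).
have [im imE] := fubini_slice2 i_f.
rewrite [RHS]/ip_on -imE /ip_on /Rintegral; congr fine; apply: ae_eq_integral => //.
- apply/measurable_EFinP; apply: measurable_funM.
    exact: (L2_on_measurable mA1 (slice2_L2 Lf Lb)).
  exact: (L2_on_measurable mA1 La).
- exact: measurable_int im.
have := L2_slice2 Lf; apply: filterS => x Lx A1x; congr EFin.
rewrite -[RHS]/(\int[m2]_(y in A2) (f (x, y) * (a x * b y))).
under [RHS]eq_Rintegral do rewrite [a _ * _]mulrC mulrA.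
rewrite RintegralZr//; exact: (ip_on_integrable mA2 (Lx A1x) Lb).
Qed.

Lemma ip_slice1 f b : L12 f -> L2 b ->
  ip_on m12 A12 f (fun p => b p.2) = ip_on m2 A2 (slice1 f (cst 1)) b.
Proof.
move=> Lf Lb; rewrite slice1_ip//; last exact: L2_on_cst.
by apply: eq_Rintegral => p _ /=; rewrite mul1r.
Qed.

Lemma ip_slice2 f a : L12 f -> L1 a ->
  ip_on m12 A12 f (fun p => a p.1) = ip_on m1 A1 (slice2 f (cst 1)) a.
Proof.
move=> Lf La; rewrite slice2_ip//; last exact: L2_on_cst.
by apply: eq_Rintegral => p _ /=; rewrite mulr1.
Qed.

Lemma L2_lift1 a : L1 a -> L12 (fun p => a p.1).
Proof.
move=> La; have := L2_tensor La (L2_on_cst 1 mA2 fin2).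
by congr (L2_on _ _ _); apply/funext => p /=; rewrite mulr1.
Qed.

Lemma L2_lift2 b : L2 b -> L12 (fun p => b p.2).
Proof.
move=> Lb; have := L2_tensor (L2_on_cst 1 mA1 fin1) Lb.
by congr (L2_on _ _ _); apply/funext => p /=; rewrite mul1r.
Qed.

End slices.

Section pi_system.
Context d (T : measurableType d) (R : realType) (m : {measure set T -> \bar R}).

(** By Dynkin's lemma the integrals vanish over all measurable sets, which determines the function
    almost everywhere. *)
Lemma integral_pi_system (A : set T) (g : T -> R) (C : set (set T)) :
  measurable A -> m.-integrable A (EFin \o g) ->
  @measurable _ T = <<s C >> -> setI_closed C ->
  (\int[m]_(x in A) (g x)%:E = 0)%E ->
  (forall B, C B -> (\int[m]_(x in A `&` B) (g x)%:E = 0)%E) ->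
  ae_eq m A (EFin \o g) (cst 0%E).
Proof.
move=> mA ig mC CI gA gC.
apply: integral_ae_eq => // E EA mE; rewrite [RHS]integral0_eq//.
suff H : forall S, measurable S -> (\int[m]_(x in A `&` S) (g x)%:E = 0)%E.
  by have := H E mE; rewrite setIidr.
have iS S : measurable S -> m.-integrable (A `&` S) (EFin \o g).
  by move=> mS; apply: integrableS ig => //; exact: measurableI.
move=> S; rewrite mC.
apply: (@dynkin_induction _ T C (fun S => (\int[m]_(x in A `&` S) (g x)%:E = 0)%E)) => //.
- by rewrite setIT.
- move=> B mB HB; have := gA.
  have {1}-> : A = (A `&` B) `|` (A `&` ~` B) by rewrite -setIUr setUv setIT.
  rewrite integral_setU//.
  + by rewrite HB add0e.
  + exact: measurableI.
  + by apply: measurableI => //; exact: measurableC.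
  + by rewrite -setIUr setUv setIT; exact: measurable_int ig.
  + apply/disj_setPS => x [[_ Bx] [_ nBx]].
    by case: nBx.
- move=> F mF tF HF; rewrite setI_bigcupr integral_bigcup.
  + by apply: eseries0 => k _ _; exact: HF.
  + apply/trivIsetP => i j _ _ ij; rewrite setIACA setIid.
    by move/trivIsetP : tF => /(_ i j I I ij) ->; rewrite setI0.
  + by move=> k; exact: measurableI.
  + by rewrite -setI_bigcupr; apply: iS; exact: bigcupT_measurable.
Qed.

End pi_system.

(** * Products and slices of test functions *)

Section smooth_projections.
Context {R : realType} {V1 V2 W : normedModType R}.

Lemma smooth_fst (f : V1 -> W) : smooth f -> smooth (fun p : V1 * V2 => f p.1).
Proof.
move=> sf; apply: (smooth_coind (P := [set h | exists2 f : V1 -> W, smooth f &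
    h = fun p : V1 * V2 => f p.1])); last by exists f.
move=> _ [{sf}f sf ->]; split => [x|u].
  apply: (@differentiable_comp _ _ _ _ fst f); last exact: smooth_differentiable.
  by apply: linear_differentiable => p; exact: cvg_fst.
by exists ('D_(u.1) f) => //; exact: smooth_derive.
Qed.

Lemma smooth_snd (f : V2 -> W) : smooth f -> smooth (fun p : V1 * V2 => f p.2).
Proof.
move=> sf; apply: (smooth_coind (P := [set h | exists2 f : V2 -> W, smooth f &
    h = fun p : V1 * V2 => f p.2])); last by exists f.
move=> _ [{sf}f sf ->]; split => [x|u].
  apply: (@differentiable_comp _ _ _ _ snd f); last exact: smooth_differentiable.
  by apply: linear_differentiable => p; exact: cvg_snd.
by exists ('D_(u.2) f) => //; exact: smooth_derive.
Qed.

End smooth_projections.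

Section product_tests.
Context {R : realType} {V : normedModType R}.

Lemma derive_slice_time (W : normedModType R) (f : R * V -> W) t x :
  'D_1 (fun t => f (t, x)) t = 'D_(1, 0) f (t, x).
Proof.
rewrite /derive; congr (lim _).
suff -> : (fun h : R => h^-1 *: (f (h *: (1 : R) + t, x) - f (t, x))) =
  (fun h : R => h^-1 *: (f (h *: ((1 : R), (0 : V)) + (t, x)) - f (t, x))) by [].
apply/funext => h; congr (_ *: (f _ - _)).
by apply: injective_projections; rewrite /= ?scaler0 ?add0r.
Qed.

Lemma smooth_slice_time (W : normedModType R) (f : R * V -> W) x : smooth f ->
  smooth (fun t => f (t, x)).
Proof.
move=> sf; apply: (smooth_coind (P := [set h | exists c f, smooth f /\
    h = fun t => c *: (f : R * V -> W) (t, x)])); last first.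
  by exists 1, f; split => //; apply/funext => t; rewrite scale1r.
move=> _ [c [{sf}f [sf ->]]].
have df (t : R) : differentiable (fun t => f (t, x)) t.
  apply: (@differentiable_comp _ _ _ _ (fun t : R => (t, x)) f).
    exact: differentiable_pair.
  exact: smooth_differentiable.
split => [t|u]; first exact: differentiableZ.
exists (c * u), ('D_(1, 0) f); split; first exact: smooth_derive.
apply/funext => t; rewrite deriveZ; last exact: diff_derivable.
rewrite -derive_slice_time !deriveE// -scalerA.
by rewrite -{1}[u]mulr1 -[u * 1]/(u *: 1) linearZ.
Qed.

Variables (G1 A1 : set R) (G A : set V).

Lemma test_tensor (b : R -> R) (psi : V -> R) :
  test_function G1 A1 b -> test_function G A psi ->
  test_function (G1 `*` G) (A1 `*` A) (fun p => b p.1 * psi p.2).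
Proof.
move=> [sb pb cb] [spsi ppsi cpsi]; split.
- apply: smoothM.
    exact: smooth_fst.
  exact: smooth_snd.
- by move=> [s u] [t x] [/= Gs Gu]; rewrite pb// ppsi.
- move=> [t x] cp.
  have : A1° t.
    apply: cb => B Bt; have [|[s y] [/= /negP nz [Bs _]]] := cp (B `*` setT).
      by exists (B, setT) => //; split => //=; exact: filter_nbhsT.
    by exists s; split => //; apply/negP => /eqP bs; apply: nz; rewrite bs mul0r.
  have : A° x.
    apply: cpsi => B Bx; have [|[s y] [/= /negP nz [_ By]]] := cp (setT `*` B).
      by exists (setT, B) => //; split => //=; exact: (@filterT _ (nbhs t)).
    by exists y; split => //; apply/negP => /eqP bs; apply: nz; rewrite bs mulr0.
  by rewrite /interior => Ax A1t; exists (A1, A).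
Qed.

Lemma test_slice psi t : G1 0 -> test_function (G1 `*` G) (A1 `*` A) psi ->
  test_function G A (fun x => psi (t, x)).
Proof.
move=> G10 [spsi ppsi cpsi]; split.
- apply: (smooth_coind (P := [set h | exists2 f : R * V -> R, smooth f &
    h = fun x => f (t, x)])); last by exists psi.
  move=> _ [f sf ->]; split => [x|u].
    apply: (@differentiable_comp _ _ _ _ (fun x => (t, x)) f).
      exact: differentiable_pair.
    exact: smooth_differentiable.
  exists ('D_(0, u) f); first exact: smooth_derive.
  apply/funext => x; rewrite /derive; congr (lim _).
  suff -> : (fun h : R => h^-1 *: (f (t, h *: u + x) - f (t, x))) =
    (fun h : R => h^-1 *: (f (h *: ((0 : R), u) + (t, x)) - f (t, x))) by [].
  apply/funext => h; congr (_ *: (f _ - _)).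
  by apply: injective_projections; rewrite /= ?scaler0 ?add0r.
- by move=> u x Gu; rewrite -(ppsi (0, u) (t, x))//= /GRing.add/= /add_pair/= addr0.
- move=> x cx; suff : (A1 `*` A)° (t, x).
    move=> [[P Q] /= [Pt Qx] PQ]; rewrite /interior.
    apply: filterS Qx => y Qy.
    have [] // : (A1 `*` A) (t, y) by apply: PQ; split => //=; exact: nbhs_singleton.
  apply: cpsi => B [[P Q] /= [Pt Qx] PQ].
  have [y [/= nz Qy]] := cx Q Qx; exists (t, y); split => //.
  by apply: PQ; split => //=; exact: nbhs_singleton.
Qed.

Lemma test_slice_time psi x : G 0 -> test_function (G1 `*` G) (A1 `*` A) psi ->
  test_function G1 A1 (fun t => psi (t, x)).
Proof.
move=> G0 [spsi ppsi cpsi]; split.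
- exact: smooth_slice_time.
- by move=> s t Gs; rewrite -(ppsi (s, 0) (t, x))//= /GRing.add/= /add_pair/= addr0.
- move=> t cx; suff : (A1 `*` A)° (t, x).
    move=> [[P Q] /= [Pt Qx] PQ]; rewrite /interior.
    apply: filterS Pt => s Ps.
    have [] // : (A1 `*` A) (s, x) by apply: PQ; split => //=; exact: nbhs_singleton.
  apply: cpsi => B [[P Q] /= [Pt Qx] PQ].
  have [s [/= nz Ps]] := cx P Pt; exists (s, x); split => //.
  by apply: PQ; split => //=; exact: nbhs_singleton.
Qed.

Lemma derive_tensor_time (b : R -> R) (psi : V -> R) : smooth b ->
  'D_(1, 0) (fun p : R * V => b p.1 * psi p.2) = fun p => 'D_1 b p.1 * psi p.2.
Proof.
move=> sb; apply/funext => -[t x]; rewrite -derive_slice_time/=.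
under eq_fun do rewrite mulrC.
rewrite [RHS]mulrC; apply: (@deriveZ _ _ _ b (psi x) t 1).
exact: smooth_derivable.
Qed.

End product_tests.

Section product_tests_rV.
Context {R : realType} {d : nat}.
Local Notation V := 'rV[R]_d.

Lemma derive_tensor_space (b : R -> R) (psi : V -> R) u : smooth psi ->
  'D_(0, u) (fun p : R * V => b p.1 * psi p.2) = fun p => b p.1 * 'D_u psi p.2.
Proof.
move=> sb; apply/funext => -[t x]; rewrite -derive_slice/=.
apply: (@deriveZ _ _ _ psi (b t) x u); exact: smooth_derivable.
Qed.

End product_tests_rV.

(** * Test functions on the time interval *)

Section time.
Context {R : realType}.
Variables (tau : R) (tau_gt0 : 0 < tau).
Local Notation I := (`[0, tau]%classic : set (measurableTypeR R)).
Local Notation leb := (@lebesgue_measure R).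
Local Notation T1 := (test_function [set 0] (`[0, tau]%classic : set R)).

Lemma measurable_time : measurable I.
Proof. exact: measurable_itv. Qed.

Lemma time_finite : (leb I < +oo)%E.
Proof. by rewrite lebesgue_measure_itv/= lte_fin tau_gt0 -EFinB ltry. Qed.

Lemma time_interior (t : R) : 0 < t < tau -> (`[0, tau]%classic : set R)° t.
Proof.
move=> t0t; have /near_in_itvoo : t \in `]0, tau[ by rewrite in_itv.
by apply: filterS => s; rewrite /= !in_itv/= => /andP[/ltW -> /ltW ->].
Qed.

Lemma time_not_interior0 : ~ (`[0, tau]%classic : set R)° 0.
Proof.
rewrite /interior => /nbhs_ballP[e /= e0 H].
have /H : ball (0 : R) e (- (e / 2)).
  by rewrite -ball_normE /= opprK add0r gtr0_norm ?divr_gt0//; lra.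
by rewrite /= in_itv/= oppr_ge0 leNgt divr_gt0.
Qed.

Lemma time_not_interior1 : ~ (`[0, tau]%classic : set R)° tau.
Proof.
rewrite /interior => /nbhs_ballP[e /= e0 H].
have /H : ball tau e (tau + e / 2).
  by rewrite -ball_normE /= opprD addNKr normrN gtr0_norm ?divr_gt0//; lra.
by rewrite /= in_itv/= => /andP[_]; rewrite gerDl leNgt divr_gt0.
Qed.

Lemma time_test_ends b : T1 b -> b 0 = 0 /\ b tau = 0.
Proof.
move=> Tb; split.
  exact: (nbhs_singleton (test_vanish Tb time_not_interior0)).
exact: (nbhs_singleton (test_vanish Tb time_not_interior1)).
Qed.

Lemma time_test_intro (b : R -> R) (x y : R) : smooth b -> 0 < x -> y < tau ->
  (forall t, b t != 0 -> x <= t <= y) -> T1 b.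
Proof.
move=> sb x0 yt hb; split => //.
  by move=> u t ->; rewrite addr0.
have cl : closed (`[x, y]%classic : set R) by exact: itv_closed.

apply: (@subset_trans _ (`[x, y]%classic : set R)).
  rewrite [X in _ `<=` X](_ : _ = closure (`[x, y]%classic : set R)); last first.
    exact/closure_id.
  by apply: closureS => t /= /hb; rewrite in_itv.
move=> t /=; rewrite in_itv/= => /andP[xt ty].
by apply: time_interior; rewrite (lt_le_trans x0 xt) (le_lt_trans ty yt).
Qed.

Lemma time_test_bump (x y : R) n : 0 < x -> y < tau -> T1 (itv_bump x y n).
Proof.
move=> x0 yt; apply: (time_test_intro (x := x) (y := y)) => //.
  exact: smooth_itv_bump.
by move=> t; rewrite itv_bump_neq0 => /andP[/ltW -> /ltW ->].
Qed.

Lemma continuous_time_bounded (b : R -> R) : continuous b ->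
  exists C, forall t, I t -> `|b t| <= C.
Proof.
move=> cb.
have := compact_bounded (continuous_compact (continuous_subspaceT cb) (@segment_compact _ 0 tau)).
move=> /pinfty_ex_gt0[C C0 hC]; exists C => t It; apply: hC.
by exists t.
Qed.

Lemma continuous_time_L2 (b : R -> R) : continuous b -> L2_on leb I b.
Proof.
move=> cb; have [C hC] := continuous_time_bounded cb.
apply: (L2_on_bounded measurable_time time_finite _ hC).
by apply: measurable_funTS; exact: continuous_measurable_fun.
Qed.

Lemma time_test_L2 b : T1 b -> L2_on leb I b.
Proof. by move=> [sb _ _]; apply: continuous_time_L2; exact: smooth_continuous. Qed.

Lemma time_test_derive_integral b : T1 b -> \int[leb]_(t in I) 'D_1 b t = 0.
Proof.
move=> Tb; have [b0 b1] := time_test_ends Tb.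
by rewrite smooth_FTC// ?b0 ?b1 ?subrr//; case: Tb.
Qed.

Lemma L2_time_integrable k : L2_on leb I k -> leb.-integrable I (EFin \o k).
Proof.
move=> Lk; have := ip_on_integrable measurable_time Lk
  (L2_on_cst (1 : R) measurable_time time_finite).
by apply: eq_integrable => // t _ /=; rewrite mulr1.
Qed.

(** Bumps give vanishing integrals over the open intervals that stay away from the ends. These
    generate the Borel sets on each [A n], and the [A n] exhaust the time interval up to its two end
    points. *)
Lemma time_fundamental_lemma k : L2_on leb I k ->
  (forall b, T1 b -> ip_on leb I k b = 0) -> ip_on leb I k k = 0.
Proof.
move=> Lk orth; have ik := L2_time_integrable Lk.
have mk : measurable_fun I k := L2_on_measurable measurable_time Lk.
have itv0 x y : 0 < x -> y < tau -> (\int[leb]_(t in `]x, y[) (k t)%:E = 0)%E.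
  move=> x0 yt.
  have sub : `]x, y[ `<=` I.
    move=> t; rewrite /= !in_itv/= => /andP[xt ty].
    by rewrite (ltW (lt_trans x0 xt)) (ltW (lt_trans ty yt)).
  have mb n : measurable_fun I (itv_bump x y n).
    apply: measurable_funTS; apply: continuous_measurable_fun.
    exact/smooth_continuous/smooth_itv_bump.
  have [||||_ _ cv] := @dominated_convergence _ _ _ leb I measurable_time
    (fun n t => (k t * itv_bump x y n t)%:E)
    (fun t => (k t * \1_(`]x, y[) t)%:E) (fun t => `|(k t)%:E|%E)
    (fun n => (measurable_EFinP _ _).2 (measurable_funM mk (mb n))).
  - apply/measurable_EFinP; apply: measurable_funM => //.
  - apply: aeW => t _; apply: cvg_EFin; first exact: nearW.
    apply: cvgM; first exact: cvg_cst.
    rewrite indicE; case: (boolP (t \in _)) => txy.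
      by apply: itv_bump_cvg; move/set_mem : txy; rewrite /= in_itv.
    rewrite (_ : (fun n => _) = cst 0); first exact: cvg_cst.
    apply/funext => n; apply/eqP/negPn/negP; rewrite itv_bump_neq0 => h.
    by move/negP : txy; apply; apply/mem_set; rewrite /= in_itv.
  - exact: integrable_abse.
  - apply: aeW => t n _; rewrite /= lee_fin normrM ler_piMr//.
    by have /andP[b0 b1] := itv_bump_itv x y n t; rewrite ger0_norm.

  have : (\int[leb]_(t in I) (k t * \1_(`]x, y[) t)%:E = 0)%E.
    apply: (cvg_unique _ cv) => //.
    rewrite (_ : (fun n => _) = cst 0%E); first exact: cvg_cst.
    apply/funext => n /=.
    have ikb := ip_on_integrable measurable_time Lk (time_test_L2 (time_test_bump n x0 yt)).
    by rewrite -[LHS]fineK ?integrable_fin_num//; congr EFin; exact: orth (time_test_bump n x0 yt).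
  move=> <-; rewrite [RHS](_ : _ = (\int[leb]_(t in I) ((EFin \o k) \_ `]x, y[) t)%E).
    by rewrite -integral_mkcondr setIidr.
  apply: eq_integral => t _; rewrite /patch indicE.
  by case: (t \in _); rewrite ?mulr1 ?mulr0.
apply: (ae_ip_on measurable_time Lk).
pose A n := (`]tau / n.+3%:R, tau - tau / n.+3%:R[%classic : set (measurableTypeR R)).
have dlt n : 0 < tau / n.+3%:R by rewrite divr_gt0.
have AI n : A n `<=` I.
  move=> t; rewrite /A/= !in_itv/= => /andP[h1 h2]; have := dlt n.
  move=> h3; apply/andP; split; first exact/ltW/(lt_trans h3 h1).
  by apply/ltW/(lt_trans h2); rewrite gtrBl.
have aeA n : ae_eq leb (A n) (EFin \o k) (cst 0%E).
  pose C : set (set (measurableTypeR R)) := [set B | exists x y, B = `]x, y[%classic].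
  have iA x y : (\int[leb]_(t in A n `&` `]x, y[) (k t)%:E = 0)%E.
    have -> : A n `&` `]x, y[ =
        `]Num.max (tau / n.+3%:R) x, Num.min (tau - tau / n.+3%:R) y[%classic.
      apply/seteqP; split => t; rewrite /A/= !in_itv/= gt_max lt_min.
        by move=> [/andP[-> ->] /andP[-> ->]].
      by move=> /andP[/andP[-> ->] /andP[-> ->]].
    apply: itv0; first by rewrite lt_max dlt.
    by rewrite gt_min ltrBlDr ltrDl dlt.
  apply: (@integral_pi_system _ _ _ leb (A n) k C).
  - exact: measurable_itv.
  - by apply: integrableS ik; [exact: measurable_time|exact: measurable_itv|exact: AI].
  - exact: RGenOpens.measurableE.
  - move=> _ _ [x [y ->]] [x' [y' ->]]; exists (Num.max x x'), (Num.min y y').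
    apply/seteqP; split => t; rewrite /= !in_itv/= gt_max lt_min.
      by move=> [/andP[-> ->] /andP[-> ->]].
    by move=> /andP[/andP[-> ->] /andP[-> ->]].
  - by apply: itv0; rewrite ?dlt// ltrBlDr ltrDl dlt.
  - by move=> _ [x [y ->]]; exact: iA.
have nA : leb.-negligible (\bigcup_n (A n `&` [set t | k t != 0])).
  apply: negligible_bigcup => n; have [N [mN N0 HN]] := aeA n.
  exists N; split => // t [At kt]; apply: HN => /= H.
  by have [k0] := H At; move: kt; rewrite /= k0 eqxx.
have n0 : leb.-negligible [set 0 : R].
  by exists [set 0]; split => //; exact: lebesgue_measure_set1.
have nt : leb.-negligible [set tau].
  by exists [set tau]; split => //; exact: lebesgue_measure_set1.
have := negligibleU (negligibleU n0 nt) nA; apply: negligibleS => t.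
move=> /not_implyP[It kt].
have [t0|t0] := eqVneq t 0; first by left; left.
have [t1|t1] := eqVneq t tau; first by left; right.
right; move: It; rewrite /= in_itv/= => /andP[t0' t1'].
have t2 : 0 < t by rewrite lt_neqAle eq_sym t0.
have t3 : 0 < tau - t by rewrite subr_gt0 lt_neqAle t1.
have [n _ hn] : exists2 n : nat, True & tau / n.+3%:R < Num.min t (tau - t).
  have m0 : 0 < Num.min t (tau - t) by rewrite lt_min t2.
  exists (Num.truncn (tau / Num.min t (tau - t))) => //.
  rewrite ltr_pdivrMr// mulrC -ltr_pdivrMr//.
  apply: (lt_le_trans (truncnS_gt _)); rewrite ler_nat !ltnS.
  exact: leqW (leqnSn _).
exists n => //; split; last by apply/eqP.
move: hn; rewrite lt_min /A/= in_itv/= => /andP[h1 h2].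
by rewrite h1 ltrBrDl addrC -ltrBrDl.
Qed.

End time.

Section time_primitive.
Context {R : realType}.
Variables (tau : R) (tau_gt0 : 0 < tau).
Local Notation I := (`[0, tau]%classic : set (measurableTypeR R)).
Local Notation leb := (@lebesgue_measure R).
Local Notation T1 := (test_function [set 0] (`[0, tau]%classic : set R)).

Lemma time_test_support b : T1 b -> exists x y, [/\ 0 < x, y < tau &
  forall t, b t != 0 -> x <= t <= y].
Proof.
move=> Tb.
have /nbhs_ballP[e /= e0 He] := test_vanish Tb (@time_not_interior0 _ tau).
have /nbhs_ballP[e' /= e'0 He'] := test_vanish Tb (@time_not_interior1 _ tau).
exists e, (tau - e'); split => //; first by rewrite gtrBl.
move=> t bt.
have : `[0, tau]%classic t.
  by apply: contrapT => It; move: bt; rewrite (test_zero Tb It) eqxx.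
rewrite /= in_itv/= => /andP[t0 t1]; apply/andP; split; rewrite leNgt; apply/negP => h.
  move: bt; rewrite (He t) ?eqxx//.
  by rewrite -ball_normE /= sub0r normrN ger0_norm.
move: bt; rewrite (He' t) ?eqxx//.
by rewrite -ball_normE /= ger0_norm ?subr_ge0// ltrBlDl -ltrBlDr.
Qed.

Lemma time_test_integrableT b : T1 b -> leb.-integrable setT (EFin \o b).
Proof.
move=> Tb.
have := L2_time_integrable tau_gt0 (time_test_L2 tau_gt0 Tb).
move=> /(integrable_mkcond _ (measurable_time tau)).
congr (integrable _ _ _); apply/funext => t; rewrite /patch; case: ifPn => // It.
rewrite /= (test_zero Tb)// => It'; move/negP : It; apply; exact: mem_set.
Qed.

(** The integral from the left vanishes before the support of [b], and after it because the total
    integral is 0. *)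
Lemma time_test_primitive b : T1 b -> \int[leb]_(t in I) b t = 0 ->
  exists2 eta, T1 eta & 'D_1 eta = b.
Proof.
move=> Tb b0; have sb := test_smooth Tb.
pose eta t := \int[leb]_(s in `]-oo, t]) b s.
have ib t : leb.-integrable `]-oo, t] (EFin \o b).
  apply: integrableS (time_test_integrableT Tb) => //.
have etaD t : derivable eta t 1 /\ 'D_1 eta t = b t.
  rewrite -derive1E; apply: (@continuous_FTC1 _ b -oo%O t (t + 1)) => //.
  - by rewrite ltrDl.
  - exact: ltNyr.
  - exact: (smooth_continuous sb).
have dE : 'D_1 eta = b.
  by apply/funext => t; have [] := etaD t.
exists eta => //.
have [x [y [x0 yt hxy]]] := time_test_support Tb.
apply: (time_test_intro _ x0 yt).
  (* Adding [eta] alone to the smooth functions gives a stable class, its derivatives being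
     multiples of [b]. *)
  apply: (smooth_coind (P := [set h | smooth h \/ h = eta])); last by right.
  move=> h [sh|->].
    split => [t|u]; first exact: smooth_differentiable.
    by left; exact: smooth_derive.
  have deta (t : R) : differentiable eta t.
    by apply/derivable1_diffP; have [] := etaD t.
  split => [//|u]; left.
  have -> : 'D_u eta = fun t => u *: b t.
    by apply/funext => t; rewrite derive_scalar//; have [_ ->] := etaD t.
  exact: smoothZ.
move=> t; apply: contra_neqT => /negP txy.
have b_zero s : ~ I s -> b s = 0 by move=> Is; exact: test_zero Tb Is.
have [tx|xt] := ltP t x.
  rewrite /eta; transitivity (\int[leb]_(s in `]-oo, t]) (0 : R)).
    apply: eq_Rintegral => s /set_mem; rewrite /= in_itv/= => st.
    apply/eqP/negPn/negP => /hxy /andP[xs _].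
    by have := le_lt_trans (le_trans xs st) tx; rewrite ltxx.
  by rewrite Rintegral_cst ?mul0r//; exact: measurable_itv.
have ty : y < t by rewrite ltNge; apply/negP => ty; apply: txy; rewrite xt.
rewrite /eta -b0 Rintegral_mkcond [RHS]Rintegral_mkcond; apply: eq_Rintegral => s _.
rewrite /patch; case: ifPn => st; case: ifPn => // sI.
  by rewrite b_zero// => Is; move/negP : sI; apply; exact: mem_set.
apply/esym/eqP/negPn/negP => /hxy /andP[_ sy]; move/negP : st; apply; apply/mem_set.
by rewrite /= in_itv/= (le_trans sy (ltW ty)).
Qed.

Lemma time_unit_bump : exists2 b, T1 b & \int[leb]_(t in I) b t = 1.
Proof.
pose x := tau / 3; pose y := tau / 3 * 2.
have t3 : 0 < tau / 3 by rewrite divr_gt0.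
have yt : y < tau by rewrite /y; lra.
pose b := itv_bump x y 0.
have Tb : T1 b by exact: time_test_bump.
pose c := \int[leb]_(t in I) b t.
have ibI := L2_time_integrable tau_gt0 (time_test_L2 tau_gt0 Tb).
have c0 : c != 0.
  apply/eqP => c0.
  have b0 : ae_eq leb I (EFin \o b) (cst 0%E).
    apply/(ae_eq_integral_abs leb (measurable_time tau) (measurable_int _ ibI)).
    transitivity (\int[leb]_(t in I) (b t)%:E)%E.
      apply: eq_integral => t _ /=.
      by rewrite ger0_norm//; have /andP[] := itv_bump_itv x y 0 t.
    have fb : (\int[leb]_(t in I) (b t)%:E)%E \is a fin_num.
      by apply: integrable_fin_num => //; exact: measurable_time.
    by rewrite -(fineK fb); congr EFin; exact: c0.
  have : leb.-negligible `]x, y[.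
    apply: negligibleS b0 => t; rewrite /= in_itv/= => txy H.
    have It : I t.
      rewrite /= in_itv/=; move: txy => /andP[xt ty]; apply/andP; split.
        exact/ltW/(lt_trans t3 xt).
      exact/ltW/(lt_trans ty yt).
    have [bt] := H It.
    by have := itv_bump_neq0 x y 0 t; rewrite txy -/b bt eqxx.
  have mxy : measurable (`]x, y[%classic : set (measurableTypeR R)) by exact: measurable_itv.
  move=> /(negligibleP _ mxy) z.
  have : lebesgue_measure `]x, y[ = 0%E :> \bar R by exact: z.
  rewrite lebesgue_measure_itv/= lte_fin.
  have xy : x < y by rewrite /x /y; lra.
  rewrite xy => -[] /eqP; rewrite subr_eq0 => /eqP yx.
  by move: xy; rewrite yx ltxx.
exists (fun t => c^-1 * b t).
  have [h1 h2 h3] := Tb; split.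
  - by have := smoothZ c^-1 h1.
  - by move=> u t Gu; rewrite h2.
  - apply: subset_trans h3; apply: closureS => t /=.
    by apply: contra_neq => ->; rewrite mulr0.
by rewrite RintegralZl// ?mulVf//; exact: measurable_time.
Qed.

End time_primitive.

(** * Test functions on space-time *)

Section space_time_tests.
Context {R : realType} {d : nat}.
Local Notation V := 'rV[R]_d.
Variables (tau : R) (tau_gt0 : 0 < tau).
Local Notation I := (`[0, tau]%classic : set (measurableTypeR R)).
Local Notation leb := (@lebesgue_measure R).
Local Notation mu := (lebesgue_rV d).
Local Notation T1 := (test_function [set 0] (`[0, tau]%classic : set R)).
Variables (G M D : set V).
Hypotheses (hM : flat_manifold G M) (hD : fundamental_domain G D).
Let mMD := flat_domain_measurable hM hD.
Let MDoo := flat_measure_lt_pinfty hM hD.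
Let mI := measurable_time tau.
Let Ioo := time_finite tau_gt0.
Local Notation L0 := (L2_M0 tau M D).
Local Notation ip0 := (ip_M0 tau M D).
Local Notation L := (L2_M M D).
Local Notation ip := (ip_M M D).
Local Notation T0 := (test_M0 tau G M).
Local Notation T := (test_function G M).

Lemma test_M0_bounded psi : T0 psi -> exists C, forall p,
  (`[0, tau] `*` (M `&` D)) p -> `|psi p| <= C.
Proof.
move=> [spsi ppsi _]; have [K [cK KM] MK] := flat_core hM.
have [r r0 hr] := compact_rV_bounded cK.
have [C _ hC] := rect_bounded tau r (smooth_continuous spsi).
exists C => -[t x] [/= It [Mx _]]; have [y [u [Ky Gu ->]]] := MK x Mx.
rewrite in_itv/= in It.
have -> : psi (t, y + u) = psi (t, y).
  have -> : (t, y + u) = (t, y) + (0, u) by apply: injective_projections; rewrite /= ?addr0.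
  by apply: ppsi.
by apply: hC => //; exact/ltW/hr.
Qed.

Lemma test_M0_L2 psi : T0 psi -> L0 psi.
Proof.
move=> Tpsi; have [C hC] := test_M0_bounded Tpsi.
apply: (@L2_on_bounded _ _ _ (leb \x mu)%E (I `*` (M `&` D)) _ psi C) => //.
- exact: measurableX.
- suff : (leb I * mu (M `&` D) < +oo)%E by rewrite -(product_measure1E leb mu mI mMD).
  by apply: lte_mul_pinfty => //; rewrite ge0_fin_numE.
- apply: measurable_funTS; apply: continuous_measurable_time_rV.
  by apply: smooth_continuous; case: Tpsi.
Qed.

Lemma tslice_L2 g b : L0 g -> L2_on leb I b -> L (slice1 leb I g b).
Proof. exact: (slice1_L2 mI mMD MDoo). Qed.

Lemma tslice_ip g b f : L0 g -> L2_on leb I b -> L f ->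
  ip (slice1 leb I g b) f = ip0 g (fun p => b p.1 * f p.2).
Proof. exact: (slice1_ip mI mMD MDoo). Qed.

Lemma tslice_ip1 g f : L0 g -> L f ->
  ip0 g (fun p => f p.2) = ip (slice1 leb I g (cst 1)) f.
Proof. exact: (ip_slice1 mI mMD Ioo MDoo). Qed.

Lemma xslice_L2 g f : L0 g -> L f -> L2_on leb I (slice2 mu (M `&` D) g f).
Proof. exact: (slice2_L2 mI mMD Ioo). Qed.

Lemma xslice_ip g b f : L0 g -> L2_on leb I b -> L f ->
  ip_on leb I (slice2 mu (M `&` D) g f) b = ip0 g (fun p => b p.1 * f p.2).
Proof. exact: (slice2_ip mI mMD Ioo). Qed.

Lemma xslice_ip1 g b : L0 g -> L2_on leb I b ->
  ip0 g (fun p => b p.1) = ip_on leb I (slice2 mu (M `&` D) g (cst 1)) b.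
Proof. exact: (ip_slice2 mI mMD Ioo MDoo). Qed.

Lemma lift_time_L2 b : L2_on leb I b -> L0 (fun p => b p.1).
Proof. exact: (L2_lift1 mI mMD MDoo). Qed.

Lemma lift_space_L2 f : L f -> L0 (fun p => f p.2).
Proof. exact: (L2_lift2 mI mMD Ioo). Qed.

Lemma L2_M0_tensor b f : L2_on leb I b -> L f -> L0 (fun p => b p.1 * f p.2).
Proof. exact: (L2_tensor mI mMD). Qed.

Lemma L2_M_psd : psd_form L ip.
Proof. exact: L2_on_psd. Qed.

Lemma L2_M0_psd : psd_form L0 ip0.
Proof. exact: (L2_on_psd (leb \x mu)%E). Qed.

(** The fundamental lemma in space, applied to the slice of g against b, allows any square
    integrable space factor; the one in time then allows any time factor; and rectangles generate
    the product sigma-algebra. *)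
Lemma M0_fundamental_product g : L0 g ->
  (forall b psi, T1 b -> T psi -> ip0 g (fun p => b p.1 * psi p.2) = 0) ->
  ip0 g g = 0.
Proof.
move=> Lg orth.
have H1 b f : T1 b -> L f -> ip0 g (fun p => b p.1 * f p.2) = 0.
  move=> Tb Lf; have Lb := time_test_L2 tau_gt0 Tb.
  have Lh := tslice_L2 Lg Lb.
  have h0 : ip (slice1 leb I g b) (slice1 leb I g b) = 0.
    apply: (fundamental_lemma hM hD Lh) => psi Tpsi.
    by rewrite (tslice_ip Lg Lb (test_L2 hM hD Tpsi)) orth.
  rewrite -(tslice_ip Lg Lb Lf).
  exact: (psd_null L2_M_psd Lh Lf h0).
have H2 a f : L2_on leb I a -> L f -> ip0 g (fun p => a p.1 * f p.2) = 0.
  move=> La Lf; have Lk := xslice_L2 Lg Lf.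
  have k0 : ip_on leb I (slice2 mu (M `&` D) g f) (slice2 mu (M `&` D) g f) = 0.
    apply: (time_fundamental_lemma tau_gt0 Lk) => b Tb.
    by rewrite (xslice_ip Lg (time_test_L2 tau_gt0 Tb) Lf) H1.
  rewrite -(xslice_ip Lg La Lf).
  exact: (psd_null (L2_on_psd leb I) Lk La k0).
have mIM : measurable (I `*` (M `&` D)) by exact: measurableX.
have L1c : L0 (cst 1).
  exact: (L2_lift1 mI mMD MDoo (L2_on_cst 1 mI Ioo)).
have ig : (leb \x mu)%E.-integrable (I `*` (M `&` D)) (EFin \o g).
  have := ip_on_integrable mIM Lg L1c.
  by apply: eq_integrable => // p _ /=; rewrite mulr1.
apply: (ae_ip_on mIM Lg).
have rect0 A B : measurable A -> measurable B ->
    (\int[(leb \x mu)%E]_(p in (I `*` (M `&` D)) `&` (A `*` B)) (g p)%:E = 0)%E.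
  move=> mA mB.
  have LA : L2_on leb I (\1_A : _ -> R).
    apply: (L2_on_bounded mI Ioo (C := 1)).
      exact: measurable_indic.
    by move=> t _; rewrite indicE; case: (_ \in _); rewrite ?normr1 ?normr0.
  have LB : L (\1_B : _ -> R).
    apply: (L2_on_bounded mMD MDoo (C := 1)).
      exact: measurable_indic.
    by move=> t _; rewrite indicE; case: (_ \in _); rewrite ?normr1 ?normr0.
  have := H2 _ _ LA LB.
  have iprod := ip_on_integrable mIM Lg (L2_tensor mI mMD LA LB).
  rewrite /ip_M0 /Rintegral => h0.
  have {h0} : (\int[(leb \x mu)%E]_(p in I `*` (M `&` D)) (g p * (\1_A p.1 * \1_B p.2))%:E = 0)%E.
    by rewrite -[LHS]fineK ?h0// integrable_fin_num.
  move=> <-; rewrite integral_mkcondr; apply: eq_integral => p _.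
  rewrite /patch in_setX !indicE.
  by case: (p.1 \in A); case: (p.2 \in B); rewrite /= ?(mulr0,mul0r,mulr1).
suff : ae_eq (leb \x mu)%E (I `*` (M `&` D)) (EFin \o g) (cst 0%E).
  by apply: filterS => p h /h [].
apply: (integral_pi_system mIM ig (measurable_prod_measurableType _ _)).
- move=> _ _ [A mA [B mB <-]] [A' mA' [B' mB' <-]].
  exists (A `&` A'); first exact: measurableI.
  exists (B `&` B'); first exact: measurableI.
  by rewrite setXI.
- have := rect0 setT setT measurableT measurableT.
  by rewrite setXTT setIT.
- by move=> _ [A mA [B mB <-]]; exact: rect0.
Qed.

Lemma test_M0_tensor b psi : T1 b -> T psi -> T0 (fun p => b p.1 * psi p.2).
Proof. by move=> Tb Tpsi; exact: test_tensor. Qed.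

Lemma M0_fundamental g : L0 g -> (forall psi, T0 psi -> ip0 g psi = 0) ->
  ip0 g g = 0.
Proof.
move=> Lg orth; apply: M0_fundamental_product => // b psi Tb Tpsi.
exact/orth/test_M0_tensor.
Qed.

End space_time_tests.

(** * Weak derivatives *)

Section psd_constructions.
Context {R : realType} {U : lmodType R}.
Implicit Types (D : set U) (B : U -> U -> R).

Lemma psd_formD D B1 B2 (a : R) : 0 <= a -> psd_form D B1 -> psd_form D B2 ->
  psd_form D (fun f g => a * B1 f g + B2 f g).
Proof.
move=> a0 p1 p2; split.
- exact: psd0 p1.
- exact: psd_closed p1.
- by move=> f g Df Dg; rewrite (psdC p1)// (psdC p2).
- move=> c f g h Df Dg Dh; rewrite (psd_linear p1)// (psd_linear p2)//.
  by ring.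
- by move=> f Df; rewrite addr_ge0// ?mulr_ge0// ?(psd_ge0 p1)// (psd_ge0 p2).
Qed.

Lemma psd_form_eq D B1 B2 : (forall f g, D f -> D g -> B1 f g = B2 f g) ->
  psd_form D B1 -> psd_form D B2.
Proof.
move=> E p1; split.
- exact: psd0 p1.
- exact: psd_closed p1.
- by move=> f g Df Dg; rewrite -!E// (psdC p1).
- move=> c f g h Df Dg Dh; rewrite -!E// ?(psd_linear p1)//.
  exact: (psd_closed p1).
- by move=> f Df; rewrite -E// (psd_ge0 p1).
Qed.

End psd_constructions.

Section weak_derivatives.
Context {R : realType} {V : normedModType R}.
Local Notation fct := (V -> R).
Variables (L : set fct) (ip : fct -> fct -> R) (T : set fct).
Hypothesis psdL : psd_form L ip.
Hypothesis TL : T `<=` L.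
Hypothesis Tsmooth : T `<=` smooth.
Hypothesis TD : forall u psi, T psi -> T ('D_u psi).
Hypothesis fund : forall g, L g -> (forall psi, T psi -> ip g psi = 0) -> ip g g = 0.
Local Notation wd := (is_weak_derivative L ip T).
Local Notation W := (weak_derivative L ip T).
Local Notation H1 := (sobolev1 L ip T).
Implicit Types (f g h k : fct) (u w : V).

Lemma wd_unique u f g k : wd u f g -> wd u f k -> ip (g - k) (g - k) = 0.
Proof.
move=> [Lg hg] [Lk hk]; apply: fund => [|psi Tpsi]; first exact: (psdB_closed psdL).
rewrite (psdBl psdL)//; last exact: TL.
by apply/eqP; rewrite subr_eq0 -eqr_opp -hg// hk.
Qed.

Lemma wd_linear (c : R) u f g h k : L f -> L h -> wd u f g -> wd u h k ->
  wd u (c *: f + h) (c *: g + k).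
Proof.
move=> Lf Lh [Lg hg] [Lk hk]; split; first exact: (psd_closed psdL).
move=> psi Tpsi; have Lpsi := TL Tpsi; have LD := TL (TD u Tpsi).
by rewrite !(psd_linear psdL)// hg// hk// opprD mulrN.
Qed.

Lemma wd0 u : wd u 0 0.
Proof.
split; first exact: (psd0 psdL).
by move=> psi Tpsi; rewrite !(psd0l psdL) ?oppr0//; apply: TL => //; exact: TD.
Qed.

Lemma wd_dir (c : R) u w f g k : L f -> wd u f g -> wd w f k ->
  wd (c *: u + w) f (c *: g + k).
Proof.
move=> Lf [Lg hg] [Lk hk]; split; first exact: (psd_closed psdL).
move=> psi Tpsi; have Lpsi := TL Tpsi.
have Lu := TL (TD u Tpsi); have Lw := TL (TD w Tpsi).
have -> : 'D_(c *: u + w) psi = c *: 'D_u psi + 'D_w psi.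
  apply/funext => x; rewrite derive_smoothD ?derive_smoothZ//; exact: Tsmooth.
rewrite (psdDr psdL)//; last exact: (psdZ_closed psdL).
by rewrite (psdZr psdL)// (psd_linear psdL)// hg// hk// opprD mulrN.
Qed.

Lemma wd_dir0 f : L f -> wd 0 f 0.
Proof.
move=> Lf; split; first exact: (psd0 psdL).
move=> psi Tpsi; have -> : 'D_0 psi = 0.
  apply/funext => x; have := derive_smoothZ x 0 0 (Tsmooth Tpsi).
  by rewrite !scale0r.
by rewrite (psd0r psdL)// (psd0l psdL) ?oppr0//; exact: TL.
Qed.

Lemma wd_dir_sum n (b : 'I_n -> V) (c : 'I_n -> R) f (g : 'I_n -> fct) : L f ->
  (forall i, wd (b i) f (g i)) -> wd (\sum_i c i *: b i) f (\sum_i c i *: g i).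
Proof.
move=> Lf hg; elim/big_ind2 : _ => [|u g1 w g2 h1 h2|i _].
- exact: wd_dir0.
- by have := wd_dir 1 Lf h1 h2; rewrite !scale1r.
- by have := wd_dir (c i) Lf (hg i) (wd_dir0 Lf); rewrite !addr0.
Qed.

Lemma wd_null u f f' g : L f -> L f' -> ip (f - f') (f - f') = 0 ->
  wd u f g -> wd u f' g.
Proof.
move=> Lf Lf' ff' [Lg hg]; split => // psi Tpsi; rewrite -hg//.
by apply/esym; apply: (psd_nullB psdL) => //; apply/TL/TD.
Qed.

Lemma H1_L f : H1 f -> L f.
Proof. by case. Qed.

Lemma H1_wd u f : H1 f -> wd u f (W u f).
Proof. by move=> [_ /(_ u) hf]; rewrite /weak_derivative; exact: xgetPex hf. Qed.

Lemma W_L u f : H1 f -> L (W u f).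
Proof. by move=> Hf; have [] := H1_wd u Hf. Qed.

(** [W u f] is an arbitrary choice, but its pairings are not: any explicit weak derivative may
    replace it. *)
Lemma wd_ip u f g k : H1 f -> L k -> wd u f g -> ip (W u f) k = ip g k.
Proof.
move=> Hf Lk hg; apply: (psd_nullB psdL) => //; first exact: W_L.
  by have [] := hg.
exact: wd_unique (H1_wd u Hf) hg.
Qed.

Lemma wd_ip2 u w f g h k : H1 f -> H1 h -> wd u f g -> wd w h k ->
  ip (W u f) (W w h) = ip g k.
Proof.
move=> Hf Hh hg hk; rewrite (wd_ip Hf (W_L w Hh) hg).
have [Lg _] := hg; have [Lk _] := hk.
rewrite (psdC psdL Lg (W_L w Hh)) (wd_ip Hh Lg hk).
exact: (psdC psdL).
Qed.

Lemma H1_linear (c : R) f h : H1 f -> H1 h -> H1 (c *: f + h).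
Proof.
move=> Hf Hh; split.
  by apply: (psd_closed psdL); exact: H1_L.
move=> u; exists (c *: W u f + W u h).
by apply: wd_linear; [exact: H1_L|exact: H1_L|exact: H1_wd|exact: H1_wd].
Qed.

Lemma wd_combination u (c : R) f h : H1 f -> H1 h ->
  wd u (c *: f + h) (c *: W u f + W u h).
Proof.
by move=> Hf Hh; apply: wd_linear; [exact: H1_L|exact: H1_L|exact: H1_wd|exact: H1_wd].
Qed.

Lemma H1_0 : H1 0.
Proof.
by split; [exact: (psd0 psdL)|move=> u; exists 0; exact: wd0].
Qed.

Variables (K : finType) (b : K -> V) (c : K -> K -> fct).
Hypothesis cL : forall i j f, L f -> L (fun x => c i j x * f x).
Hypothesis cC : forall i j f g, L f -> L g ->
  ip (fun x => c i j x * f x) g = ip (fun x => c j i x * f x) g.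
Hypothesis cA : forall i j f g,
  ip (fun x => c i j x * f x) g = ip f (fun x => c i j x * g x).
Hypothesis c_ge0 : forall p : K -> fct, (forall i, L (p i)) ->
  0 <= \sum_i \sum_j ip (fun x => c i j x * p i x) (p j).

(** An abstract gradient form with the sums outside the integrals, so that each weak derivative
    occurs in a pairing where it can be exchanged for another one. *)
Definition energy f h :=
  \sum_i \sum_j ip (fun x => c i j x * W (b i) f x) (W (b j) h).

Lemma energy_wd f h (g k : K -> fct) : H1 f -> H1 h ->
  (forall i, wd (b i) f (g i)) -> (forall i, wd (b i) h (k i)) ->
  energy f h = \sum_i \sum_j ip (fun x => c i j x * g i x) (k j).
Proof.
move=> Hf Hh hg hk; apply: eq_bigr => i _; apply: eq_bigr => j _.
have Lg := (hg i).1; have Lk := (hk j).1.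
rewrite cA (wd_ip Hf _ (hg i)); last exact/cL/W_L.
have cLg := cL i j Lg.
rewrite -cA (psdC psdL cLg (W_L (b j) Hh)) (wd_ip Hh cLg (hk j)).
exact: (psdC psdL).
Qed.

Lemma energy_psd : psd_form H1 energy.
Proof.
split.
- exact: H1_0.
- exact: H1_linear.
- move=> f h Hf Hh; rewrite /energy exchange_big; apply: eq_bigr => j _ /=.
  apply: eq_bigr => i _; have Lf := W_L (b i) Hf; have Lh := W_L (b j) Hh.
  by rewrite cA (psdC psdL Lf (cL i j Lh)) cC.
- move=> a f h g Hf Hh Hg.
  rewrite (energy_wd (H1_linear a Hf Hh) Hg
    (fun i => wd_combination (b i) a Hf Hh) (fun i => H1_wd (b i) Hg)).
  rewrite /energy mulr_sumr -big_split; apply: eq_bigr => i _ /=.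
  rewrite mulr_sumr -big_split; apply: eq_bigr => j _ /=.
  have Lf := W_L (b i) Hf; have Lh := W_L (b i) Hh; have Lg := W_L (b j) Hg.
  have cLg := cL i j Lg.
  by rewrite cA (psd_linear psdL)// -!cA.
- by move=> f Hf; apply: c_ge0 => i; exact: W_L.
Qed.

End weak_derivatives.

Section Rintegral_sum.
Context d (T : measurableType d) (R : realType) (mu : {measure set T -> \bar R}).

Lemma integrable_sumR (A : set T) (I : Type) (r : seq I) (f : I -> T -> R) :
  measurable A -> (forall i, mu.-integrable A (EFin \o f i)) ->
  mu.-integrable A (fun x => (\sum_(i <- r) f i x)%:E).
Proof.
move=> mA intf; elim: r => [|i r Ir].
  by under eq_fun do rewrite big_nil; exact: integrable0.
under eq_fun do rewrite big_cons EFinD.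
exact: integrableD (intf i) Ir.
Qed.

Lemma Rintegral_sum (A : set T) (I : Type) (r : seq I) (f : I -> T -> R) :
  measurable A -> (forall i, mu.-integrable A (EFin \o f i)) ->
  \int[mu]_(x in A) (\sum_(i <- r) f i x) = \sum_(i <- r) \int[mu]_(x in A) f i x.
Proof.
move=> mA intf; elim: r => [|i r IH].
  under eq_Rintegral do rewrite big_nil.
  by rewrite big_nil Rintegral_cst// mul0r.
under eq_Rintegral do rewrite big_cons.
rewrite big_cons RintegralD//; first by rewrite IH.
exact: integrable_sumR.
Qed.

End Rintegral_sum.

(** * Sobolev functions on space-time and the two quadratic forms *)

Section sobolev_M0.
Context {R : realType} {d : nat}.
Local Notation V := 'rV[R]_d.
Variables (tau : R) (tau_gt0 : 0 < tau).
Local Notation I := (`[0, tau]%classic : set (measurableTypeR R)).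
Local Notation leb := (@lebesgue_measure R).
Local Notation mu := (lebesgue_rV d).
Variables (G M D : set V).
Hypotheses (hM : flat_manifold G M) (hD : fundamental_domain G D).
Let hG := flat_lattice hM.
Let mMD := flat_domain_measurable hM hD.
Let MDoo := flat_measure_lt_pinfty hM hD.
Let mI := measurable_time tau.
Let Ioo := time_finite tau_gt0.
Local Notation L0 := (L2_M0 tau M D).
Local Notation ip0 := (ip_M0 tau M D).
Local Notation L := (L2_M M D).
Local Notation ip := (ip_M M D).
Local Notation T0 := (test_M0 tau G M).
Local Notation T := (test_function G M).
Local Notation wd := (is_weak_derivative L ip T).
Local Notation W := (weak_derivative L ip T).
Local Notation wd0 := (is_weak_derivative L0 ip0 T0).
Local Notation W0 := (weak_derivative L0 ip0 T0).
Local Notation H1 := (H1_M G M D).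
Local Notation H10 := (H1_M0 tau G M D).
Local Notation A0 := (I `*` (M `&` D)).

Lemma test_M_L2 : T `<=` L. Proof. by move=> psi; exact: test_L2. Qed.
Lemma test_M_derive u psi : T psi -> T ('D_u psi). Proof. exact: test_derive. Qed.
Lemma test_M0_sub_L2 : T0 `<=` L0.
Proof. by move=> psi; exact: (test_M0_L2 tau_gt0 hM hD). Qed.
Lemma test_M0_smooth : T0 `<=` smooth. Proof. by move=> psi; exact: test_smooth. Qed.
Lemma test_M0_derive u psi : T0 psi -> T0 ('D_u psi). Proof. exact: test_derive. Qed.
Let psdL := L2_M_psd M D.
Let psdL0 := L2_M0_psd tau M D.
Let fund0 := @M0_fundamental R d tau tau_gt0 G M D hM hD.

Lemma time_cst_L2 (c : R) : L2_on leb I (cst c).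
Proof. exact: L2_on_cst. Qed.

(** For fixed x the time integral of the time derivative of a test function is 0, the slice being a
    test function in time. *)
Lemma lift_wd_time f : L f -> wd0 (1, 0) (fun p => f p.2) 0.
Proof.
move=> Lf; split; first exact: (psd0 psdL0).
move=> psi Tpsi; have TD := test_M0_derive (1, 0) Tpsi.
have LD := test_M0_sub_L2 TD; have Lpsi := test_M0_sub_L2 Tpsi.
have Lf0 := lift_space_L2 tau_gt0 hM hD Lf.
rewrite (psd0l psdL0)// oppr0 (psdC psdL0)// (tslice_ip1 tau_gt0 hM hD)//.
have -> : slice1 leb I ('D_(1, 0) psi) (cst 1) = 0.
  apply/funext => x; rewrite /slice1 /ip_on.
  under eq_Rintegral do rewrite mulr1 -derive_slice_time.
  apply: time_test_derive_integral => //.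
  exact: (@test_slice_time R V [set 0] _ G M psi x (lattice0 hG) Tpsi).
exact: (psd0l psdL).
Qed.

(** At a fixed time a test function on space-time is one on M, to which the weak derivative of f
    applies; then integrate over time. *)
Lemma lift_wd_space f u g : L f -> wd u f g ->
  wd0 (0, u) (fun p => f p.2) (fun p => g p.2).
Proof.
move=> Lf [Lg hg]; split; first exact: (lift_space_L2 tau_gt0 hM hD).
move=> psi Tpsi; have TD := test_M0_derive (0, u) Tpsi.
have LD := test_M0_sub_L2 TD; have Lpsi := test_M0_sub_L2 Tpsi.
have Lf0 := lift_space_L2 tau_gt0 hM hD Lf.
have Lg0 := lift_space_L2 tau_gt0 hM hD Lg.
have L1 := time_cst_L2 1.
have E h k : L0 h -> L k ->
    ip0 (fun p => k p.2) h = ip_on leb I (slice2 mu (M `&` D) h k) (cst 1).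
  move=> Lh Lk; rewrite (psdC psdL0)//; last exact: (lift_space_L2 tau_gt0 hM hD).
  rewrite (xslice_ip tau_gt0 hM hD)//.
  by congr (ip0 _ _); apply/funext => p; rewrite mul1r.
rewrite !E//.
have -> : slice2 mu (M `&` D) ('D_(0, u) psi) f = - slice2 mu (M `&` D) psi g.
  apply/funext => t; have Tt := test_slice t (erefl : [set 0] (0 : R)) Tpsi.
  have h := hg _ Tt.
  rewrite (psdC psdL Lf (test_M_L2 (test_M_derive u Tt))) in h.
  rewrite (psdC psdL Lg (test_M_L2 Tt)) in h.
  transitivity (ip ('D_u (fun x => psi (t, x))) f); last exact: h.
  by apply: eq_Rintegral => x _; rewrite derive_slice.
have psd1 := L2_on_psd leb I.
have Ls := xslice_L2 tau_gt0 hM hD Lpsi Lg.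
by rewrite -scaleN1r (psdZl psd1)// mulN1r.
Qed.

Lemma H10_intro f g : L0 f -> wd0 (1, 0) f g ->
  (forall u, exists h, wd0 (0, u) f h) -> H10 f.
Proof.
move=> Lf hg hh; split => // -[t w]; have [h Hh] := hh w.
exists (t *: g + h).
have -> : (t, w) = t *: ((1 : R), (0 : V)) + (0, w).
  by apply: injective_projections; rewrite /= ?scaler0 ?addr0 ?add0r// -[t *: 1]/(t * 1) mulr1.
exact: (wd_dir psdL0 test_M0_sub_L2 test_M0_smooth test_M0_derive).
Qed.

Lemma lift_H1 f : H1 f -> H10 (fun p => f p.2).
Proof.
move=> Hf; have Lf := H1_L Hf; apply: (@H10_intro _ 0).
- exact: (lift_space_L2 tau_gt0 hM hD).
- exact: lift_wd_time.
- by move=> u; exists (fun p => W u f p.2); apply: lift_wd_space => //; exact: H1_wd.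
Qed.

Lemma lift_ip f h : L f -> L h ->
  ip0 (fun p => f p.2) (fun p => h p.2) = tau * ip f h.
Proof.
move=> Lf Lh; rewrite (tslice_ip1 tau_gt0 hM hD)//; last exact: (lift_space_L2 tau_gt0 hM hD).
rewrite -(psdZl psdL)//; congr (ip _ _); apply/funext => x.
rewrite /slice1 /ip_on; transitivity (\int[leb]_(t in I) cst (f x) t).
  by apply: eq_Rintegral => t _; rewrite mulr1.
rewrite Rintegral_cst// mulrC; congr (_ * _).
have E : lebesgue_measure `[0, tau] = tau%:E :> \bar R.
  by rewrite lebesgue_measure_itv/= lte_fin tau_gt0 sube0.
by transitivity (fine tau%:E); [congr fine; exact: E|].
Qed.

Section metric.
Variables (v phi : R -> V -> V).
Hypotheses (hv : velocity_field tau G v) (hphi : flow_map tau M v phi).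
Local Notation c := (metric_coef phi).
Local Notation space_dir i := ((0 : R), delta_mx ord0 i : V).

Let mA0 : measurable A0. Proof. exact: measurableX. Qed.

Lemma metric_coef_L2 i j f : L0 f -> L0 (fun p => c i j p * f p).
Proof.
move=> Lf; have [k _ hk] := metric_bounds hM hv hphi.
apply: (@L2_onM _ _ _ (leb \x mu)%E _ mA0 f (c i j) k) => //.
  apply: (measurable_metric_coef hM hv hphi) => //.
  by move=> p [Ip [Mp _]].
move=> [t x] [/= It [Mx _]]; rewrite in_itv/= in It.
by have [_ h _ _] := hk t x It Mx.
Qed.

Lemma metric_coefC_ip i j f g :
  ip0 (fun p => c i j p * f p) g = ip0 (fun p => c j i p * f p) g.
Proof.
have [k _ hk] := metric_bounds hM hv hphi.
apply: eq_Rintegral => -[t x] /set_mem [/= It [Mx _]]; rewrite in_itv/= in It.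
by have [_ _ -> _] := hk t x It Mx.
Qed.

Lemma metric_coef_move i j f g :
  ip0 (fun p => c i j p * f p) g = ip0 f (fun p => c i j p * g p).
Proof. exact: (ip_on_movel (leb \x mu)%E). Qed.

Lemma grad_dot_integral (p q : 'I_d -> R * V -> R) :
  (forall i, L0 (p i)) -> (forall i, L0 (q i)) ->
  (leb \x mu)%E.-integrable A0 (fun z => (grad_dot phi z.1 z.2
      (\row_i p i z) (\row_i q i z))%:E) /\
  \int[(leb \x mu)%E]_(z in A0)
    grad_dot phi z.1 z.2 (\row_i p i z) (\row_i q i z) =
  \sum_i \sum_j ip0 (fun z => c i j z * p i z) (q j).
Proof.
move=> Lp Lq.
have intij i j : (leb \x mu)%E.-integrable A0
    (fun z => (c i j z * p i z * q j z)%:E).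
  exact: (ip_on_integrable mA0 (metric_coef_L2 i j (Lp i)) (Lq j)).
have E z : grad_dot phi z.1 z.2 (\row_i p i z) (\row_i q i z) =
    \sum_i \sum_j c i j z * p i z * q j z.
  rewrite grad_dotE; apply: eq_bigr => i _; apply: eq_bigr => j _.
  by rewrite !mxE -surjective_pairing.
have inti i : (leb \x mu)%E.-integrable A0
    (fun z => (\sum_j c i j z * p i z * q j z)%:E).
  exact: (@integrable_sumR _ _ _ (leb \x mu)%E A0 _ _
    (fun j z => c i j z * p i z * q j z) mA0 (intij i)).
split.
  apply: (eq_integrable mA0 (fun z => (\sum_i \sum_j c i j z * p i z * q j z)%:E)).
    by move=> z _; congr EFin; rewrite -E.
  exact: (@integrable_sumR _ _ _ (leb \x mu)%E A0 _ _ (fun i z => \sum_j c i j z * p i z * q j z)).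
transitivity (\int[(leb \x mu)%E]_(z in A0) \sum_i \sum_j c i j z * p i z * q j z).
  by apply: eq_Rintegral => z _; exact: E.
rewrite (@Rintegral_sum _ _ _ (leb \x mu)%E A0 _ _ (fun i z => \sum_j c i j z * p i z * q j z))//.
apply: eq_bigr => i _.
exact: (@Rintegral_sum _ _ _ (leb \x mu)%E A0 _ _
  (fun j z => c i j z * p i z * q j z) mA0 (intij i)).
Qed.

Lemma metric_ge0 (p : 'I_d -> R * V -> R) : (forall i, L0 (p i)) ->
  0 <= \sum_i \sum_j ip0 (fun z => c i j z * p i z) (p j).
Proof.
move=> Lp; rewrite -(grad_dot_integral Lp Lp).2.
have [k k0 hk] := metric_bounds hM hv hphi.
apply: Rintegral_ge0 => -[t x] [/= It [Mx _]]; rewrite in_itv/= in It.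
have [_ _ _ h] := hk t x It Mx.
by rewrite -(pmulr_rge0 _ k0); apply: le_trans (h _); exact: dot_ge0.
Qed.

Lemma metric_elliptic : exists2 k, 0 < k & forall p : 'I_d -> R * V -> R,
  (forall i, L0 (p i)) ->
  \sum_i ip0 (p i) (p i) <= k * \sum_i \sum_j ip0 (fun z => c i j z * p i z) (p j).
Proof.
have [k k0 hk] := metric_bounds hM hv hphi; exists k => // p Lp.
have [ig <-] := grad_dot_integral Lp Lp.
have isq i : (leb \x mu)%E.-integrable A0 (fun z => (p i z * p i z)%:E).
  exact: (ip_on_integrable mA0 (Lp i) (Lp i)).
rewrite -(RintegralZl k mA0 ig).
rewrite -[leLHS](@Rintegral_sum _ _ _ (leb \x mu)%E A0 _ _ (fun i z => p i z * p i z))//.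
apply: le_Rintegral => //.
- exact: (@integrable_sumR _ _ _ (leb \x mu)%E A0 _ _ (fun i z => p i z * p i z)).
- exact: (integrableZl mA0 k ig).
move=> -[t x] [/= It [Mx _]]; rewrite in_itv/= in It.
have [_ _ _ h] := hk t x It Mx.
apply: le_trans (h _); rewrite dotE ler_sum// => i _.
by rewrite !mxE.
Qed.

Definition grad_form (f h : R * V -> R) : R :=
  energy L0 ip0 T0 (fun i : 'I_d => space_dir i) c f h.

Lemma grad_form_psd : psd_form H10 grad_form.
Proof.
apply: (energy_psd psdL0 test_M0_sub_L2 test_M0_derive fund0).
- exact: metric_coef_L2.
- by move=> i j f g _ _; exact: metric_coefC_ip.
- exact: metric_coef_move.
- exact: metric_ge0.
Qed.

Lemma grad_form_wd f h (g k : 'I_d -> R * V -> R) : H10 f -> H10 h ->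
  (forall i, wd0 (space_dir i) f (g i)) -> (forall i, wd0 (space_dir i) h (k i)) ->
  grad_form f h = \sum_i \sum_j ip0 (fun x => c i j x * g i x) (k j).
Proof.
apply: (energy_wd psdL0 test_M0_sub_L2 fund0); first exact: metric_coef_L2.
exact: metric_coef_move.
Qed.

Lemma time_form_psd : psd_form H10 (fun f h => ip0 (W0 (1, 0) f) (W0 (1, 0) h)).
Proof.
split.
- exact: (H1_0 psdL0 test_M0_sub_L2 test_M0_derive).
- exact: (H1_linear psdL0 test_M0_sub_L2 test_M0_derive).
- by move=> f h Hf Hh; apply: (psdC psdL0); exact: W_L.
- move=> a f h g Hf Hh Hg; rewrite -(psd_linear psdL0)//; try exact: W_L.
  apply: (wd_ip psdL0 test_M0_sub_L2 fund0); [|exact: W_L|].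
    exact: (H1_linear psdL0 test_M0_sub_L2 test_M0_derive).
  exact: (wd_combination psdL0 test_M0_sub_L2 test_M0_derive).
- by move=> f Hf; apply: (psd_ge0 psdL0); exact: W_L.
Qed.

(** Isolates the dependence on [a] in the time term. *)
Lemma inflated_formE a f h : H10 f -> H10 h ->
  inflated_form tau G M D phi a f h =
  a ^+ 2 * ip0 (W0 (1, 0) f) (W0 (1, 0) h) + grad_form f h.
Proof.
move=> Hf Hh.
have Lf u : L0 (W0 u f) by exact: W_L.
have Lh u : L0 (W0 u h) by exact: W_L.
have [ig igE] := grad_dot_integral (fun i => Lf (space_dir i)) (fun i => Lh (space_dir i)).
rewrite /grad_form /energy -igE.
have it := ip_on_integrable mA0 (Lf (1, 0)) (Lh (1, 0)).
rewrite [ip0 _ _](_ : _ = \int[(leb \x mu)%E]_(z in A0) (W0 (1, 0) f z * W0 (1, 0) h z))//.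
rewrite -(RintegralZl (a ^+ 2) mA0 it) -RintegralD//; last first.
  exact: (integrableZl mA0 (a ^+ 2) it).
apply: eq_Rintegral => z _; rewrite mulrA; congr (_ + _).
Qed.

Lemma inflated_form_psd a : psd_form H10 (inflated_form tau G M D phi a).
Proof.
apply: (psd_form_eq (B1 := fun f h => a ^+ 2 * ip0 (W0 (1, 0) f) (W0 (1, 0) h) + grad_form f h)).
  by move=> f h Hf Hh; rewrite inflated_formE.
exact: (psd_formD (sqr_ge0 a) time_form_psd grad_form_psd).
Qed.

(** By Fubini the time average of the Dirichlet forms is an integral over space-time, so the dynamic
    form inherits symmetry and positivity from [grad_form]. *)
Lemma dynamic_form_lift f h : H1 f -> H1 h ->
  dynamic_form tau G M D phi f h =
  tau^-1 * grad_form (fun p => f p.2) (fun p => h p.2).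
Proof.
move=> Hf Hh; have Lf := H1_L Hf; have Lh := H1_L Hh.
rewrite (grad_form_wd (lift_H1 Hf) (lift_H1 Hh)
  (fun i => lift_wd_space Lf (H1_wd _ Hf)) (fun i => lift_wd_space Lh (H1_wd _ Hh))).
have Lft i : L0 (fun p => W (delta_mx ord0 i) f p.2).
  by apply: (lift_space_L2 tau_gt0 hM hD); exact: W_L.
have Lht i : L0 (fun p => W (delta_mx ord0 i) h p.2).
  by apply: (lift_space_L2 tau_gt0 hM hD); exact: W_L.
have [ig <-] := grad_dot_integral Lft Lht.
by have [_ <-] := fubini_slice2 mI mMD ig.
Qed.

Lemma dynamic_form_psd : psd_form H1 (dynamic_form tau G M D phi).
Proof.
apply: (psd_form_eq (B1 := fun f h => tau^-1 * grad_form (fun p => f p.2) (fun p => h p.2))).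
  by move=> f h Hf Hh; rewrite dynamic_form_lift.
have pg := grad_form_psd; split.
- exact: (H1_0 psdL test_M_L2 test_M_derive).
- exact: (H1_linear psdL test_M_L2 test_M_derive).
- move=> f h Hf Hh.
  exact: (congr1 (fun x => tau^-1 * x) (psdC pg (lift_H1 Hf) (lift_H1 Hh))).
- move=> a f h g Hf Hh Hg; rewrite (mulrCA a) -mulrDr.
  exact: (congr1 (fun x => tau^-1 * x)
    (psd_linear pg a (lift_H1 Hf) (lift_H1 Hh) (lift_H1 Hg))).
- move=> f Hf; apply: mulr_ge0; first by rewrite invr_ge0 ltW.
  exact: (psd_ge0 pg (lift_H1 Hf)).
Qed.

End metric.
End sobolev_M0.

(** * Averages over time and space *)

Section averaging.
Context {R : realType} {d : nat}.
Local Notation V := 'rV[R]_d.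
Variables (tau : R) (tau_gt0 : 0 < tau).
Local Notation I := (`[0, tau]%classic : set (measurableTypeR R)).
Local Notation leb := (@lebesgue_measure R).
Local Notation mu := (lebesgue_rV d).
Local Notation T1 := (test_function [set 0] (`[0, tau]%classic : set R)).
Variables (G M D : set V).
Hypotheses (hM : flat_manifold G M) (hD : fundamental_domain G D).
Let hG := flat_lattice hM.
Local Notation L0 := (L2_M0 tau M D).
Local Notation ip0 := (ip_M0 tau M D).
Local Notation L := (L2_M M D).
Local Notation ip := (ip_M M D).
Local Notation T0 := (test_M0 tau G M).
Local Notation wd0 := (is_weak_derivative L0 ip0 T0).
Local Notation W0 := (weak_derivative L0 ip0 T0).
Local Notation H1 := (H1_M G M D).
Local Notation H10 := (H1_M0 tau G M D).
Local Notation L1 := (L2_on leb I).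
Local Notation ip1 := (ip_on leb I).
Let psdL := L2_M_psd M D.
Let psdL0 := L2_M0_psd tau M D.
Let psd1 := L2_on_psd leb I.
Let TL := @test_M_L2 R d G M D hM hD.
Let TL0 := test_M0_sub_L2 tau_gt0 hM hD.
Let TD := @test_M_derive R d G M.
Let TD0 := @test_M0_derive R d tau G M.
Let fundM := @fundamental_lemma R d G M D hM hD.
Let fund0 := @M0_fundamental R d tau tau_gt0 G M D hM hD.
Let liftT := @lift_time_L2 R d tau G M D hM hD.
Let liftX := @lift_space_L2 R d tau tau_gt0 G M D hM hD.
Let tsL2 := @tslice_L2 R d tau G M D hM hD.
Let tsip := @tslice_ip R d tau G M D hM hD.
Let xsL2 := @xslice_L2 R d tau tau_gt0 G M D hM hD.
Let xsip := @xslice_ip R d tau tau_gt0 G M D hM hD.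
Let tensL2 := @L2_M0_tensor R d tau G M D hM hD.
Let cstL := @cst_L2 R d G M D hM hD.
Let testT1 := @time_test_L2 R tau tau_gt0.

(** The space factor may be any square integrable function, for instance a constant, which need not
    be a test function: the sum of the two slices is orthogonal to all test functions on M, hence
    null. *)
Lemma wd_time_tensor F K b f : L0 F -> wd0 (1, 0) F K -> T1 b -> L f ->
  ip0 F (fun p => 'D_1 b p.1 * f p.2) = - ip0 K (fun p => b p.1 * f p.2).
Proof.
move=> LF [LK hK] Tb Lf; have sb := test_smooth Tb.
have Lb := testT1 Tb.
have Ldb := testT1 (test_derive (1 : R) Tb).
pose h := slice1 leb I F ('D_1 b); pose k := slice1 leb I K b.
have Lh : L h by exact: tsL2.
have Lk : L k by exact: tsL2.
have hk0 : ip (h + k) (h + k) = 0.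
  apply: fundM => [|psi Tpsi]; first exact: (psdD_closed psdL).
  have Lpsi := TL Tpsi.
  rewrite (psdDl psdL)// (tsip LF Ldb Lpsi).
  rewrite (tsip LK Lb Lpsi) -derive_tensor_time//.
  by rewrite hK ?addNr//; exact: test_M0_tensor.
rewrite -(tsip LF Ldb Lf) -(tsip LK Lb Lf).
apply/eqP; rewrite -subr_eq0 opprK -(psdDl psdL)//.
by apply/eqP/(psd_null psdL) => //; exact: (psdD_closed psdL).
Qed.

Lemma temp_wd a a' : L1 a -> L1 a' ->
  (forall b, T1 b -> ip1 a ('D_1 b) = - ip1 a' b) ->
  wd0 (1, 0) (fun p => a p.1) (fun p => a' p.1).
Proof.
move=> La La' haa'; split; first exact: liftT.
move=> psi Tpsi; have LD := TL0 (TD0 (1, 0) Tpsi); have Lpsi := TL0 Tpsi.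
have E h k : L0 h -> L1 k ->
    ip0 (fun p => k p.1) h = ip (slice1 leb I h k) (cst 1).
  move=> Lh Lk; rewrite (psdC psdL0)//; last exact: liftT.
  rewrite (tsip Lh Lk (cstL 1)).
  by congr (ip0 _ _); apply/funext => p; rewrite mulr1.
rewrite !E//.
have -> : slice1 leb I ('D_(1, 0) psi) a = - slice1 leb I psi a'.
  apply/funext => x.
  have Tx := @test_slice_time R V [set 0] _ G M psi x (lattice0 hG) Tpsi.
  have h := haa' _ Tx.
  rewrite (psdC psd1 La (testT1 (test_derive (1 : R) Tx))) in h.
  rewrite (psdC psd1 La' (testT1 Tx)) in h.
  transitivity (ip1 ('D_1 (fun t => psi (t, x))) a); last exact: h.
  by apply: eq_Rintegral => t _; rewrite derive_slice_time.
have Ls := tsL2 Lpsi La'.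
by rewrite -scaleN1r (psdZl psdL)// ?mulN1r//; exact: cstL.
Qed.

(** The integral over M of a derivative of a test function vanishes at each time. *)
Lemma temp_wd_space a u : L1 a -> wd0 (0, u) (fun p => a p.1) 0.
Proof.
move=> La; split; first exact: (psd0 psdL0).
move=> psi Tpsi; have LD := TL0 (TD0 (0, u) Tpsi); have Lpsi := TL0 Tpsi.
rewrite (psd0l psdL0)// oppr0 (psdC psdL0)//; last exact: liftT.
rewrite (xslice_ip1 tau_gt0 hM hD)//.
have -> : slice2 mu (M `&` D) ('D_(0, u) psi) (cst 1) = 0.
  apply/funext => t; rewrite /slice2 /ip_on.
  have Tt := test_slice t (erefl : [set 0] (0 : R)) Tpsi.
  rewrite -[RHS](test_derive_integral hM hD u Tt).
  by apply: eq_Rintegral => x _; rewrite mulr1 derive_slice.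
exact: (psd0l psd1).
Qed.

Lemma temp_H1 a a' : L1 a -> L1 a' ->
  (forall b, T1 b -> ip1 a ('D_1 b) = - ip1 a' b) -> H10 (fun p => a p.1).
Proof.
move=> La La' haa'.
apply: (H10_intro tau_gt0 hM hD (g := fun p => a' p.1)).
- exact: liftT.
- exact: temp_wd.
- by move=> u; exists 0; exact: temp_wd_space.
Qed.

(* du Bois-Reymond: a test function b has the same moment as (int b) times a
   fixed unit bump, up to the derivative of a test function. *)
Lemma constant_in_time F : H10 F -> wd0 (1, 0) F 0 ->
  exists f, H1 f /\ ip0 (F - (fun p => f p.2)) (F - (fun p => f p.2)) = 0.
Proof.
move=> HF hF; have LF := H1_L HF.
have [th Tth th1] := time_unit_bump tau_gt0; have Lth := testT1 Tth.
pose f := slice1 leb I F th; have Lf : L f by exact: tsL2.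
have Lf0 := liftX Lf.
exists f; split.
  split => // u; have Lu : L0 (W0 (0, u) F) by exact: W_L.
  exists (slice1 leb I (W0 (0, u) F) th); split; first exact: tsL2.
  move=> psi Tpsi; have Lpsi := TL Tpsi.
  rewrite (tsip LF Lth (TL (TD u Tpsi))) (tsip Lu Lth Lpsi).
  rewrite -derive_tensor_space; last exact: test_smooth Tpsi.
  have [_ h] : wd0 (0, u) F (W0 (0, u) F) by exact: H1_wd.
  by apply: h; exact: test_M0_tensor.
apply: (M0_fundamental_product tau_gt0 hM hD); first exact: (psdB_closed psdL0).
move=> b psi Tb Tpsi; have Lb := testT1 Tb; have Lpsi := TL Tpsi.
have Lbp := tensL2 Lb Lpsi.
rewrite (psdBl psdL0)//.
pose B := \int[leb]_(t in I) b t.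
have lift_bpsi : ip0 (fun p => f p.2) (fun p => b p.1 * psi p.2) =
    ip0 F (fun p => (B *: th) p.1 * psi p.2).
  rewrite -tsip//.
  have -> : slice1 leb I (fun p => f p.2) b = B *: f.
    apply/funext => x; rewrite /slice1 /ip_on /= RintegralZl//.
      by rewrite mulrC.
    by apply: L2_time_integrable.
  rewrite (psdZl psdL)// tsip// -(psdZr psdL0)//; last first.
    exact: tensL2.
  congr (ip0 _ _); apply/funext => p.
  by rewrite -[LHS]/(B * (th p.1 * psi p.2)) -[RHS]/(B * th p.1 * psi p.2) mulrA.
have LBth : L1 (B *: th) by exact: (psdZ_closed psd1).
rewrite lift_bpsi -(psdBr psdL0)//; last exact: tensL2.
pose g := b - B *: th.
have Tg : T1 g.
  have [h1 h2 h3] := Tb; have [k1 k2 k3] := Tth; split.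
  - have := smoothD h1 (smoothZ (- B) k1); congr smooth.
    by apply/funext => t; rewrite /g !fctE scaleNr.
  - by move=> u t Gu; rewrite /g !fctE h2// k2.
  - move=> t ct; have : closure ([set t | b t != 0] `|` [set t | th t != 0]) t.
      move: ct; apply: closureS => s /=; rewrite /g !fctE => gs.
      have [bs|] := eqVneq (b s) 0; last by left.
      right; apply: contra_neq gs => ths.
      by rewrite bs ths scaler0 subr0.
    by rewrite closureU => -[/h3|/k3].
have g0 : \int[leb]_(t in I) g t = 0.
  rewrite /g RintegralB//.
  - by rewrite RintegralZl ?th1 ?mulr1 ?subrr//; exact: L2_time_integrable.
  - exact: L2_time_integrable.
  - exact: L2_time_integrable.
have [eta Teta etaE] := time_test_primitive tau_gt0 Tg g0.
transitivity (ip0 F (fun p => 'D_1 eta p.1 * psi p.2)).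
  congr (ip0 _ _); apply/funext => p.
  have -> : 'D_1 eta p.1 = g p.1 by exact: (congr1 (fun f => f p.1) etaE).
  by rewrite /g !fctE mulrBl.
rewrite (wd_time_tensor LF hF)// (psd0l psdL0) ?oppr0//.
by apply: tensL2 => //; exact: testT1.
Qed.

Lemma S0_spat_lift f : L f -> S0_spat tau M D (fun p => f p.2).
Proof.
move=> Lf; split; first exact: liftX.
move=> _ [g [Lg g0 ->]]; have Lg0 := liftT Lg.
rewrite (psdC psdL0)//; last exact: liftX.
rewrite (tslice_ip1 tau_gt0 hM hD)//.
have -> : slice1 leb I (fun p : R * V => g p.1) (cst 1) = 0.
  apply/funext => x; rewrite /slice1 /ip_on -[RHS]g0.
  by apply: eq_Rintegral => t _; rewrite mulr1.
exact: (psd0l psdL).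
Qed.

Local Notation vol := (ip (cst 1) (cst 1)).
Hypothesis vol_gt0 : 0 < vol.

Definition space_average (F : R * V -> R) : R -> R :=
  slice2 mu (M `&` D) F (cst vol^-1).

Lemma space_average_L2 F : L0 F -> L1 (space_average F).
Proof. by move=> LF; apply: xsL2 => //; exact: cstL. Qed.

Lemma space_average_ip F b : L0 F -> L1 b ->
  ip0 F (fun p => b p.1) = vol * ip1 (space_average F) b.
Proof.
move=> LF Lb; rewrite /space_average (xsip LF Lb (cstL _)).
have -> : (fun p : R * V => b p.1 * cst vol^-1 p.2) = vol^-1 *: (fun p => b p.1).
  by apply/funext => p; rewrite /= mulrC.
rewrite (psdZr psdL0)//; last exact: liftT.
by rewrite mulrA mulfV ?mul1r// gt_eqF.
Qed.

Lemma space_average_wd F K b : L0 F -> wd0 (1, 0) F K -> T1 b ->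
  ip1 (space_average F) ('D_1 b) = - ip1 (space_average K) b.
Proof.
move=> LF hK Tb; have [LK _] := hK.
have Lb := testT1 Tb.
have Ldb := testT1 (test_derive (1 : R) Tb).
have Lc := cstL vol^-1.
rewrite !xsip//.
exact: wd_time_tensor.
Qed.

Let L11 : L1 (cst 1). Proof. exact: (time_cst_L2 tau_gt0). Qed.

Lemma ip1_cst : ip1 (cst 1) (cst 1) = tau.
Proof.
rewrite /ip_on; transitivity (\int[leb]_(t in I) cst (1 : R) t).
  by apply: eq_Rintegral => t _; rewrite mulr1.
rewrite Rintegral_cst ?mul1r//.
have E : lebesgue_measure `[0, tau] = tau%:E :> \bar R.
  by rewrite lebesgue_measure_itv/= lte_fin tau_gt0 sube0.
by transitivity (fine tau%:E); [congr fine; exact: E|].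
Qed.

(** Read as a function on space-time, the orthogonal projection of [F] to [S0_temp]. *)
Definition centered_average F : R -> R :=
  space_average F - cst (tau^-1 * ip1 (space_average F) (cst 1)).

Let cstE (c : R) : cst c = c *: (cst 1 : R -> R).
Proof. by apply/funext => t; rewrite -[RHS]/(c * 1) mulr1. Qed.

Lemma centered_average_L2 F : L0 F -> L1 (centered_average F).
Proof.
move=> LF; apply: (psdB_closed psd1); first exact: space_average_L2.
exact: (time_cst_L2 tau_gt0).
Qed.

Lemma centered_average_mean F : L0 F -> ip1 (centered_average F) (cst 1) = 0.
Proof.
move=> LF; have La := space_average_L2 LF.
rewrite /centered_average cstE (psdBl psd1)//; last exact: (psdZ_closed psd1).
rewrite (psdZl psd1)// ip1_cst [_ * tau]mulrC mulrA mulfV ?gt_eqF// mul1r.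
exact: subrr.
Qed.

Lemma centered_average_temp F : L0 F -> S0_temp tau (fun p : R * V => centered_average F p.1).
Proof.
move=> LF; exists (centered_average F); split => //.
  exact: centered_average_L2.
rewrite -[RHS](centered_average_mean LF).
by apply: eq_Rintegral => t _; rewrite mulr1.
Qed.

Lemma centered_average_wd F K b : L0 F -> wd0 (1, 0) F K -> T1 b ->
  ip1 (centered_average F) ('D_1 b) = - ip1 (space_average K) b.
Proof.
move=> LF hK Tb; have La := space_average_L2 LF.
have Ldb := testT1 (test_derive (1 : R) Tb).
rewrite /centered_average cstE (psdBl psd1)//; last exact: (psdZ_closed psd1).
rewrite (psdZl psd1)// (space_average_wd LF hK Tb).
have -> : ip1 (cst 1) ('D_1 b) = 0.
  rewrite -[RHS](time_test_derive_integral tau_gt0 Tb).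
  by apply: eq_Rintegral => t _; rewrite mul1r.
by rewrite mulr0 subr0.
Qed.

Lemma centered_average_spat F : S0_spat tau M D F ->
  ip1 (centered_average F) (centered_average F) = 0.
Proof.
move=> [LF hF]; have La := space_average_L2 LF; have Lc := centered_average_L2 LF.
have h1 : ip1 (space_average F) (centered_average F) = 0.
  have := hF _ (centered_average_temp LF); rewrite space_average_ip//.
  by move/eqP; rewrite mulf_eq0 gt_eqF//= => /eqP.
rewrite {1}/centered_average cstE (psdBl psd1)//; last exact: (psdZ_closed psd1).
by rewrite (psdZl psd1)// h1 [ip1 (cst 1) _](psdC psd1)// centered_average_mean// mulr0 subr0.
Qed.

(** The average of a spatial function over M does not depend on time, so the average of its time
    derivative is weakly, hence almost everywhere, 0. *)
Lemma spat_time_derivative F g : S0_spat tau M D F -> H10 F -> L1 g ->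
  ip0 (W0 (1, 0) F) (fun p => g p.1) = 0.
Proof.
move=> SF HF Lg; have LF := H1_L HF.
have LW : L0 (W0 (1, 0) F) by exact: W_L.
have LaW := space_average_L2 LW.
rewrite space_average_ip//; apply/eqP; rewrite mulf_eq0; apply/orP; right; apply/eqP.
apply: (psd_null psd1) => //.
apply: (time_fundamental_lemma tau_gt0 LaW) => b Tb.
apply/eqP; rewrite -oppr_eq0 -(centered_average_wd LF (H1_wd _ HF) Tb); apply/eqP.
apply: (psd_null psd1).
- exact: centered_average_L2.
- exact: testT1 (test_derive (1 : R) Tb).
- exact: centered_average_spat.
Qed.

Lemma centered_average_H1 F : H10 F -> H10 (fun p => centered_average F p.1).
Proof.
move=> HF; have LF := H1_L HF.
have LW : L0 (W0 (1, 0) F) by exact: W_L.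
apply: (@temp_H1 _ (space_average (W0 (1, 0) F))).
- exact: centered_average_L2.
- exact: space_average_L2.
- by move=> b Tb; apply: centered_average_wd => //; exact: H1_wd.
Qed.

Lemma subtract_average_spat F : L0 F ->
  S0_spat tau M D (F - (fun p => centered_average F p.1)).
Proof.
move=> LF; have Lc := centered_average_L2 LF; have La := space_average_L2 LF.
have Lc0 := liftT Lc.
split; first exact: (psdB_closed psdL0).
move=> _ [g [Lg g0 ->]]; have Lg0 := liftT Lg.
rewrite (psdBl psdL0)// space_average_ip//.
have -> : ip0 (fun p => centered_average F p.1) (fun p => g p.1) =
    vol * ip1 (centered_average F) g.
  rewrite space_average_ip//; congr (_ * ip1 _ _); apply/funext => t.
  rewrite /space_average /slice2 /ip_on.
  transitivity (\int[mu]_(x in M `&` D) (centered_average F t * vol^-1 * (cst 1 x * cst 1 x))).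
    by apply: eq_Rintegral => x _; rewrite !mulr1.
  rewrite RintegralZl; last 2 first.
    exact: flat_domain_measurable hM hD.
    apply: ip_on_integrable; [exact: flat_domain_measurable hM hD|exact: cstL|exact: cstL].
  by rewrite -mulrA mulVf ?mulr1// gt_eqF.
rewrite /centered_average cstE (psdBl psd1)//; last exact: (psdZ_closed psd1).
rewrite (psdZl psd1)// [ip1 (cst 1) g](_ : _ = 0) ?mulr0 ?subr0 ?subrr//.
by rewrite -[RHS]g0; apply: eq_Rintegral => t _; rewrite mul1r.
Qed.

Section spat_temp.
Variables (v phi : R -> V -> V).
Hypotheses (hv : velocity_field tau G v) (hphi : flow_map tau M v phi).

(** The time term pairs the time derivative of a spatial function with a function of time alone, and
    the gradient term vanishes because the second argument has no space derivatives. *)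
Lemma spat_average_form a F H : S0_spat tau M D F -> H10 F -> H10 H ->
  inflated_form tau G M D phi a F (fun p => centered_average H p.1) = 0.
Proof.
move=> SF HF HH; have LH := H1_L HH.
have Hc := centered_average_H1 HH; have LW : L0 (W0 (1, 0) H) by exact: W_L.
have Lc := centered_average_L2 LH.
rewrite (inflated_formE hM hD hv hphi)//.
have hc : wd0 (1, 0) (fun p => centered_average H p.1)
    (fun p => space_average (W0 (1, 0) H) p.1).
  apply: temp_wd => //; first exact: space_average_L2.
  by move=> b Tb; apply: centered_average_wd => //; exact: H1_wd.
rewrite (wd_ip2 psdL0 TL0 fund0 HF Hc (H1_wd _ HF) hc).
rewrite spat_time_derivative//; last exact: space_average_L2.
rewrite mulr0 add0r.
rewrite (grad_form_wd tau_gt0 hM hD hv hphi HF Hc (fun i => H1_wd _ HF)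
  (fun i => temp_wd_space (delta_mx ord0 i) Lc)).
rewrite big1// => i _; rewrite big1// => j _; apply: (psd0r psdL0).
by apply: (metric_coef_L2 hM hD hv hphi); exact: W_L.
Qed.

End spat_temp.
End averaging.

(** * Comparison of eigenvalues *)

Section min_max.
Context {R : realType} {U : lmodType R}.
Variables (L dom : set U) (ip E : U -> U -> R).
Hypotheses (psdL : psd_form L ip) (psdE : psd_form dom E) (domL : dom `<=` L).
Variables (e : nat -> U) (s : nat -> R).
Hypothesis oe : orthonormal_seq L ip e.
Hypothesis dome : forall k, dom (e k).
Hypothesis eigen : forall k h, dom h -> E (e k) h = s k * ip (e k) h.
Hypothesis mono : forall i j, (i <= j)%N -> s i <= s j.

Lemma partial_sum_dom c N : dom (partial_sum e c N).
Proof. by apply: (psd_sum_closed psdE) => i; exact: dome. Qed.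

Lemma form_partial_sum_le (c : nat -> R) k : \sum_(i < k.+1) c i ^+ 2 = 1 ->
  E (partial_sum e c k.+1) (partial_sum e c k.+1) <= s k.
Proof.
move=> c1; rewrite (eigen_sum_form psdL psdE domL oe dome eigen).
rewrite -[leRHS]mulr1 -c1 mulr_sumr ler_sum// => i _.
by rewrite ler_wpM2r ?sqr_ge0// mono// -ltnS.
Qed.

(** Some unit combination of the first k + 1 eigenvectors satisfies the k constraints, and its form
    is at most [s k]. The lower bound [ht] is where another operator enters. *)
Lemma min_max k (g : 'I_k -> U) t : (forall j, L (g j)) ->
  (forall c, (forall j, ip (partial_sum e c k.+1) (g j) = 0) ->
    t * ip (partial_sum e c k.+1) (partial_sum e c k.+1) <=
    E (partial_sum e c k.+1) (partial_sum e c k.+1)) ->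
  t <= s k.
Proof.
move=> Lg ht; have [c [c1 hc]] := orthonormal_combination psdL oe Lg.
have := ht c hc; rewrite (partial_sum_sq psdL oe) c1 mulr1 => h.
exact: le_trans h (form_partial_sum_le c1).
Qed.

End min_max.

(** * Spectral bounds within an invariant subspace *)

Section invariant_subspace.
Context {R : realType} {U : lmodType R}.
Variables (L dom : set U) (ip E : U -> U -> R).
Hypotheses (psdL : psd_form L ip) (psdE : psd_form dom E) (domL : dom `<=` L).
Hypothesis complL : psd_complete L ip.
Variables (e : nat -> U) (s : nat -> R).
Hypothesis oe : orthonormal_seq L ip e.
Hypothesis dome : forall k, dom (e k).
Hypothesis eigen : forall k h, dom h -> E (e k) h = s k * ip (e k) h.
Hypothesis total : forall f, L f -> (forall k, ip f (e k) = 0) -> ip f f = 0.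
Variable S : set U.
Hypothesis SL : S `<=` L.
Hypothesis S_linear : forall c f g, S f -> S g -> S (c *: f + g).
Hypothesis splitS : forall h, dom h -> exists n, [/\ dom n, S (h - n),
  forall f, S f -> ip f n = 0 & forall f, S f -> dom f -> E f n = 0].
Variables (u : nat -> U) (sg : nat -> R).
Hypothesis ou : orthonormal_seq L ip u.
Hypothesis Su : forall k, S (u k).
Hypothesis domu : forall k, dom (u k).
Hypothesis eigenu : forall k h, dom h -> E (u k) h = sg k * ip (u k) h.
Hypothesis monou : forall i j, (i <= j)%N -> sg i <= sg j.
Hypothesis totalu : forall m f, S f -> dom f ->
  (forall h, dom h -> E f h = m * ip f h) ->
  (forall k, ip f (u k) = 0) -> ip f f = 0.

(** The splitting is orthogonal for [ip] and for [E] alike, so projection to [S] preserves the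
    eigenvector equation. *)
Lemma projected_eigenvector m f n : dom f -> dom n -> S (f - n) ->
  (forall h, S h -> ip h n = 0) -> (forall h, S h -> dom h -> E h n = 0) ->
  (forall h, dom h -> E f h = m * ip f h) ->
  forall h, dom h -> E (f - n) h = m * ip (f - n) h.
Proof.
move=> df dn Sp ipn En ef h dh.
have [n' [dn' Sp' ipn' En']] := splitS dh.
have dp : dom (f - n) by exact: (psdB_closed psdE).
have dp' : dom (h - n') by exact: (psdB_closed psdE).
have Lf := domL df; have Ln := domL dn; have Lh := domL dh; have Ln' := domL dn'.
have Lp := SL Sp; have Lp' := SL Sp'.
have -> : E (f - n) h = E (f - n) (h - n').
  by rewrite (psdBr psdE dh dn' dp) (En' _ Sp dp) subr0.
rewrite (psdBl psdE df dn dp') (psdC psdE dn dp') (En _ Sp' dp') subr0 ef//.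
congr (_ * _).
have -> : ip (f - n) h = ip (f - n) (h - n').
  by rewrite (psdBr psdL Lh Ln' Lp) (ipn' _ Sp) subr0.
by rewrite (psdBl psdL Lf Ln Lp') (psdC psdL Ln Lp') (ipn _ Sp') subr0.
Qed.

Lemma subspace_lower_bound k f : S f -> dom f ->
  (forall i, (i < k)%N -> ip f (u i) = 0) -> sg k * ip f f <= E f f.
Proof.
move=> Sf df fu; have Lf := SL Sf.
apply: (spectral_lower_bound psdL psdE domL oe dome eigen complL total) => // j sj.
have [n [dn Sp ipn En]] := splitS (dome j).
set p := e j - n in Sp; have dp : dom p by exact: (psdB_closed psdE).
have Lp := SL Sp; have Lj := domL (dome j); have Ln := domL dn.
have eigp := projected_eigenvector (dome j) dn Sp ipn En (eigen j).
have -> : ip f (e j) = ip f p.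
  by rewrite (psdBr psdL Lj Ln Lf) (ipn _ Sf) subr0.
pose c i := ip p (u i).
(* Symmetry of [E] evaluates the form at [p] and [u i] in two ways: eigenvectors for different
   eigenvalues are orthogonal. *)
have ce i : c i * (sg i - s j) = 0.
  have h := eigp _ (domu i); have := eigenu i dp.
  rewrite (psdC psdE (domu i) dp) h -/p (psdC psdL (domL (domu i)) Lp) => /eqP.
  by rewrite -subr_eq0 -mulrBl mulf_eq0 subr_eq0 => /orP[/eqP ->|/eqP ci];
    rewrite ?subrr ?mulr0// /c ci mul0r.
have c0 i : (k <= i)%N -> c i = 0.
  move=> ki; have /eqP := ce i; rewrite mulf_eq0 subr_eq0 => /orP[/eqP //|/eqP sgi].
  by have := lt_le_trans sj (monou ki); rewrite sgi ltxx.
pose q := partial_sum u c k; have Lq : L q by exact: (partial_sum_closed psdL ou).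
have dq : dom q by apply: (psd_sum_closed psdE) => i; exact: domu.
have S0 : S 0 by have := S_linear (-1) Sf Sf; rewrite scaleN1r addNr.
have Sq : S q.
  rewrite /q /partial_sum; elim/big_ind : _ => //.
    by move=> x y Sx Sy; have := S_linear 1 Sx Sy; rewrite scale1r.
  by move=> i _; have := S_linear (c i) (Su i) S0; rewrite addr0.
have Sw : S (p - q) by have := S_linear (-1) Sq Sp; rewrite scaleN1r addrC.
have dw : dom (p - q) by exact: (psdB_closed psdE).
(* By [ce] the terms of [q] that remain have eigenvalue [s j], so [p - q] satisfies the same
   equation as [p]; it is orthogonal to all [u i]. *)
have w0 : ip (p - q) (p - q) = 0.
  apply: (totalu (m := s j)) => //.
    move=> h dh; have Lh := domL dh.
    rewrite (psdBl psdE dp dq dh) (psdBl psdL Lp Lq Lh) mulrBr -eigp//.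
    congr (_ - _); rewrite /q /partial_sum (psd_suml psdE _ (fun i => domu i) dh).
    rewrite (psd_suml psdL _ (fun i => domL (domu i)) Lh).
    rewrite mulr_sumr; apply: eq_bigr => i _; rewrite eigenu// mulrA [RHS]mulrA.
    congr (_ * _); apply/eqP; rewrite [s j * _]mulrC -subr_eq0 -mulrBr.
    exact/eqP/ce.
  move=> i; have Li := domL (domu i).
  rewrite (psdBl psdL Lp Lq Li) (partial_sum_coef psdL ou).
  by case: ltnP => [ik|/c0 ci]; rewrite ?subrr// subr0 -/(c i) ci.
have Lw := SL Sw.
have pE : p = (p - q) + q by rewrite subrK.
rewrite pE (psdDr psdL Lw Lq Lf) (psdC psdL Lf Lw) (psd_null psdL Lw Lf w0) add0r.
rewrite (partial_sum_dot psdL ou)// big1// => i _.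
by rewrite fu ?mulr0.
Qed.

End invariant_subspace.

Section eigen_data.
Context {R : realType} {T : Type}.
Local Notation fct := (T -> R).
Variables (L dom : set fct) (ip E : fct -> fct -> R).
Hypotheses (psdL : psd_form L ip) (domL : dom `<=` L).
Local Notation A := (form_operator L ip dom E).

Lemma eigenvector_formP mu f : eigenvector A mu f <->
  dom f /\ forall h, dom h -> E f h = - mu * ip f h.
Proof.
have E1 h : L f -> dom h -> ip (fun x => mu * f x) h = mu * ip f h.
  by move=> Lf dh; have := psdZl psdL mu Lf (domL dh).
split => [[df Lmf hf]|[df hf]].
  split => // h dh; apply/eqP; rewrite -eqr_opp mulNr opprK hf// E1//.
  exact: domL.
split => //; first by have := psdZ_closed psdL mu (domL df).
by move=> h dh; rewrite hf// E1 ?mulNr ?opprK//; exact: domL.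
Qed.

Lemma eigenvalues_in_data (S : set fct) lam : S `<=` L ->
  eigenvalues_in ip A S lam -> exists u : nat -> fct,
  [/\ orthonormal_seq L ip u, forall k, S (u k) /\ dom (u k),
      forall k h, dom h -> E (u k) h = - lam k * ip (u k) h,
      forall i j, (i <= j)%N -> - lam i <= - lam j &
      forall m f, S f -> dom f -> (forall h, dom h -> E f h = m * ip f h) ->
        (forall k, ip f (u k) = 0) -> ip f f = 0].
Proof.
move=> SL [u [mono hu ou tot]]; exists u.
have eu k : dom (u k) /\ forall h, dom h -> E (u k) h = - lam k * ip (u k) h.
  by apply/eigenvector_formP; have [] := hu k.
split.
- by split => // k; apply: SL; have [] := hu k.
- by move=> k; split; [have [] := hu k|have [] := eu k].
- by move=> k; have [] := eu k.
- by move=> i j ij; rewrite lerN2 mono.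
- move=> m f Sf df hf; apply: (tot (- m)) => //.
  by apply/eigenvector_formP; split => // h dh; rewrite opprK hf.
Qed.

Lemma discrete_spectrum_data lam : discrete_spectrum L ip A lam ->
  exists e : nat -> fct,
  [/\ orthonormal_seq L ip e, forall k, dom (e k),
      forall k h, dom h -> E (e k) h = - lam k * ip (e k) h,
      forall i j, (i <= j)%N -> - lam i <= - lam j &
      (forall f, L f -> (forall k, ip f (e k) = 0) -> ip f f = 0) /\
      forall c, exists N, c < - lam N].
Proof.
move=> [e [[mono he oe _] divl tot]]; exists e.
have ee k : dom (e k) /\ forall h, dom h -> E (e k) h = - lam k * ip (e k) h.
  by apply/eigenvector_formP; have [] := he k.
split.
- by split => // k; have [] := he k.
- by move=> k; have [] := ee k.
- by move=> k; have [] := ee k.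
- by move=> i j ij; rewrite lerN2 mono.
split => // c; have /cvgrNyPlt /(_ (- c)) [N _ hN] := divl.
by exists N; rewrite ltrNr; apply: hN => /=.
Qed.

End eigen_data.

(** * Inequalities between the spectra *)

Section main.
Context {R : realType} {d : nat}.
Local Notation V := 'rV[R]_d.
Variables (tau : R) (tau_gt0 : 0 < tau).
Local Notation I := (`[0, tau]%classic : set (measurableTypeR R)).
Local Notation leb := (@lebesgue_measure R).
Local Notation mu := (lebesgue_rV d).
Variables (G M D : set V).
Hypotheses (hM : flat_manifold G M) (hD : fundamental_domain G D).
Local Notation L0 := (L2_M0 tau M D).
Local Notation ip0 := (ip_M0 tau M D).
Local Notation L := (L2_M M D).
Local Notation ip := (ip_M M D).
Local Notation H1 := (H1_M G M D).
Local Notation H10 := (H1_M0 tau G M D).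
Local Notation Sspat := (S0_spat tau M D).
Variables (v phi : R -> V -> V).
Hypotheses (hv : velocity_field tau G v) (hphi : flow_map tau M v phi).
Local Notation E := (inflated_form tau G M D phi).
Local Notation Edyn := (dynamic_form tau G M D phi).
Let psdL := L2_M_psd M D.
Let psdL0 := L2_M0_psd tau M D.
Let psdE a := inflated_form_psd tau_gt0 hM hD hv hphi a.
Let psdEdyn := dynamic_form_psd tau_gt0 hM hD hv hphi.
Let H1L : H1 `<=` L. Proof. by move=> f; case. Qed.
Let H10L : H10 `<=` L0. Proof. by move=> f; case. Qed.
Let complL : psd_complete L ip.
Proof. exact: (L2_on_complete (flat_domain_measurable hM hD)). Qed.
Let complL0 : psd_complete L0 ip0.
Proof.
apply: (@L2_on_complete _ _ _ (leb \x mu)%E).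
by apply: measurableX; [exact: measurable_time|exact: (flat_domain_measurable hM hD)].
Qed.
Let liftX := @lift_space_L2 R d tau tau_gt0 G M D hM hD.

Let SspatL : Sspat `<=` L0. Proof. by move=> f; case. Qed.

Lemma S0_spat_linear (c : R) f g : Sspat f -> Sspat g -> Sspat (c *: f + g).
Proof.
move=> [Lf hf] [Lg hg]; split; first exact: (psd_closed psdL0).
move=> h Th; have Lh : L0 h.
  by have [b [Lb _ ->]] := Th; exact: (lift_time_L2 hM hD).
by rewrite (psd_linear psdL0)// hf// hg// mulr0 addr0.
Qed.

Lemma inflated_form_mono a b f : 0 < a -> a <= b -> H10 f -> E a f f <= E b f f.
Proof.
move=> a0 ab Hf; rewrite !(inflated_formE hM hD hv hphi)// lerD2r ler_wpM2r//.
  by apply: (psd_ge0 psdL0); exact: W_L.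
by rewrite ler_pXn2r// ?nnegrE// ltW// (lt_le_trans a0).
Qed.

Lemma inflated_form_lift a f : H1 f ->
  E a (fun p => f p.2) (fun p => f p.2) = tau * Edyn f f.
Proof.
move=> Hf; have Lf := H1L Hf; have Hlf := lift_H1 tau_gt0 hM hD Hf.
rewrite (inflated_formE hM hD hv hphi)// (dynamic_form_lift tau_gt0 hM hD hv hphi)//.
rewrite mulrA mulfV ?gt_eqF// mul1r.
have ht := lift_wd_time tau_gt0 hM hD Lf.
rewrite (wd_ip2 psdL0 (test_M0_sub_L2 tau_gt0 hM hD) (M0_fundamental tau_gt0 hM hD) Hlf Hlf ht ht).
by rewrite (psd0l psdL0) ?mulr0 ?add0r//; exact: (psd0 psdL0).
Qed.

Variables (lamD : nat -> R) (Lam Lam_spat : R -> nat -> R).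
Hypothesis hlamD : discrete_spectrum L ip (dynamic_laplacian tau G M D phi)
  (fun k => lamD k.+1).
Hypothesis hLam : forall a, 0 < a -> discrete_spectrum L0 ip0
  (inflated_laplacian tau G M D phi a) (fun k => Lam a k.+1).
Hypothesis hLam_spat : forall a, 0 < a -> eigenvalues_in ip0
  (inflated_laplacian tau G M D phi a) Sspat (fun k => Lam_spat a k.+1).

(** If the volume were 0, every function would be null, against the existence of a unit
    eigenvector. *)
Let vol_gt0 : 0 < ip (cst 1) (cst 1).
Proof.
have [e [[Le oe] _ _ _ _]] := discrete_spectrum_data psdL H1L hlamD.
have L1 : L (cst 1) by exact: (cst_L2 hM hD).
rewrite lt_neqAle (psd_ge0 psdL)// andbT; apply/eqP => /esym v0.
have mMD := flat_domain_measurable hM hD.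
have ae1 := ip_on_ae mMD L1 v0.
have : ip (e 0%N) (e 0%N) = 0.
  apply: (ae_ip_on mMD (Le 0%N)); apply: filterS ae1 => x h MDx.
  by have /eqP := h MDx; rewrite oner_eq0.
by rewrite oe => /eqP; rewrite oner_eq0.
Qed.

Lemma full_bound a : 0 < a -> exists e,
  [/\ orthonormal_seq L0 ip0 e, forall k, H10 (e k),
      forall k h, H10 h -> E a (e k) h = - Lam a k.+1 * ip0 (e k) h,
      forall i j, (i <= j)%N -> - Lam a i.+1 <= - Lam a j.+1 &
      [/\ (forall f, L0 f -> (forall k, ip0 f (e k) = 0) -> ip0 f f = 0),
          (forall c, exists N, c < - Lam a N.+1) &
          forall k f, H10 f -> (forall i, (i < k)%N -> ip0 f (e i) = 0) ->
            - Lam a k.+1 * ip0 f f <= E a f f]].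
Proof.
move=> a0; have [e [oe de ee mono [tot div]]] := discrete_spectrum_data psdL0 H10L (hLam a0).
exists e; split => //; split => // k f Hf hf.
apply: (spectral_lower_bound psdL0 (psdE a) H10L oe de ee complL0 tot) => // j sj.
apply: hf; rewrite ltnNge; apply/negP => kj.
by have := lt_le_trans sj (mono _ _ kj); rewrite ltxx.
Qed.

(** The invariant subspace is that of the spatial functions; the complement component of [h] is its
    centered average. *)
Lemma spat_bound a : 0 < a -> exists u,
  [/\ orthonormal_seq L0 ip0 u, forall k, Sspat (u k) /\ H10 (u k),
      forall k h, H10 h -> E a (u k) h = - Lam_spat a k.+1 * ip0 (u k) h,
      forall i j, (i <= j)%N -> - Lam_spat a i.+1 <= - Lam_spat a j.+1 &
      forall k f, Sspat f -> H10 f -> (forall i, (i < k)%N -> ip0 f (u i) = 0) ->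
            - Lam_spat a k.+1 * ip0 f f <= E a f f].
Proof.
move=> a0; have [e [oe de ee mono [tot div]]] := discrete_spectrum_data psdL0 H10L (hLam a0).
have [u [ou Su eu monou totu]] := eigenvalues_in_data psdL0 H10L SspatL (hLam_spat a0).
exists u; split => // k f Sf Hf hf.
apply: (subspace_lower_bound psdL0 (psdE a) H10L complL0 oe de ee tot SspatL
  S0_spat_linear _ ou _ _ eu monou totu Sf Hf hf).
- move=> h Hh; exists (fun p => centered_average tau M D h p.1); split.
  + exact: (centered_average_H1 tau_gt0 hM hD).
  + exact: (subtract_average_spat tau_gt0 hM hD vol_gt0 (H10L Hh)).
  + move=> g [_ hg]; apply: hg.
    exact: (centered_average_temp tau_gt0 hM hD (H10L Hh)).
  + move=> g Sg Hg.
    exact: (spat_average_form tau_gt0 hM hD vol_gt0 hv hphi).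
- by move=> j; have [] := Su j.
- by move=> j; have [] := Su j.
Qed.

Lemma dyn_bound : exists e,
  [/\ orthonormal_seq L ip e, forall k, H1 (e k),
      forall k h, H1 h -> Edyn (e k) h = - lamD k.+1 * ip (e k) h,
      forall i j, (i <= j)%N -> - lamD i.+1 <= - lamD j.+1 &
      forall k f, H1 f -> (forall i, (i < k)%N -> ip f (e i) = 0) ->
        - lamD k.+1 * ip f f <= Edyn f f].
Proof.
have [e [oe de ee mono [tot div]]] := discrete_spectrum_data psdL H1L hlamD.
exists e; split => // k f Hf hf.
apply: (spectral_lower_bound psdL psdEdyn H1L oe de ee complL tot) => // j sj.
apply: hf; rewrite ltnNge; apply/negP => kj.
by have := lt_le_trans sj (mono _ _ kj); rewrite ltxx.
Qed.

Lemma lamD_le_Lam_spat a k : 0 < a -> lamD k.+1 <= Lam_spat a k.+1.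
Proof.
move=> a0; rewrite -lerN2.
have [e [oe de ee mono _]] := dyn_bound.
have [u [[Lu ou] Su eu _ low]] := spat_bound a0.
have L1 : L2_on leb I (cst 1) by exact: time_cst_L2.
(* The lift of f is orthogonal to [u j] exactly when f is orthogonal to the time integral of
   [u j]. *)
apply: (min_max psdL psdEdyn H1L oe de ee mono
  (g := fun j : 'I_k => slice1 leb I (u j) (cst 1))).
  by move=> j; exact: (tslice_L2 hM hD).
move=> c hc; set f := partial_sum e c k.+1.
have Hf : H1 f by exact: (partial_sum_dom psdEdyn de).
have Lf := H1L Hf.
rewrite -(ler_pM2l tau_gt0) -(inflated_form_lift a Hf) mulrCA -(lift_ip tau_gt0 hM hD Lf Lf).
apply: low => [| |i ik].
- exact: (S0_spat_lift tau_gt0 hM hD).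
- exact: lift_H1.
rewrite (psdC psdL0 (liftX Lf) (Lu i)) (tslice_ip1 tau_gt0 hM hD (Lu i) Lf).
have Ls : L (slice1 leb I (u i) (cst 1)) by exact: (tslice_L2 hM hD).
by rewrite (psdC psdL Ls Lf); exact: (hc (Ordinal ik)).
Qed.

Lemma Lam_nonincreasing a b k : 0 < a -> a <= b -> Lam b k.+1 <= Lam a k.+1.
Proof.
move=> a0 ab; have b0 := lt_le_trans a0 ab; rewrite -lerN2.
have [e [oe de ee mono _]] := full_bound b0.
have [e' [[Le' _] _ _ _ [_ _ low]]] := full_bound a0.
apply: (min_max psdL0 (psdE b) H10L oe de ee mono (g := fun j : 'I_k => e' j)) => //.
move=> c hc; have Hf : H10 (partial_sum e c k.+1) by exact: (partial_sum_dom (psdE b) de).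
apply: le_trans (inflated_form_mono a0 ab Hf).
by apply: low => // i ik; exact: (hc (Ordinal ik)).
Qed.

Lemma S0_spat_partial_sum u (c : nat -> R) k : (forall i, Sspat (u i)) ->
  Sspat (partial_sum u c k).
Proof.
move=> Su; have S0 : Sspat 0.
  by have := S0_spat_linear (-1) (Su 0%N) (Su 0%N); rewrite scaleN1r addNr.
rewrite /partial_sum; elim/big_ind : _ => //.
  by move=> x y Sx Sy; have := S0_spat_linear 1 Sx Sy; rewrite scale1r.
by move=> i _; have := S0_spat_linear (c i) (Su i) S0; rewrite addr0.
Qed.

Lemma Lam_spat_nonincreasing a b k : 0 < a -> a <= b ->
  Lam_spat b k.+1 <= Lam_spat a k.+1.
Proof.
move=> a0 ab; have b0 := lt_le_trans a0 ab; rewrite -lerN2.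
have [e [oe Se ee mono _]] := spat_bound b0.
have de i : H10 (e i) by have [] := Se i.
have [e' [[Le' _] _ _ _ low]] := spat_bound a0.
apply: (min_max psdL0 (psdE b) H10L oe de ee mono (g := fun j : 'I_k => e' j)) => //.
move=> c hc; have Hf : H10 (partial_sum e c k.+1) by exact: (partial_sum_dom (psdE b) de).
apply: le_trans (inflated_form_mono a0 ab Hf).
apply: low => //.
  by apply: S0_spat_partial_sum => i; have [] := Se i.
by move=> i ik; exact: (hc (Ordinal ik)).
Qed.

Lemma Lam_spat_le_Lam a k : 0 < a -> Lam_spat a k.+1 <= Lam a k.+1.
Proof.
move=> a0; rewrite -lerN2.
have [e [oe Se ee mono _]] := spat_bound a0.
have de i : H10 (e i) by have [] := Se i.
have [e' [[Le' _] _ _ _ [_ _ low]]] := full_bound a0.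
apply: (min_max psdL0 (psdE a) H10L oe de ee mono (g := fun j : 'I_k => e' j)) => //.
move=> c hc; have Hf : H10 (partial_sum e c k.+1) by exact: (partial_sum_dom (psdE a) de).
by apply: low => // i ik; exact: (hc (Ordinal ik)).
Qed.

End main.

(** * The large diffusion limit *)

Section tail_bound.
Context {R : realType} {U : lmodType R}.
Variables (L dom : set U) (ip E : U -> U -> R).
Hypotheses (psdL : psd_form L ip) (psdE : psd_form dom E) (domL : dom `<=` L).
Hypothesis complL : psd_complete L ip.
Variables (e : nat -> U) (s : nat -> R).
Hypothesis oe : orthonormal_seq L ip e.
Hypothesis dome : forall k, dom (e k).
Hypothesis eigen : forall k h, dom h -> E (e k) h = s k * ip (e k) h.
Hypothesis mono : forall i j, (i <= j)%N -> s i <= s j.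
Hypothesis total : forall f, L f -> (forall k, ip f (e k) = 0) -> ip f f = 0.

(** What remains of [f] after N terms has energy at most m and is orthogonal to the first N
    eigenvectors, so its mass is at most [m / s N]. The bound is the same for all functions of
    energy at most m. *)
Lemma tail_bound N f m : dom f -> E f f <= m -> 0 < s N ->
  ip f f - m / s N <= \sum_(i < N) ip f (e i) ^+ 2.
Proof.
move=> df Ef sN; have Lf := domL df.
pose q := partial_sum e (fun i => ip f (e i)) N.
have Lq : L q by exact: (partial_sum_closed psdL oe).
have dq : dom q by exact: (partial_sum_dom psdE dome).
have dr : dom (f - q) by exact: (psdB_closed psdE).
have Er : E (f - q) (f - q) <= m.
  rewrite (form_residual psdL psdE domL oe dome eigen N df) lerBlDr.
  apply: le_trans Ef _; rewrite lerDl sumr_ge0// => i _.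
  by rewrite mulr_ge0 ?sqr_ge0// (eigenvalue_ge0 psdE oe dome eigen).
have low : s N * ip (f - q) (f - q) <= E (f - q) (f - q).
  apply: (spectral_lower_bound psdL psdE domL oe dome eigen complL total) => // j sj.
  have jN : (j < N)%N.
    by rewrite ltnNge; apply/negP => Nj; have := lt_le_trans sj (mono Nj); rewrite ltxx.
  have Lj := domL (dome j).
  by rewrite (psdBl psdL Lf Lq Lj) (partial_sum_coef psdL oe) jN subrr.
rewrite (bessel_eq psdL oe N Lf) in low.
rewrite lerBlDr addrC -lerBlDr ler_pdivlMr// mulrC.
exact: le_trans low Er.
Qed.

End tail_bound.

Lemma cvg_sumR (R : realType) (J : Type) (F : set_system J) {FF : Filter F}
    (I : Type) (r : seq I) (f : I -> J -> R) (l : I -> R) :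
  (forall i, f i x @[x --> F] --> l i) ->
  \sum_(i <- r) f i x @[x --> F] --> \sum_(i <- r) l i.
Proof.
move=> fl; elim: r => [|i r IH].
  by under eq_fun do rewrite big_nil; rewrite big_nil; exact: cvg_cst.
under eq_fun do rewrite big_cons.
by rewrite big_cons; apply: cvgD; [exact: fl|exact: IH].
Qed.

Section large_diffusion.
Context {R : realType} {d : nat}.
Local Notation V := 'rV[R]_d.
Variables (tau : R) (tau_gt0 : 0 < tau).
Local Notation leb := (@lebesgue_measure R).
Variables (G M D : set V).
Hypotheses (hM : flat_manifold G M) (hD : fundamental_domain G D).
Local Notation L0 := (L2_M0 tau M D).
Local Notation ip0 := (ip_M0 tau M D).
Local Notation L := (L2_M M D).
Local Notation ip := (ip_M M D).
Local Notation T0 := (test_M0 tau G M).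
Local Notation wd0 := (is_weak_derivative L0 ip0 T0).
Local Notation W0 := (weak_derivative L0 ip0 T0).
Local Notation H1 := (H1_M G M D).
Local Notation H10 := (H1_M0 tau G M D).
Variables (v phi : R -> V -> V).
Hypotheses (hv : velocity_field tau G v) (hphi : flow_map tau M v phi).
Local Notation E := (inflated_form tau G M D phi).
Local Notation Edyn := (dynamic_form tau G M D phi).
Local Notation Q := (grad_form tau G M D phi).
Local Notation c := (metric_coef phi).
Local Notation space_dir i := ((0 : R), delta_mx ord0 i : V).
Let psdL0 := L2_M0_psd tau M D.
Let psdE a := inflated_form_psd tau_gt0 hM hD hv hphi a.
Let psdQ := grad_form_psd tau_gt0 hM hD hv hphi.
Let H10L : H10 `<=` L0. Proof. by move=> f; case. Qed.
Let complL0 : psd_complete L0 ip0.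
Proof.
apply: (@L2_on_complete _ _ _ (leb \x lebesgue_rV d)%E).
by apply: measurableX; [exact: measurable_time|exact: (flat_domain_measurable hM hD)].
Qed.
Let liftX := @lift_space_L2 R d tau tau_gt0 G M D hM hD.
Let TL0 := test_M0_sub_L2 tau_gt0 hM hD.
Let TD0 := @test_M0_derive R d tau G M.
Let Tsm0 := @test_M0_smooth R d tau G M.

Variables (F : nat -> R * V -> R) (m : R).
Hypothesis HF : forall n, H10 (F n).
Hypothesis F1 : forall n, ip0 (F n) (F n) = 1.
Hypothesis EF : forall n, E n.+1%:R (F n) (F n) <= m.

Let LF n : L0 (F n). Proof. exact/H10L/HF. Qed.
Let LWF n u : L0 (W0 u (F n)). Proof. exact: W_L (HF n). Qed.

Let energy_split n : n.+1%:R ^+ 2 * ip0 (W0 (1, 0) (F n)) (W0 (1, 0) (F n)) +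
  Q (F n) (F n) <= m.
Proof. by rewrite -(inflated_formE hM hD hv hphi)//; exact: EF. Qed.

Let QF n : Q (F n) (F n) <= m.
Proof.
apply: le_trans (energy_split n); rewrite lerDr mulr_ge0 ?sqr_ge0//.
exact: (psd_ge0 psdL0 (LWF n _)).
Qed.

Let m_ge0 : 0 <= m.
Proof. exact: le_trans (psd_ge0 psdQ (HF 0%N)) (QF 0%N). Qed.

Let time_derivative_small n :
  ip0 (W0 (1, 0) (F n)) (W0 (1, 0) (F n)) <= m / n.+1%:R ^+ 2.
Proof.
rewrite ler_pdivlMr ?exprn_gt0// mulrC.
apply: le_trans (energy_split n); rewrite lerDl.
exact: (psd_ge0 psdQ (HF n)).
Qed.

Let gradient_bounded : exists C, forall n i,
  ip0 (W0 (space_dir i) (F n)) (W0 (space_dir i) (F n)) <= C.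
Proof.
have [k k0 hk] := @metric_elliptic R d tau G M D hM hD v phi hv hphi.
exists (k * m) => n i.
apply: (@le_trans _ _ (\sum_i ip0 (W0 (space_dir i) (F n)) (W0 (space_dir i) (F n)))).
  rewrite (bigD1 i)//= lerDl sumr_ge0// => j _.
  exact: (psd_ge0 psdL0 (LWF n _)).
apply: le_trans (hk (fun i => W0 (space_dir i) (F n)) (fun i => LWF n _)) _.
by rewrite ler_pM2l//; exact: (QF n).
Qed.

Variables (e : nat -> R * V -> R) (s : nat -> R).
Hypothesis oe : orthonormal_seq L0 ip0 e.
Hypothesis dome : forall k, H10 (e k).
Hypothesis eigen : forall k h, H10 h -> E 1 (e k) h = s k * ip0 (e k) h.
Hypothesis mono : forall i j, (i <= j)%N -> s i <= s j.
Hypothesis total : forall f, L0 f -> (forall k, ip0 f (e k) = 0) -> ip0 f f = 0.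
Hypothesis unbounded : forall c, exists N, c < s N.

Let E1F n : E 1 (F n) (F n) <= m.
Proof.
apply: le_trans (EF n).
by apply: (inflated_form_mono hM hD hv hphi ltr01 _ (HF n)); rewrite ler1n.
Qed.

(** [P] carries the orthogonality constraints on the sequence; they are linear, so they survive the
    weak limit. *)
Lemma large_diffusion_limit (P : set (R * V -> R)) : P `<=` L0 ->
  (forall n h, P h -> ip0 (F n) h = 0) ->
  exists f, [/\ H1 f, 0 < ip f f, Edyn f f <= m * ip f f &
    forall h, L h -> P (fun p => h p.2) -> ip f h = 0].
Proof.
move=> PL FP.
(* [U] refines the filter at infinity, so ordinary limits such as that of the time derivatives
   remain limits along it. *)
have [U [UU leU]] := ultraFilterLemma (@eventually_filter).
have PU : ProperFilter U by exact: ultra_proper.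
have F_le n : ip0 (F n) (F n) <= 1 by rewrite F1.
have [w Lw cw] := weak_compactness psdL0 complL0 oe total LF F_le.
have [C hC] := gradient_bounded.
have /choice[g hg] (i : 'I_d) : exists g, L0 g /\ forall h, L0 h ->
    ip0 (W0 (space_dir i) (F n)) h @[n --> U] --> ip0 g h.
  have [g Lg cg] := weak_compactness psdL0 complL0 oe total (F := U)
    (fun n => LWF n (space_dir i)) (fun n => hC n i).
  by exists g.
have Lg i : L0 (g i) by have [] := hg i.
have cg i h : L0 h -> ip0 (W0 (space_dir i) (F n)) h @[n --> U] --> ip0 (g i) h.
  by have [_] := hg i; exact.
have time0 h : L0 h -> ip0 (W0 (1, 0) (F n)) h @[n --> U] --> (0 : R).
  move=> Lh; have [C0 C0_ge0 C0m] : exists2 C0, 0 <= C0 & C0 ^+ 2 = m * ip0 h h.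
    exists (Num.sqrt (m * ip0 h h)); first exact: sqrtr_ge0.
    by rewrite sqr_sqrtr// mulr_ge0// (psd_ge0 psdL0 Lh).
  have bnd n : `|ip0 (W0 (1, 0) (F n)) h| <= C0 * n.+1%:R^-1.
    rewrite -(@ler_pXn2r _ 2)// ?nnegrE ?mulr_ge0//.
    rewrite real_normK ?num_real// exprMn C0m exprVn.
    apply: le_trans (cauchy_schwarz psdL0 (LWF n _) Lh) _.
    rewrite [leRHS]mulrAC.
    by apply: ler_wpM2r; [exact: (psd_ge0 psdL0 Lh)|exact: (time_derivative_small n)].
  suff lim0 : ip0 (W0 (1, 0) (F n)) h @[n --> \oo] --> (0 : R).
    by move=> A /lim0 hA; exact: leU.
  apply/cvgr0Pnorm_le => eps eps0.
  have : C0 * n.+1%:R^-1 @[n --> \oo] --> (C0 * 0 : R).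
    by apply: cvgM; [exact: cvg_cst|exact: cvg_harmonic].
  rewrite mulr0 => /cvgr0Pnorm_le /(_ _ eps0); apply: filterS => n.
  by apply: le_trans; apply: le_trans (bnd n) (ler_norm _).
have wt : wd0 (1, 0) w 0.
  split; first exact: (psd0 psdL0).
  move=> psi Tpsi; have Lpsi := TL0 Tpsi; have LD := TL0 (TD0 (1, 0) Tpsi).
  rewrite (psd0l psdL0)// oppr0.
  apply: (cvg_unique _ (cw _ LD)) => //.
  have -> : (fun n => ip0 (F n) ('D_(1, 0) psi)) = (fun n => - ip0 (W0 (1, 0) (F n)) psi).
    apply/funext => n.
    by have [_ ->//] : wd0 (1, 0) (F n) (W0 (1, 0) (F n)) := H1_wd _ (HF n).
  by rewrite -oppr0; apply: cvgN; exact: time0.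
have wg i : wd0 (space_dir i) w (g i).
  split => // psi Tpsi; have Lpsi := TL0 Tpsi; have LD := TL0 (TD0 (space_dir i) Tpsi).
  apply: (cvg_unique _ (cw _ LD)) => //.
  have -> : (fun n => ip0 (F n) ('D_(space_dir i) psi)) =
      (fun n => - ip0 (W0 (space_dir i) (F n)) psi).
    by apply/funext => n; have [_ ->//] := @H1_wd _ _ _ _ _ (space_dir i) _ (HF n).
  by apply: cvgN; exact: cg.
have Hw : H10 w.
  apply: (H10_intro tau_gt0 hM hD Lw wt) => u.
  exists (\sum_i (u : V) ord0 i *: g i); rewrite dir_decomp.
  exact: (wd_dir_sum psdL0 TL0 Tsm0 TD0 _ Lw wg).
have Lcg i j : L0 (fun p => c i j p * g j p).
  exact: (metric_coef_L2 hM hD hv hphi).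
have QwE : Q w w = \sum_i \sum_j ip0 (g i) (fun p => c i j p * g j p).
  rewrite (grad_form_wd tau_gt0 hM hD hv hphi Hw Hw wg wg).
  by apply: eq_bigr => i _; apply: eq_bigr => j _; rewrite metric_coef_move.
(* With [w] fixed and the coefficients moved to its side, the form is a finite sum of pairings of
   the weakly convergent gradients with fixed functions. *)
have cQ : Q (F n) w @[n --> U] --> Q w w.
  rewrite QwE.
  have -> : (fun n => Q (F n) w) = (fun n => \sum_i \sum_j
      ip0 (W0 (space_dir i) (F n)) (fun p => c i j p * g j p)).
    apply/funext => n.
    rewrite (grad_form_wd tau_gt0 hM hD hv hphi (HF n) Hw (fun i => H1_wd _ (HF n)) wg).
    by apply: eq_bigr => i _; apply: eq_bigr => j _; rewrite metric_coef_move.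
  by apply: cvg_sumR => i; apply: cvg_sumR => j; exact: cg.
have Qw : Q w w <= m.
  (* Positivity of [Q] at [F n - w]; only the mixed term, for which weak convergence suffices,
     depends on n. *)
  have half n : Q (F n) w *+ 2 - Q w w <= m.
    have := psd_ge0 psdQ (psdB_closed psdQ (HF n) Hw).
    rewrite (psd_sqB psdQ (HF n) Hw) => ge0.
    apply: le_trans (QF n); rewrite -subr_ge0; apply: le_trans ge0 _.
    by rewrite mulr_natl opprB addrA addrAC.
  have lim_le (x : nat -> R) y : x n @[n --> U] --> y ->
      (forall n, x n *+ 2 - y <= m) -> y <= m.
    move=> xy x_le; have xy2 : x n *+ 2 - y @[n --> U] --> y *+ 2 - y.
      by apply: cvgB; [apply: cvgMn|exact: cvg_cst].
    by rewrite mulr2n addrK in xy2; apply: (cvgr_to_le xy2); exact: nearW.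
  exact: (lim_le _ _ cQ half).
have tails N : 0 < s N -> 1 - m / s N <= ip0 w w.
  move=> sN; apply: le_trans (bessel psdL0 oe N Lw).
  have : \sum_(i < N) ip0 (F n) (e i) ^+ 2 @[n --> U] --> \sum_(i < N) ip0 w (e i) ^+ 2.
    by apply: cvg_sumR => i; apply: cvgM; apply: cw; exact: H10L.
  move=> /cvgr_to_ge; apply; apply: nearW => n; rewrite -(F1 n).
  exact: (tail_bound psdL0 (psdE 1) H10L complL0 oe dome eigen mono total (HF n) (E1F n) sN).
have w1 : 1 <= ip0 w w.
  rewrite leNgt; apply/negP => w_lt1; have w0 : 0 < 1 - ip0 w w by rewrite subr_gt0.
  (* For this N the lost mass [m / s N] is less than [1 - ip0 w w], against the tail bound. *)
  have [N hN] := unbounded (m / (1 - ip0 w w)).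
  have sN : 0 < s N by apply: le_lt_trans hN; rewrite divr_ge0// ltW.
  have := tails N sN; rewrite leNgt => /negP; apply.
  by rewrite ltrBrDl -ltrBrDr ltr_pdivrMr// mulrC -ltr_pdivrMr.
have [f [Hf fw]] := constant_in_time tau_gt0 hM hD Hw wt.
have Lf : L f := H1_L Hf.
have Lff : L0 (fun p => f p.2) := liftX Lf.
have ipff : tau * ip f f = ip0 w w.
  rewrite -(lift_ip tau_gt0 hM hD Lf Lf) -(psd_nullB psdL0 Lw Lff Lff fw).
  by rewrite (psdC psdL0 Lw Lff) -(psd_nullB psdL0 Lw Lff Lw fw).
have Hff := lift_H1 tau_gt0 hM hD Hf.
have Qff : tau * Edyn f f = Q w w.
  have tauK x y : x = tau^-1 * y -> tau * x = y.
    by move=> ->; rewrite mulrA divff ?mul1r// gt_eqF.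
  have EL := dynamic_form_lift tau_gt0 hM hD hv hphi Hf Hf.
  suff QE : Q (fun p => f p.2) (fun p => f p.2) = Q w w.
    exact: (tauK _ _ (etrans EL (congr1 (fun z => tau^-1 * z) QE))).
  have fg i := wd_null psdL0 TL0 TD0 Lw Lff fw (wg i).
  rewrite (grad_form_wd tau_gt0 hM hD hv hphi Hff Hff fg fg).
  by rewrite (grad_form_wd tau_gt0 hM hD hv hphi Hw Hw wg wg).
exists f; split => //.
- by rewrite -(pmulr_rgt0 _ tau_gt0) ipff (lt_le_trans ltr01).
(* The energy of [w] is at most [m], and [m <= m * ip0 w w] because the mass of [w] is at least
   1. *)
- rewrite -(ler_pM2l tau_gt0) Qff mulrCA ipff.
  by apply: le_trans Qw _; rewrite ler_peMr.
- move=> h Lh Ph; have Lhh := PL _ Ph.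
  apply: (mulfI (lt0r_neq0 tau_gt0)); rewrite mulr0 -(lift_ip tau_gt0 hM hD)//.
  rewrite -(psd_nullB psdL0 Lw Lff Lhh fw).
  apply: (cvg_unique _ (cw _ Lhh)) => //.
  have -> : (fun n => ip0 (F n) (fun p => h p.2)) = fun=> 0.
    by apply/funext => n; exact: FP.
  exact: cvg_cst.
Qed.

End large_diffusion.

(** * The temporal eigenvalues *)

Section temporal.
Context {R : realType}.
Variables (tau : R) (tau_gt0 : 0 < tau).

Lemma temporal_eigenvalue_nonincreasing k a b : 0 < a -> a <= b ->
  temporal_eigenvalue tau b k <= temporal_eigenvalue tau a k.
Proof.
move=> a0 ab; rewrite /temporal_eigenvalue lerN2.
rewrite ler_pXn2r// ?nnegrE ?divr_ge0 ?mulr_ge0 ?pi_ge0 ?ler0n ?(ltW a0) ?(ltW tau_gt0)//;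
  last by rewrite (le_trans (ltW a0)).
rewrite ler_pM2r ?invr_gt0// -!mulrA ler_wpM2r//.
by rewrite mulr_ge0 ?pi_ge0.
Qed.

Lemma temporal_eigenvalue_cvg k : (1 <= k)%N ->
  temporal_eigenvalue tau a k @[a --> +oo] --> -oo.
Proof.
move=> k1; set q := pi * k%:R / tau.
have q0 : 0 < q by rewrite divr_gt0// mulr_gt0 ?pi_gt0// ltr0n.
(* For [a >= 1] one has [a <= a ^+ 2], so it is enough that [a * q ^+ 2] exceeds [|A|]. *)
apply/cvgrNyPle => A; apply: filterS (nbhs_pinfty_ge (num_real (Num.max 1 (`|A| / q ^+ 2)))).
move=> a; rewrite ge_max => /andP[a1].
rewrite ler_pdivrMr ?exprn_gt0// => aA.
rewrite /temporal_eigenvalue lerNl; apply: le_trans (ler_norm (- A)) _; rewrite normrN.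
apply: le_trans aA _.
rewrite (_ : a * pi * k%:R / tau = a * q); last by rewrite /q !mulrA.
by rewrite (exprMn _ a) ler_pM2r ?exprn_gt0// expr2 ler_peMl// (le_trans ler01).
Qed.

End temporal.

(** * Passage to the limit *)

Section limits.
Context {R : realType} {d : nat}.
Local Notation V := 'rV[R]_d.
Variables (tau : R) (tau_gt0 : 0 < tau).
Variables (G M D : set V).
Hypotheses (hM : flat_manifold G M) (hD : fundamental_domain G D).
Local Notation L0 := (L2_M0 tau M D).
Local Notation ip0 := (ip_M0 tau M D).
Local Notation L := (L2_M M D).
Local Notation ip := (ip_M M D).
Local Notation H10 := (H1_M0 tau G M D).
Variables (v phi : R -> V -> V).
Hypotheses (hv : velocity_field tau G v) (hphi : flow_map tau M v phi).
Let psdL0 := L2_M0_psd tau M D.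
Let psdE a := inflated_form_psd tau_gt0 hM hD hv hphi a.
Let H10L : H10 `<=` L0. Proof. by move=> f; case. Qed.
Let liftX := @lift_space_L2 R d tau tau_gt0 G M D hM hD.
Variables (lamD : nat -> R) (Lam Lam_spat : R -> nat -> R).
Hypothesis hlamD : discrete_spectrum L ip (dynamic_laplacian tau G M D phi)
  (fun k => lamD k.+1).
Hypothesis hLam : forall a, 0 < a -> discrete_spectrum L0 ip0
  (inflated_laplacian tau G M D phi a) (fun k => Lam a k.+1).
Hypothesis hLam_spat : forall a, 0 < a -> eigenvalues_in ip0
  (inflated_laplacian tau G M D phi a) (S0_spat tau M D)
  (fun k => Lam_spat a k.+1).

Lemma Lam_limit_bound k m : (forall n, - Lam n.+1%:R k.+1 <= m) -> - lamD k.+1 <= m.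
Proof.
move=> Lm.
have [eD [[LeD _] HeD _ _ lowD]] := dyn_bound tau_gt0 hM hD hv hphi hlamD.
have [e1 [oe1 de1 ee1 mono1 [tot1 div1 _]]] :=
  full_bound tau_gt0 hM hD hv hphi hLam ltr01.
pose g (j : 'I_k) : R * V -> R := fun p => eD j p.2.
have Lg j : L0 (g j) by exact: (liftX (LeD j)).
have /choice[F hF] n : exists F, [/\ H10 F, ip0 F F = 1,
    inflated_form tau G M D phi n.+1%:R F F <= m & forall j, ip0 F (g j) = 0].
  have n0 : 0 < n.+1%:R :> R by [].
  have [e [oe de ee mono _]] := full_bound tau_gt0 hM hD hv hphi hLam n0.
  have [c [c1 hc]] := orthonormal_combination psdL0 oe Lg.
  exists (partial_sum e c k.+1); split => //.
  - exact: (partial_sum_dom (psdE n.+1%:R) de).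
  - by rewrite (partial_sum_sq psdL0 oe).
  - apply: le_trans (Lm n).
    exact: (form_partial_sum_le psdL0 (psdE n.+1%:R) H10L oe de ee mono c1).
have HF n : H10 (F n) by have [] := hF n.
have F1 n : ip0 (F n) (F n) = 1 by have [] := hF n.
have EF n : inflated_form tau G M D phi n.+1%:R (F n) (F n) <= m by have [] := hF n.
have Fg n j : ip0 (F n) (g j) = 0 by have [] := hF n.
have [||f [Hf f0 Ef fP]] := large_diffusion_limit tau_gt0 hM hD hv hphi HF F1 EF
  oe1 de1 ee1 mono1 tot1 div1 (P := range g).
- by move=> _ [j _ <-].
- by move=> n _ [j _ <-].
rewrite -(ler_pM2r f0); apply: le_trans Ef; apply: lowD => // i ik.
by apply: fP => //; exists (Ordinal ik).
Qed.

(** Both spectra lie between [lamD] and [Lam]. If [Lam] stayed [eps] above [lamD] at all integers,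
    the limit bound would give [lamD + eps <= lamD]; monotonicity in a passes from one integer to
    all larger a. *)
Lemma spectra_cvg k : (Lam_spat a k.+1 @[a --> +oo] --> lamD k.+1) /\
  (Lam a k.+1 @[a --> +oo] --> lamD k.+1).
Proof.
have sandwich a : 0 < a ->
    lamD k.+1 <= Lam_spat a k.+1 /\ Lam_spat a k.+1 <= Lam a k.+1.
  move=> a0; split; first exact: (lamD_le_Lam_spat tau_gt0 hM hD hv hphi hlamD hLam hLam_spat).
  exact: (Lam_spat_le_Lam tau_gt0 hM hD hv hphi hlamD hLam hLam_spat).
have upper eps : 0 < eps -> \forall a \near +oo, 0 < a /\ Lam a k.+1 <= lamD k.+1 + eps.
  move=> eps0; have [n hn] : exists n, Lam n.+1%:R k.+1 < lamD k.+1 + eps.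
    apply: contrapT => /forallNP nex.
    have : - lamD k.+1 <= - (lamD k.+1 + eps).
      apply: Lam_limit_bound => n; rewrite lerN2 leNgt; exact/negP/nex.
    by rewrite lerN2 -lerBrDl subrr leNgt eps0.
  apply: filterS (nbhs_pinfty_ge (num_real (n.+1%:R : R))) => a na.
  have n0 : 0 < n.+1%:R :> R by [].
  split; first exact: lt_le_trans na.
  apply: le_trans (ltW hn).
  exact: (Lam_nonincreasing tau_gt0 hM hD hv hphi hLam k n0 na).
split; apply/cvgrPdist_le => eps eps0; apply: filterS (upper _ eps0) => a [a0 ha];
  have [h1 h2] := sandwich a a0; rewrite distrC ger0_norm ?subr_ge0 ?lerBlDl//.
- exact: le_trans h2 ha.
- exact: le_trans h1 h2.
Qed.

End limits.

Theorem theorem7 (R : realType) (d : nat) (d_gt0 : (0 < d)%N)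
    (tau : R) (tau_gt0 : 0 < tau)
    (G M D : set 'rV[R]_d) (hM : flat_manifold G M)
    (hD : fundamental_domain G D)
    (v phi : R -> 'rV[R]_d -> 'rV[R]_d)
    (hv : velocity_field tau G v) (hphi : flow_map tau M v phi)
    (lamD : nat -> R) (Lam Lam_spat : R -> nat -> R)
    (hlamD : discrete_spectrum (L2_M M D) (ip_M M D)
       (dynamic_laplacian tau G M D phi) (fun k => lamD k.+1))
    (hLam : forall a, 0 < a -> discrete_spectrum
       (L2_M0 tau M D) (ip_M0 tau M D)
       (inflated_laplacian tau G M D phi a) (fun k => Lam a k.+1))
    (hLam_spat : forall a, 0 < a -> eigenvalues_in (ip_M0 tau M D)
       (inflated_laplacian tau G M D phi a) (S0_spat tau M D)
       (fun k => Lam_spat a k.+1)) :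
  [/\ forall (k : nat) (a : R), (1 <= k)%N -> 0 < a ->
        lamD k <= Lam_spat a k,
      forall (k : nat) (a b : R), (1 <= k)%N -> 0 < a -> a <= b ->
        [/\ Lam b k <= Lam a k,
            temporal_eigenvalue tau b k <= temporal_eigenvalue tau a k &
            Lam_spat b k <= Lam_spat a k],
      forall k : nat, (1 <= k)%N ->
        temporal_eigenvalue tau a k @[a --> +oo] --> -oo &
      forall k : nat, (1 <= k)%N ->
        (Lam_spat a k @[a --> +oo] --> lamD k) /\
        (Lam a k @[a --> +oo] --> lamD k)].
Proof.
split.
(* The spectra are listed from index 1; the value at 0 is unconstrained and is excluded by
   [1 <= k]. *)
- move=> [//|k] a _ a0.
  exact: (lamD_le_Lam_spat tau_gt0 hM hD hv hphi hlamD hLam hLam_spat).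
- move=> [//|k] a b _ a0 ab; split.
  + exact: (Lam_nonincreasing tau_gt0 hM hD hv hphi hLam).
  + exact: temporal_eigenvalue_nonincreasing.
  + exact: (Lam_spat_nonincreasing tau_gt0 hM hD hv hphi hlamD hLam hLam_spat).
- by move=> k k1; exact: temporal_eigenvalue_cvg.
- move=> [//|k] _.
  exact: (spectra_cvg tau_gt0 hM hD hv hphi hlamD hLam hLam_spat).
Qed.
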